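(* Let $G$ be a Carnot group of rank $r\ge2$ and let $\gamma:[0,T]\to G$, $T>0$, be a length-minimizing curve parametrized by arclength. Then there exists an infinitesimal sequence $\eta_i\downarrow0$ (of positive numbers) such that \[ \lim_{i\to\infty}\mathrm{Exc}(\gamma;[0,\eta_i])=0. \]
   Context: A Carnot group is a finite-dimensional connected, simply connected, nilpotent Lie group $G$ whose Lie algebra $\mathfrak g$ (of left-invariant vector fields) is stratified, i.e. equipped with a fixed decomposition $\mathfrak g=\mathfrak g_1\oplus\dots\oplus\mathfrak g_s$ with $\mathfrak g_j=[\mathfrak g_1,\mathfrak g_{j-1}]$ for $j=2,\dots,s$ and $[\mathfrak g,\mathfrak g_s]=\{0\}$. The integer $s$ is the step and $r=\dim\mathfrak g_1$ is the rank. $\mathfrak g$ carries a scalar product $\langle\cdot,\cdot\rangle$ with $\mathfrak g_i\perp\mathfrak g_j$ for $i\ne j$, $X_1,\dots,X_r$ is a fixed orthonormal basis of $\mathfrak g_1$, and $S^{r-1}$ is the set of unit vectors of $\mathfrak g_1$. A Lipschitz curve $\gamma:I\to G$ is horizontal if $\dot\gamma(t)=\sum_{i=1}^r h_i(t)X_i(\gamma(t))$ for a.e. $t\in I$, with $h_1,\dots,h_r\in L^\infty(I)$. Its length is $L(\gamma)=\int_I|h|\,dt$, $|h|=(h_1^2+\dots+h_r^2)^{1/2}$, and it is parametrized by arclength if $|h|=1$ a.e. The distance $d(x,y)$ is the infimum of the lengths of horizontal curves joining $x$ to $y$. A horizontal curve $\gamma:[a,b]\to G$ is length-minimizing if $L(\gamma)=d(\gamma(a),\gamma(b))$.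 Let $\pi:G\to\mathfrak g_1$ be the composition of $\exp^{-1}:G\to\mathfrak g$ with the projection $\mathfrak g\to\mathfrak g_1$ given by the stratification, and let $\underline\gamma=\pi\circ\gamma$, with derivative $\underline{\dot\gamma}$ (for a horizontal curve, $\underline{\dot\gamma}(t)=\sum_{i=1}^rh_i(t)X_i$ a.e.). The excess of a horizontal curve $\gamma:I\to G$ on a Borel set $B\subseteq I$ with $\mathcal L^1(B)>0$ is \[ \mathrm{Exc}(\gamma;B)=\inf_{v\in S^{r-1}}\Big(\frac1{\mathcal L^1(B)}\int_B\langle v,\underline{\dot\gamma}(t)\rangle^2\,dt\Big)^{1/2}. \] *)

(* Defs.v *)
From HB Require Import structures.
From mathcomp Require Import all_boot all_order all_algebra.
From mathcomp Require Import all_classical all_reals all_analysis.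

Set Implicit Arguments.
Unset Strict Implicit.
Unset Printing Implicit Defensive.

Import Order.TTheory GRing.Theory Num.Theory.
Import numFieldNormedType.Exports.

Local Open Scope classical_set_scope.
Local Open Scope ring_scope.

Section Smooth.
Context {R : realType} {U V : normedModType R}.

Fixpoint smooth_upto (k : nat) (f : U -> V) : Prop :=
  if k is k'.+1 then
    (forall x, differentiable f x) /\
    (forall v, smooth_upto k' (fun x => 'D_v f x))
  else continuous f.

Definition smooth (f : U -> V) : Prop := forall k, smooth_upto k f.

End Smooth.

(* A Lie group whose exponential map is a global diffeomorphism, as is the case
   for every connected, simply connected, nilpotent Lie group. Its Lie algebra
   is identified with R^n through a linear basis, and the smooth structure of
   the group is the one given by the global chart [lgexp]. The last field says
   that the curves t |-> lgexp (t *: u) are one-parameter subgroups; in the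
   chart they have velocity u at t = 0, so [lgexp] is the Lie exponential.
   Inversion is u |-> - u in the chart, hence smooth. *)
Record expLieGroup (R : realType) (n : nat) := ExpLieGroup {
  lgcarrier :> groupType ;
  lgexp : 'rV[R]_n -> lgcarrier ;
  lglog : lgcarrier -> 'rV[R]_n ;
  lgexpK : cancel lgexp lglog ;
  lglogK : cancel lglog lgexp ;
  lgmul_smooth :
    smooth (fun p : 'rV[R]_n * 'rV[R]_n => lglog (lgexp p.1 * lgexp p.2)%g) ;
  lgexp_subgroup : forall (u : 'rV[R]_n) (s t : R),
    lgexp ((s + t) *: u) = (lgexp (s *: u) * lgexp (t *: u))%g }.

Section LieAlgebra.
Context {R : realType} {n : nat} (G : expLieGroup R n).
Implicit Types u v : 'rV[R]_n.

(* The value at x, read in the chart, of the left-invariant vector field equal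
   to v at the identity: the differential at the identity of the left
   translation by x, applied to v. *)
Definition left_invariant_field v (x : G) : 'rV[R]_n :=
  'D_v (fun y : 'rV[R]_n => lglog (x * lgexp G y)%g) 0.

(* [Y, Z] = Y Z - Z Y as derivations, computed in coordinates. *)
Definition vector_field_bracket (Y Z : 'rV[R]_n -> 'rV[R]_n) (x : 'rV[R]_n) :
  'rV[R]_n := 'D_(Y x) Z x - 'D_(Z x) Y x.

Definition lie_bracket u v : 'rV[R]_n :=
  vector_field_bracket (fun x => left_invariant_field u (lgexp G x))
                       (fun x => left_invariant_field v (lgexp G x)) 0.

(* W = [U, V], the linear span of the brackets. *)
Definition is_commutator_space (W U V : {vspace 'rV[R]_n}) : Prop :=
  (forall u v, u \in U -> v \in V -> lie_bracket u v \in W) /\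
  (forall W' : {vspace 'rV[R]_n},
    (forall u v, u \in U -> v \in V -> lie_bracket u v \in W') ->
    (W <= W')%VS).

End LieAlgebra.

(* [layer j] is the j-th layer of the stratification for 1 <= j <= step; its
   values at the other indices are irrelevant. *)
Record carnotGroup (R : realType) := CarnotGroup {
  topdim : nat ;
  cgroup :> expLieGroup R topdim ;
  step : nat ;
  step_gt0 : (0 < step)%N ;
  layer : nat -> {vspace 'rV[R]_topdim} ;
  layer_sum : (\sum_(j < step) layer j.+1)%VS = fullv ;
  layer_direct : directv (\sum_(j < step) layer j.+1) ;
  layer_gen : forall j : nat, (2 <= j <= step)%N ->
    is_commutator_space cgroup (layer j) (layer 1) (layer j.-1) ;
  layer_last : forall u v : 'rV[R]_topdim,
    v \in layer step -> lie_bracket cgroup u v = 0 ;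
  scal : {dot 'rV[R]_topdim for idfun} ;
  layer_orth : forall i j : nat,
    (1 <= i <= step)%N -> (1 <= j <= step)%N -> i != j ->
    forall u v, u \in layer i -> v \in layer j -> scal u v = 0 ;
  frame : (\dim (layer 1)).-tuple 'rV[R]_topdim ;
  frame_basis : basis_of (layer 1) frame ;
  frame_orthonormal : forall i j : 'I_(\dim (layer 1)),
    scal (tnth frame i) (tnth frame j) = (i == j)%:R }.

Definition rank (R : realType) (G : carnotGroup R) : nat := \dim (layer G 1).

Section Curves.
Context {R : realType} (G : carnotGroup R).
Local Notation mu := (@lebesgue_measure R).
Local Notation alg := 'rV[R]_(topdim G).

Definition frame_field (i : 'I_(rank G)) : G -> alg :=
  left_invariant_field (tnth (frame G) i).

Definition control_norm (h : 'I_(rank G) -> R -> R) (t : R) : R :=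
  Num.sqrt (\sum_(i < rank G) h i t ^+ 2).

Definition Linfty_on (a b : R) (f : R -> R) : Prop :=
  measurable_fun `[a, b] f /\
  exists M : R, {ae mu, forall t, t \in `[a, b] -> `|f t| <= M}.

(* [gamma] restricted to [a, b] is a horizontal curve with coordinates [h].
   On a compact interval being Lipschitz does not depend on the chart nor on
   the Riemannian metric. *)
Definition horizontal (a b : R) (gamma : R -> G) (h : 'I_(rank G) -> R -> R) :
  Prop :=
  [/\ [lipschitz (lglog (gamma t) : alg) | t in `[a, b]],
      forall i, Linfty_on a b (h i)
    & {ae mu, forall t, t \in `[a, b] ->
        is_derive t 1 (fun t => lglog (gamma t) : alg)
          (\sum_(i < rank G) h i t *: frame_field i (gamma t))}].

Definition hlength (a b : R) (h : 'I_(rank G) -> R -> R) : \bar R :=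
  (\int[mu]_(t in `[a, b]) (control_norm h t)%:E)%E.

Definition arclength_parametrized (a b : R) (h : 'I_(rank G) -> R -> R) :
  Prop := {ae mu, forall t, t \in `[a, b] -> control_norm h t = 1}.

Definition cc_dist (x y : G) : \bar R :=
  ereal_inf [set l | exists (a b : R) (gamma : R -> G) h,
    [/\ a < b, horizontal a b gamma h, gamma a = x, gamma b = y
      & l = hlength a b h]].

(* The coordinates of a horizontal curve are determined almost everywhere by
   the curve, hence so is its length. *)
Definition length_minimizing (a b : R) (gamma : R -> G)
    (h : 'I_(rank G) -> R -> R) : Prop :=
  horizontal a b gamma h /\ hlength a b h = cc_dist (gamma a) (gamma b).

Definition proj_first_layer : 'End(alg) :=
  daddv_pi (layer G 1) (\sum_(1 <= j < step G) layer G j.+1)%VS.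

Definition hproj (x : G) : alg := proj_first_layer (lglog x).

Definition unit_sphere : set alg :=
  [set v | v \in layer G 1 /\ scal G v v = 1].

Definition excess (gamma : R -> G) (B : set R) : R :=
  inf [set Num.sqrt ((fine (mu B))^-1 *
         \int[mu]_(t in B) (scal G v (derive1 (hproj \o gamma) t)) ^+ 2)
      | v in unit_sphere].

End Curves.

(* Main.v *)
Require Import Defs.
From HB Require Import structures.
From mathcomp Require Import all_boot all_order all_algebra.
From mathcomp Require Import all_classical all_reals all_analysis.
From mathcomp Require Import measurable_realfun.
From mathcomp Require Import zify ring lra.
Import Order.TTheory GRing.Theory Num.Theory.
Import numFieldNormedType.Exports.
Import HBNNSimple.
Set Implicit Arguments.
Unset Strict Implicit.
Unset Printing Implicit Defensive.
Local Open Scope classical_set_scope.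
Local Open Scope ring_scope.

(** If the excess did not come close to 0 on short intervals, it would be at least
    some eps > 0 on [0, eta] for all eta <= eta0: for every unit vector v of the
    first layer the average of <v, gamma'>^2 over [0, eta] would be at least eps^2.
    From this a curve shorter than gamma with the same end points is built.

    First, gamma is not straight: its displacement over [0, eta], in the first
    layer, has length at most (1 - eps^2 / 2) eta ([norm2_disp_le]). The segment
    with this displacement is shorter than gamma by a fixed proportion, and its end
    point differs from that of gamma by an element of degree at least 2, i.e.
    without component in the first layer ([shortcut2]).

    Second, cut [0, eta] into N equal pieces, with N large but independent of eta.
    As gamma is a minimizer, the polygon of the displacements of the pieces has
    length almost eta ([polygon_length]). So most pieces are almost straight, and
    the displacements see every direction that the velocity sees: the sum of the
    squares of their scalar products with a unit vector is at least c0 eta^2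
    ([gram_lower_bound]). Every vector of the first layer is then a combination of
    these displacements, with controlled coefficients ([gram_solve]).

    Now the error of the short cut is raised to higher and higher degrees. Suppose
    that some curve gains kappa rho on gamma at scale rho, with an error of degree
    j + 1. At the larger scale M rho, conjugate the pieces of gamma by elements c_i
    of degree j with leading parts Z_i. To leading order this multiplies the end
    point by the sum of the brackets [u_i, Z_i] ([gprod_conj]), where the u_i are
    the displacements. As the u_i span the first layer, whose brackets with the
    j-th layer span the next one, the Z_i can be chosen to cancel the error in
    degree j + 1. They are of order rho^j / M, and the conjugations take a time of
    order M^(-1/j) rho, less than the gain if M is large ([shortcutS]). The error
    finally has degree greater than the step, hence is trivial, and gamma would not
    be a minimizer ([no_shortcut]).

    The group law is only known through the exponential chart. It enters through
    the finite series of Ad (exp x) and of the differential of exp ([Ad_expE],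
    [dexpE]), which solve linear differential equations that are triangular for the
    stratification. They give the group law modulo terms of higher degree
    ([chart_mul_fil]) and, by integrating the horizontal equation one degree at a
    time ([curve_bndu]), the two inclusions of the ball-box estimate ([reach_bnd],
    [ball_box]). Curves are Lipschitz and only differentiable almost everywhere;
    their increments are bounded by the mean value inequality [ae_mean_value_le]. *)

(** * Derivatives of curves *)
Section CurveDerivatives.
Context {R : realType}.
Implicit Types V W : normedModType R.

Lemma is_derive1P V (c : R -> V) (t : R) c' :
  is_derive t 1 c c' <-> h^-1 *: (c (h + t) - c t) @[h --> 0^'] --> c'.
Proof.
have E : (fun h : R => h^-1 *: ((c \o shift t) (h *: 1) - c t)) =
         (fun h : R => h^-1 *: (c (h + t) - c t)).
  by apply/funext => h /=; rewrite [h *: 1]mulr1.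
split=> [[]|cc'].
  by rewrite /derivable /derive E => ? <-.
split; rewrite /derivable /derive E; first by apply/cvg_ex; exists c'.
exact/cvg_lim.
Qed.

Lemma is_derive_comp V W (F : V -> W) (c : R -> V) (t : R) c' :
  differentiable F (c t) -> is_derive t 1 c c' ->
  is_derive t 1 (F \o c) ('d F (c t) c').
Proof.
move=> dF [dc <-].
have dc' : differentiable c t by exact/derivable1_diffP.
split; first by apply/derivable1_diffP/differentiable_comp.
rewrite deriveE; last exact: differentiable_comp.
by rewrite diff_comp //; congr ('d F (c t) _); rewrite -deriveE.
Qed.

Lemma is_derive_pair V W (c : R -> V) (d : R -> W) (t : R) c' d' :
  is_derive t 1 c c' -> is_derive t 1 d d' ->
  is_derive t 1 (fun s => (c s, d s)) (c', d').
Proof.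
move=> [dc <-] [dd <-].
have dc' : differentiable c t by exact/derivable1_diffP.
have dd' : differentiable d t by exact/derivable1_diffP.
split; first by apply/derivable1_diffP/differentiable_pair.
rewrite deriveE; last exact: differentiable_pair.
by rewrite diff_pair //= -!deriveE.
Qed.

Lemma is_derive1_unique V (c : R -> V) (t : R) c' c'' :
  is_derive t 1 c c' -> is_derive t 1 c c'' -> c' = c''.
Proof. by move=> [_ <-] [_ <-]. Qed.

Lemma is_derive_line V (x y : V) (t : R) :
  is_derive t 1 (fun s : R => x + s *: y) y.
Proof.
apply/is_derive1P.
apply: (@cvg_trans _ (cst y @ (0:R)^')); last exact: cvg_cst.
apply: near_eq_cvg; near=> h.
have h0 : h != 0 by near: h; exact: nbhs_dnbhs_neq.
by rewrite opprD addrACA subrr add0r -scalerBl addrK scalerA mulVf ?scale1r.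
Unshelve. all: by end_near. Qed.

Lemma is_derive_scale_line V (y : V) (t : R) :
  is_derive t 1 (fun s : R => s *: y) y.
Proof.
have := is_derive_line 0 y t.
by under [X in is_derive _ _ X _]eq_fun do rewrite add0r.
Qed.

Lemma is_derive_affine V (c : R -> V) (a b t : R) c' :
  is_derive (a * t + b) 1 c c' ->
  is_derive t 1 (fun s => c (a * s + b)) (a *: c').
Proof.
move=> [dc <-].
have dc' : differentiable c (a * t + b) by exact/derivable1_diffP.
have da : is_derive t 1 (fun s : R => a * s + b) a.
  apply: is_derive_eq; rewrite addr0.
  by rewrite [_%:A]mulr1.
have := is_derive_comp (F := c) (c := fun s : R => a * s + b) dc' da.
have -> : 'd c (a * t + b) a = a *: 'D_1 c (a * t + b).
  by rewrite deriveE // -linearZ; congr ('d c _ _); rewrite [a *: 1]mulr1.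
exact.
Qed.

Lemma derivable_direction V W (F : V -> W) (x v : V) :
  differentiable F x -> is_derive (0 : R) 1 (fun s : R => F (x + s *: v)) ('d F x v).
Proof.
move=> dF.
have := is_derive_comp (F := F) (c := fun s : R => x + s *: v)
  (t := 0) _ (is_derive_line x v 0).
by rewrite scale0r addr0; exact.
Qed.

End CurveDerivatives.

(** * Linear and bilinear maps in finite dimension *)
Section FiniteDimension.
Context {R : realType}.

Lemma row_expand n (x : 'rV[R]_n) : x = \sum_i x 0 i *: 'e_i.
Proof. exact: row_sum_delta. Qed.

Lemma coord_norm_le n (x : 'rV[R]_n) i : `|x 0 i| <= `|x|.
Proof.
rewrite [leRHS]/Num.Def.normr /= mx_normrE.
exact: (le_bigmax _ (fun i : 'I_1 * 'I_n => `|x i.1 i.2|) (0, i)).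
Qed.

Lemma norm_le_coord n (x : 'rV[R]_n) M : 0 <= M ->
  (forall i, `|x 0 i| <= M) -> `|x| <= M.
Proof.
move=> M0 H; rewrite [leLHS]/Num.Def.normr /= mx_normrE.
by apply/bigmax_leP; split => // -[i j] _ /=; rewrite (ord1 i).
Qed.

Lemma linear_bounded n (W : normedModType R) (f : {linear 'rV[R]_n -> W}) :
  exists2 K, 0 < K & forall x, `|f x| <= K * `|x|.
Proof.
exists (1 + \sum_i `|f 'e_i|); first by rewrite ltr_pwDl // sumr_ge0.
move=> x; rewrite [in leLHS](row_expand x) linear_sum /=.
apply: (le_trans (ler_norm_sum _ _ _)).
rewrite mulrDl mul1r; apply: ler_wpDl => //; rewrite mulr_suml; apply: ler_sum => i _.
by rewrite linearZ /= normrZ mulrC ler_wpM2l // coord_norm_le.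
Qed.

Lemma bounded_linear_cts (V W : normedModType R) (f : {linear V -> W}) K :
  0 < K -> (forall x, `|f x| <= K * `|x|) -> continuous (f : V -> W).
Proof.
move=> K0 H x; apply/cvgrPdist_le => e e0; near=> y.
rewrite -linearB; apply: (le_trans (H _)).
rewrite -ler_pdivlMl //; near: y.
apply: (@cvgr_dist_le _ _ _ _ _ id x) => //; by rewrite mulrC divr_gt0.
Unshelve. all: by end_near. Qed.

Lemma linear_rV_continuous n (W : normedModType R) (f : {linear 'rV[R]_n -> W}) :
  continuous (f : 'rV[R]_n -> W).
Proof. by have [K K0 H] := linear_bounded f; exact: bounded_linear_cts H. Qed.

Lemma is_derive_linear n (W : normedModType R) (f : {linear 'rV[R]_n -> W})
    (c : R -> 'rV[R]_n) (t : R) c' :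
  is_derive t 1 c c' -> is_derive t 1 (f \o c) (f c').
Proof.
move=> dc; have fc := @linear_rV_continuous _ _ f.
have df : differentiable f (c t) by exact: linear_differentiable.
have := is_derive_comp df dc.
by rewrite (diff_lin _ fc).
Qed.

Lemma is_derive_coord n (c : R -> 'rV[R]_n) (t : R) c' i :
  is_derive t 1 c c' -> is_derive t 1 (fun s => c s 0 i : R) (c' 0 i).
Proof.
move=> dc.
have lf : linear (fun N : 'rV[R]_n => N 0 i) by move=> a x y; rewrite !mxE.
pose fM := GRing.isLinear.Build _ _ _ _ _ lf.
pose f : {linear 'rV[R]_n -> R} := HB.pack (fun N : 'rV[R]_n => N 0 i) fM.
exact: (@is_derive_linear _ _ f).
Qed.

Lemma is_derive_scalel (W : normedModType R) (f : R -> R) (w : W) (t : R) f' :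
  is_derive t 1 f f' -> is_derive t 1 (fun s => f s *: w) (f' *: w).
Proof.
move=> df.
have H : is_diff (f t) ( *:%R ^~ w) ( *:%R ^~ w) by exact: is_diff_scalel.
have := @is_derive_comp _ _ _ (fun x : R => x *: w) _ _ _ _ df.
by move=> /(_ (@ex_diff _ _ _ _ _ _ _ H)); rewrite diff_val.
Qed.

Lemma is_derive_scale (W : normedModType R) (f : R -> R) (c : R -> W) (t : R) f' c' :
  is_derive t 1 f f' -> is_derive t 1 c c' ->
  is_derive t 1 (fun s => f s *: c s) (f' *: c t + f t *: c').
Proof.
move=> df /is_derive1P dc; have /is_derive1P df1 := df.
have cf : f (h + t) @[h --> 0^'] --> f t.
  have d0 : is_derive (0 : R) 1 (fun s => f (1 * s + t)) (1 *: f').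
    by apply: is_derive_affine; rewrite mulr0 add0r.
  have ct : {for (0 : R), continuous (fun s : R => f (1 * s + t))}.
    by apply: differentiable_continuous; apply/derivable1_diffP; case: d0.
  apply: (@cvg_trans _ ((fun h => f (h + t)) @ nbhs (0 : R))).
    by apply: cvg_app; exact: cvg_within.
  move: ct; rewrite /prop_for /continuous_at /= mulr0 add0r.
  by under eq_fun do rewrite mul1r.
apply/is_derive1P.
have E h : h^-1 *: (f (h + t) *: c (h + t) - f t *: c t) =
   (h^-1 *: (f (h + t) - f t)) *: c t + f (h + t) *: (h^-1 *: (c (h + t) - c t)).
  rewrite -scalerA [f (h+t) *: (_ *: _)]scalerA mulrC -scalerA -scalerDr.
  congr (_ *: _).
  by rewrite scalerBl scalerBr [RHS]addrC addrA subrK.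
under eq_fun do rewrite E.
by apply: cvgD; [apply: cvgZ => //; exact: cvg_cst | apply: cvgZ].
Qed.

Lemma is_derive_fsum (W : normedModType R) n (c : 'I_n -> R -> W) (t : R) c' :
  (forall i, is_derive t 1 (c i) (c' i)) ->
  is_derive t 1 (fun s => \sum_i c i s) (\sum_i c' i).
Proof.
move=> dc; have := @is_derive_sum _ _ _ _ _ t (1 : R) _ dc.
by congr (is_derive _ _ _ _); apply/funext => s; rewrite fct_sumE.
Qed.

Lemma is_derive_bilinear n m p (b : 'rV[R]_n -> 'rV[R]_m -> 'rV[R]_p)
    (lin1 : forall v, linear (b^~ v)) (lin2 : forall u, linear (b u))
    (c : R -> 'rV[R]_n) (d : R -> 'rV[R]_m) (t : R) c' d' :
  is_derive t 1 c c' -> is_derive t 1 d d' ->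
  is_derive t 1 (fun s => b (c s) (d s)) (b c' (d t) + b (c t) d').
Proof.
move=> dc dd.
pose b2 u : {linear 'rV[R]_m -> 'rV[R]_p} :=
  HB.pack (b u) (GRing.isLinear.Build _ _ _ _ _ (lin2 u)).
pose b1 v : {linear 'rV[R]_n -> 'rV[R]_p} :=
  HB.pack (b^~ v) (GRing.isLinear.Build _ _ _ _ _ (lin1 v)).
have E u v : b u v = \sum_i u 0 i *: b2 'e_i v.
  rewrite -[LHS]/(b1 v u) {1}(row_expand u) linear_sum /=.
  by apply: eq_bigr => i _; rewrite -[b _ v]/(b1 v _) linearZ.
have -> : (fun s => b (c s) (d s)) = (fun s => \sum_i c s 0 i *: b2 'e_i (d s)).
  by apply/funext => s; rewrite E.
rewrite !E -big_split /=; apply: is_derive_fsum => i.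
apply: is_derive_scale; first exact: is_derive_coord.
exact: (@is_derive_linear _ _ (b2 'e_i)).
Qed.

End FiniteDimension.

(** * The mean value inequality for Lipschitz curves *)
Section MeanValue.
Context {R : realType} {W : normedModType R}.
Local Notation mu := (@lebesgue_measure R).

(** Continuous induction: the set of the [x] such that the inequality holds
    between [a] and [x] contains its supremum, which cannot be less than [b]. The
    majorant [g] may jump upwards. *)
Lemma increment_le (f : R -> W) (g : R -> R) (a b : R) : a <= b ->
  (forall x y, a <= x -> x <= y -> y <= b -> g x <= g y) ->
  (forall c e, a <= c <= b -> 0 < e -> exists2 d, 0 < d &
     forall x, a <= x <= c -> c - x < d -> `|f c - f x| <= e) ->
  (forall c, a <= c < b -> exists2 d, 0 < d &
     forall h, 0 < h < d -> c + h <= b -> `|f (c + h) - f c| <= g (c + h) - g c) ->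
  `|f b - f a| <= g b - g a.
Proof.
move=> ab gm fc fg.
pose S := [set x | a <= x <= b /\ `|f x - f a| <= g x - g a].
have Sa : S a by split; rewrite ?lexx ?ab // !subrr normr0.
have hS : has_sup S.
  by split; [exists a | exists b => x [/andP[]]].
set c := sup S.
have ac : a <= c by apply: sup_upper_bound.
have cb : c <= b by apply: sup_le_ub; [exists a | move=> x [/andP[]]].
have Sc : S c.
  split; first by rewrite ac cb.
  apply/ler_addgt0Pr => e e0.
  have [|d d0 Hd] := fc c e _ e0; first by rewrite ac cb.
  have [x Sx xc] := sup_adherent d0 hS.
  have xlec : x <= c by apply: sup_upper_bound.
  case: (Sx) => /andP[ax xb] fx.
  have h1 : `|f c - f x| <= e.
    by apply: Hd; [rewrite ax xlec | rewrite -/c in xc; lra].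
  have h2 : g x <= g c by exact: gm.
  have h3 : `|f c - f a| <= `|f c - f x| + `|f x - f a|.
    by rewrite -[f c - f a](subrKA (f x)); exact: ler_normD.
  by lra.
have [cb'|bc] := ltP c b; last first.
  have -> : b = c by apply/eqP; rewrite eq_le cb bc.
  by case: Sc.
have [|d d0 Hd] := fg c; first by rewrite ac cb'.
pose h := Num.min (d / 2) (b - c).
have h0 : 0 < h by rewrite lt_min; apply/andP; split; lra.
have hd : h < d by rewrite gt_min; apply/orP; left; lra.
have hb : c + h <= b.
  by rewrite -lerBrDl ge_min lexx orbT.
have Sch : S (c + h).
  split; first by apply/andP; split; lra.
  have h1 : `|f (c + h) - f c| <= g (c + h) - g c by apply: Hd => //; rewrite h0 hd.
  have [_ h2] := Sc.
  have h3 : `|f (c + h) - f a| <= `|f (c + h) - f c| + `|f c - f a|.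
    by rewrite -[f (c + h) - f a](subrKA (f c)); exact: ler_normD.
  by lra.
have : c + h <= c by apply: sup_upper_bound.
by move=> ?; exfalso; lra.
Qed.

Lemma is_derive_right_growth (f : R -> W) (t M e : R) f' :
  is_derive t 1 f f' -> `|f'| <= M -> 0 < e ->
  exists2 d, 0 < d & forall h, 0 < h < d -> `|f (t + h) - f t| <= (M + e) * h.
Proof.
move=> /is_derive1P /cvgrPdist_le df fM e0.
have /nbhs_ballP[d /= d0 Hd] := df e e0.
exists d => // h /andP[h0 hd].
have hn : h != 0 by rewrite gt_eqF.
have := Hd h; rewrite /ball /= sub0r normrN gtr0_norm // => /(_ hd hn).
rewrite (addrC h t) => H.
have -> : f (t + h) - f t = h *: (h^-1 *: (f (t + h) - f t)).
  by rewrite scalerA mulfV // scale1r.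
rewrite normrZ gtr0_norm // mulrC; apply: ler_wpM2r; first exact: ltW.
set q := h^-1 *: _ in H *.
have : `|q| <= `|f'| + `|f' - q|.
  by rewrite -{1}(subKr f' q) ler_normB.
move: H fM; lra.
Qed.

(** Where a Lipschitz curve has no derivative its increments are controlled by
    those of time only. They are absorbed by the measure [p x] of the part before
    [x] of a small open neighbourhood of the exceptional set: it grows at unit
    speed on that set, and little in total. *)
Lemma null_set_majorant (N : set R) (a b e : R) : a <= b -> 0 < e ->
  mu.-negligible N ->
  exists p : R -> R, [/\ p a = 0, p b <= e,
    forall x y, a <= x -> x <= y -> y <= b -> p x <= p y &
    forall c, N c -> a <= c < b -> exists2 d, 0 < d &
      forall h, 0 < h < d -> h <= p (c + h) - p c].
Proof.
move=> ab e0 /negligible_outer_measure N0.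
have [U [oU NU muU]] := outer_measure_open_le N e0.
rewrite N0 add0e in muU.
have mU : measurable U by exact: measurable_realfun.open_measurable.
have mUi (x y : R) : measurable (U `&` `]x, y]) by exact: measurableI.
have leU (x y : R) : (mu (U `&` `]x, y]) <= mu U)%E.
  by apply: le_measure; rewrite ?inE; [exact: mUi | exact: mU | move=> z []].
have fU (x y : R) : (mu (U `&` `]x, y]) < +oo)%E.
  by apply: le_lt_trans (ltry e); apply: le_trans muU.
have fnU (x y : R) : mu (U `&` `]x, y]) \is a fin_num.
  by rewrite ge0_fin_numE.
exists (fun x => fine (mu (U `&` `]a, x]))).
have step x y : a <= x -> x <= y ->
   mu (U `&` `]a, y]) = (mu (U `&` `]a, x]) + mu (U `&` `]x, y]))%E.
  move=> ax xy; rewrite -measureU; [|exact: mUi|exact: mUi|].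
    by rewrite -setIUr; congr (mu (U `&` _)); rewrite -itv_bndbnd_setU ?bnd_simp.
  apply/seteqP; split => z //= [[_]] /=; rewrite in_itv /= => /andP[_ zx] [_].
  by rewrite in_itv /= => /andP[xz _]; lra.
split.
- by rewrite set_itvoc0 setI0 measure0.
- by rewrite -lee_fin fineK //; apply: le_trans muU.
- move=> x y ax xy yb; apply: fine_le => //.
  by rewrite (step x y) // leeDl.
- move=> c Nc /andP[ac cb].
  have /nbhs_ballP[d /= d0 Hd] : nbhs c U by apply: open_nbhs_nbhs; split => //; exact: NU.
  exists d => // h /andP[h0 hd].
  rewrite (step c (c + h)) //; last by lra.
  rewrite fineD // addrAC subrr add0r.
  rewrite (_ : U `&` _ = `]c, c + h]%classic).
    by rewrite lebesgue_measure_itv /= lte_fin ltrDl h0 -EFinB /= addrAC subrr add0r.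
  apply/seteqP; split => z /=; first by case.
  by rewrite in_itv /= => /andP[cz zc]; split; [apply: Hd; rewrite /ball /= ltr_distlC; apply/andP; split; lra | rewrite ?in_itv /= cz zc].
Qed.

Lemma is_derive_cont_at (f : R -> W) (t : R) f' : is_derive t 1 f f' -> {for t, continuous f}.
Proof.
by move=> [df _]; apply: differentiable_continuous; apply/derivable1_diffP.
Qed.

Lemma mean_value_le (f : R -> W) (a b M : R) : a <= b ->
  (forall t, a <= t <= b -> exists2 f', is_derive t 1 f f' & `|f'| <= M) ->
  `|f b - f a| <= M * (b - a).
Proof.
move=> ab fd.
have M0 : 0 <= M.
  have [|f' _ fM] := fd a; first by rewrite lexx ab.
  exact: le_trans fM.
apply/ler_addgt0Pr => e e0.
pose e1 := e / (1 + (b - a)).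
have e10 : 0 < e1 by rewrite divr_gt0 //; lra.
have -> : M * (b - a) + e = (M + e1) * b - (M + e1) * a + e1.
  by rewrite /e1; field; lra.
apply: ler_wpDr; first exact: ltW.
apply: (@increment_le f (fun x => (M + e1) * x)) => //.
- by move=> x y _ xy _; rewrite ler_wpM2l //; lra.
- move=> c e2 cab e20; have [f' df _] := fd _ cab.
  have /cvgrPdist_le/(_ e2 e20)/nbhs_ballP[d /= d0 Hd] := is_derive_cont_at df.
  exists d => // x /andP[ax xc] cx; apply: Hd; rewrite /ball /= ger0_norm //; lra.
- move=> c /andP[ac cb].
  have [|f' df fM] := fd c; first by rewrite ac ltW.
  have [d d0 Hd] := is_derive_right_growth df fM e10.
  exists d => // h hd _; apply: le_trans (Hd h hd) _.
  by rewrite -mulrBr addrAC subrr add0r.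
Qed.

(** A multiple of the majorant of the exceptional null set, added to the expected
    bound, gives a bound on increments at every point; [increment_le] applies. *)
Lemma ae_mean_value_le (f : R -> W) (a b M K : R) : a <= b -> 0 <= M ->
  (forall s t, a <= s <= b -> a <= t <= b -> `|f s - f t| <= K * `|s - t|) ->
  {ae mu, forall t, t \in `[a, b] -> exists2 f', is_derive t 1 f f' & `|f'| <= M} ->
  `|f b - f a| <= M * (b - a).
Proof.
move=> ab M0 fK /= nN; apply/ler_addgt0Pr => e e0.
pose K' := 1 + `|K|.
have K'0 : 0 < K' by rewrite /K' ltr_pwDl.
have KK' : K <= K' by rewrite /K'; have := ler_norm K; lra.
have fK' s t : a <= s <= b -> a <= t <= b -> `|f s - f t| <= K' * `|s - t|.
  by move=> sab tab; apply: le_trans (fK _ _ sab tab) _; rewrite ler_wpM2r.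
pose e1 := e / 2 / (1 + (b - a)).
have e10 : 0 < e1 by rewrite divr_gt0 //; lra.
have e20 : 0 < e / 2 / K' by rewrite !divr_gt0.
have [p [pa pb pm pN]] := null_set_majorant ab e20 nN.
pose g x := (M + e1) * x + K' * p x.
apply: (@le_trans _ _ (g b - g a)); last first.
  have : K' * p b <= e / 2 by rewrite -ler_pdivlMl // mulrC.
  have : e1 * (b - a) <= e / 2.
    by rewrite /e1 mulrAC ler_pdivrMr ?ler_wpM2l //; lra.
  by rewrite /g pa; lra.
apply: increment_le => //.
- move=> x y ax xy yb; rewrite /g lerD // ler_wpM2l //; [lra|lra|exact: pm].
- move=> c e2 cab e2_gt0; exists (e2 / K'); first by rewrite divr_gt0.
  move=> x /andP[ax xc] cx; move/andP: (cab) => [ac cb].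
  apply: (le_trans (fK' _ _ cab _)); first by apply/andP; split; lra.
  by rewrite -ler_pdivlMl // ger0_norm; [rewrite mulrC; lra|lra].
- move=> c /andP[ac cb].
  have cab : a <= c <= b by rewrite ac ltW.
  have [Nc|] := pselect ((~` [set t | t \in `[a, b] -> exists2 f', is_derive t 1 f f' & `|f'| <= M]) c).
    have [|d d0 Hd] := pN _ Nc; first by rewrite ac cb.
    exists d => // h hd hb; move/andP: (hd) => [h0 _].
    apply: (le_trans (fK' _ _ _ cab)); first by apply/andP; split; lra.
    rewrite addrAC subrr add0r gtr0_norm //.
    have := Hd h hd; rewrite -(ler_pM2l K'0).
    have : 0 <= (M + e1) * h by rewrite mulr_ge0 //; lra.
    by rewrite /g; lra.
  move=> /contrapT /= /(_ _)[|f' df fM]; first by rewrite in_itv.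
  have [d d0 Hd] := is_derive_right_growth df fM e10.
  exists d => // h hd hb; apply: le_trans (Hd h hd) _; move/andP: (hd) => [h0 _].
  have : p c <= p (c + h) by apply: pm => //; lra.
  by rewrite -(ler_pM2l K'0) /g; lra.
Qed.

End MeanValue.

(** * Translation invariance of the Lebesgue measure *)
Section Translation.
Context {R : realType}.
Local Notation mu := (@lebesgue_measure R).

Let shiftm (c : R) : measurable_fun (setT : set (measurableTypeR R)) (fun x : measurableTypeR R => (x + c : measurableTypeR R)).
Proof. by apply: measurable_funD. Qed.

Lemma lebesgue_translation (c : R) (A : set R) : measurable A ->
  mu ((fun x => x + c) @^-1` A) = mu A.
Proof.
move=> mA.
pose nu0 := (pushforward mu (fun x : measurableTypeR R => (x + c : measurableTypeR R))
  : {measure set (measurableTypeR R) -> \bar R}).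
pose nu := nu0 (shiftm c).
rewrite -[LHS]/(nu A); apply/esym; apply: lebesgue_measure_unique => //.
move=> X /ocitvP[->|[[x y] /= xy ->]]; first by rewrite !measure0.
have -> : nu `]x, y]%classic = mu `]x - c, y - c]%classic.
  congr (mu _); apply/seteqP; split => z /=; rewrite !in_itv /= => /andP[? ?]; apply/andP; split; lra.
rewrite !lebesgue_measure_itv /= !lte_fin; case: ifPn => h1; case: ifPn => h2 //.
- by rewrite -!EFinB; congr (_%:E); ring.
- by exfalso; lra.
- by exfalso; lra.
Qed.

Lemma negligible_translation (c : R) (N : set R) : mu.-negligible N ->
  mu.-negligible [set x | N (x + c)].
Proof.
move=> [A [mA A0 NA]]; exists ((fun x => x + c) @^-1` A); split.
- by rewrite -[X in measurable X]setTI; exact: shiftm.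
- by rewrite lebesgue_translation.
- by move=> x /NA.
Qed.

End Translation.

(** * Local Lipschitz continuity of C1 maps *)
Section C1Lipschitz.
Context {R : realType}.

Lemma C1_lipschitz_ball n m (F : 'rV[R]_n -> 'rV[R]_m) (r : R) :
  (forall x, differentiable F x) ->
  (forall v, continuous (fun x => 'D_v F x)) ->
  exists2 K, 0 <= K & forall x y, `|x| <= r -> `|y| <= r ->
    `|F x - F y| <= K * `|x - y|.
Proof.
move=> dF cF.
have B (i : 'I_n) : exists2 K, 0 <= K & forall x, `|x| <= r -> `|'D_('e_i) F x| <= K.
  have [r0|r0] := ltP r 0.
    by exists 0 => // x xr; have := normr_ge0 x; lra.
  have cB : compact [set x : 'rV[R]_n | `|x| <= r].
    apply: bounded_closed_compact.
      exists r; split; first exact: num_real.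
      by move=> M rM x /= xr; exact: (le_trans xr (ltW rM)).
    apply: (@closed_comp _ _ (fun x : 'rV[R]_n => `|x|) [set t : R | t <= r]).
      by move=> x _; exact: norm_continuous.
    exact: closed_le.
  have [||c _ Hc] := @compact_EVT_max _ R (fun x => `|'D_('e_i) F x|) _ _ cB.
  - by exists 0; rewrite /= normr0.
  - apply: continuous_subspaceT => x; apply: continuous_comp; first exact: cF.
    exact: norm_continuous.
  exists (`|'D_('e_i) F c|); first exact: normr_ge0.
  by move=> x xr; exact: (Hc x (mem_set xr)).
have /choice[k Hk] : forall i : 'I_n, exists K, 0 <= K /\ forall x, `|x| <= r -> `|'D_('e_i) F x| <= K.
  by move=> i; have [K] := B i; exists K.
exists (\sum_i k i); first by apply: sumr_ge0 => i _; case: (Hk i).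
move=> x y xr yr.
have := @mean_value_le R _ (fun t : R => F (y + t *: (x - y))) 0 1 ((\sum_i k i) * `|x - y|) ler01.
rewrite scale1r scale0r addr0 [y + (x - y)]addrC subrK subr0 mulr1; apply => t /andP[t0 t1].
set z := y + t *: (x - y).
exists ('d F z (x - y)).
  exact: (@is_derive_comp R _ _ F (fun s : R => y + s *: (x - y)) t (x - y) (dF z) (is_derive_line y (x - y) t)).
have zr : `|z| <= r.
  have -> : z = (1 - t) *: y + t *: x.
    by apply/rowP => i; rewrite !mxE; ring.
  have t1' : 0 <= 1 - t by rewrite subr_ge0.
  apply: (le_trans (ler_normD _ _)); rewrite !normrZ (ger0_norm t0) (ger0_norm t1').
  have -> : r = (1 - t) * r + t * r by ring.
  by apply: lerD; apply: ler_wpM2l.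
rewrite (row_expand (x - y)) linear_sum /=.
apply: (le_trans (ler_norm_sum _ _ _)); rewrite mulr_suml; apply: ler_sum => i _.
rewrite linearZ /= normrZ mulrC -deriveE //; apply: ler_pM => //.
  by have [_] := Hk i; exact.
by rewrite -row_expand; exact: coord_norm_le.
Qed.

End C1Lipschitz.

(** * The group law in the exponential chart *)
Section ExpLieGroup.
Context {R : realType} {n : nat} (G : expLieGroup R n).
Local Notation V := 'rV[R]_n.
Local Notation exp := (lgexp G).
Local Notation log := (@lglog R n G).

Definition chart_mul (p : V * V) : V := log (exp p.1 * exp p.2)%g.
Local Notation F := chart_mul.

Lemma lgexp0 : exp 0 = 1%g.
Proof.
have := lgexp_subgroup G 0 0 0; rewrite !scaler0 => H.
by apply: (@mulgI _ (exp 0)); rewrite -H mulg1.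
Qed.

Lemma lgexpN u : exp (- u) = ((exp u)^-1)%g.
Proof.
have := lgexp_subgroup G u 1 (-1); rewrite subrr scale0r lgexp0 scale1r scaleN1r => H.
by apply: (@mulgI _ (exp u)); rewrite -H mulgV.
Qed.

Lemma lglog1 : log 1%g = 0. Proof. by rewrite -lgexp0 lgexpK. Qed.

Lemma lglogM (x y : G) : log (x * y)%g = F (log x, log y).
Proof. by rewrite /F /= !lglogK. Qed.

Lemma lgexpM (x y : V) : exp (F (x, y)) = (exp x * exp y)%g.
Proof. by rewrite /F lglogK. Qed.

Lemma lglogV (x : G) : log (x^-1)%g = - log x.
Proof. by rewrite -[x in LHS](lglogK) -lgexpN lgexpK. Qed.

Lemma chart_mul0r x : F (x, 0) = x.
Proof. by rewrite /F /= lgexp0 mulg1 lgexpK. Qed.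

Lemma chart_mul0l x : F (0, x) = x.
Proof. by rewrite /F /= lgexp0 mul1g lgexpK. Qed.

Lemma chart_mulKl x y : F (- x, F (x, y)) = y.
Proof. by rewrite /F /= lglogK lgexpN mulKg lgexpK. Qed.

Lemma chart_mulA x y z : F (x, F (y, z)) = F (F (x, y), z).
Proof. by rewrite /F /= !lglogK mulgA. Qed.

Lemma chart_mulN x y : - F (x, y) = F (- y, - x).
Proof. by rewrite /F /= -lglogV invgM !lgexpN. Qed.

Lemma chart_mul_line u (s t : R) : F (s *: u, t *: u) = (s + t) *: u.
Proof. by rewrite /F /= -lgexp_subgroup lgexpK. Qed.

Lemma chart_mul_smooth : smooth F. Proof. exact: lgmul_smooth. Qed.

Lemma diff_chart_mul p : differentiable F p.
Proof. by case: (chart_mul_smooth 1) => + _; exact. Qed.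

Lemma cont_D_chart_mul v : continuous ('D_v F).
Proof. by case: (chart_mul_smooth 1) => _; exact. Qed.

Lemma diff_D_chart_mul v p : differentiable ('D_v F) p.
Proof. by case: (chart_mul_smooth 2) => _ /(_ v) [+ _]; exact. Qed.

Lemma is_derive_chart_mul (a b : R -> V) (t : R) a' b' :
  is_derive t 1 a a' -> is_derive t 1 b b' ->
  is_derive t 1 (fun s => F (a s, b s)) ('d F (a t, b t) (a', b')).
Proof.
move=> da db; have dab := is_derive_pair da db.
exact: (is_derive_comp (diff_chart_mul _) dab).
Qed.

Lemma is_derive_cst1 (W : normedModType R) (w : W) (t : R) : is_derive t 1 (fun=> w) 0.
Proof. exact: is_derive_cst. Qed.

Lemma diff_pairE p a b : 'd F p (a, b) = 'd F p (a, 0) + 'd F p (0, b).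
Proof.
have E : (a, b) = (a, 0) + (0, b) :> V * V by rewrite -[RHS]/(a + 0, 0 + b) addr0 add0r.
by rewrite {1}E linearD.
Qed.

Lemma diff_chart_mul00 a b : 'd F (0, 0) (a, b) = a + b.
Proof.
rewrite diff_pairE; congr (_ + _).
- have := is_derive_chart_mul (is_derive_scale_line a 0) (is_derive_cst1 (0 : V) 0).
  rewrite scale0r => H; apply: (is_derive1_unique H).
  by under [X in is_derive _ _ X _]eq_fun do rewrite chart_mul0r; exact: is_derive_scale_line.
- have := is_derive_chart_mul (is_derive_cst1 (0 : V) 0) (is_derive_scale_line b 0).
  rewrite scale0r => H; apply: (is_derive1_unique H).
  by under [X in is_derive _ _ X _]eq_fun do rewrite chart_mul0l; exact: is_derive_scale_line.
Qed.

(** The value at [x] of the left-invariant field [w], read in the chart. *)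
Definition left_field (x w : V) : V := 'd F (x, 0) (0, w).

Lemma is_derive_left_field (x w : V) :
  is_derive (0 : R) 1 (fun s : R => F (x, s *: w)) (left_field x w).
Proof.
have := is_derive_chart_mul (is_derive_cst1 x 0) (is_derive_scale_line w 0).
by rewrite scale0r.
Qed.

(** * The adjoint action *)

Definition Ad (g : G) (y : V) : V := log (g * exp y * g^-1)%g.

Lemma lgexp_Ad g y : exp (Ad g y) = (g * exp y * g^-1)%g.
Proof. by rewrite /Ad lglogK. Qed.

Lemma Ad0 g : Ad g 0 = 0.
Proof. by rewrite /Ad lgexp0 mulg1 mulgV lglog1. Qed.

Lemma Ad1 y : Ad 1%g y = y.
Proof. by rewrite /Ad mul1g invg1 mulg1 lgexpK. Qed.

Lemma AdM g h y : Ad (g * h)%g y = Ad g (Ad h y).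
Proof. by rewrite /Ad lglogK invgM !mulgA. Qed.

Lemma Ad_chart_mul g x y : Ad g (F (x, y)) = F (Ad g x, Ad g y).
Proof.
rewrite /Ad /F /= !lglogK; congr (log _).
by rewrite -!mulgA mulKg.
Qed.

Lemma AdE g y : Ad g y = F (F (log g, y), - log g).
Proof. by rewrite /Ad /F /= !lglogK lgexpN lglogK. Qed.

Let dAd g y := 'd F (log g, - log g) ('d F (log g, 0) (0, y), 0).

Let is_derive_Ad_line g y : is_derive (0 : R) 1 (fun s : R => Ad g (s *: y)) (dAd g y).
Proof.
have h1 := is_derive_chart_mul (is_derive_cst1 (log g) 0) (is_derive_scale_line y 0).
have := is_derive_chart_mul h1 (is_derive_cst1 (- log g) 0).
rewrite scale0r chart_mul0r.
by under [X in is_derive _ _ X _ -> _]eq_fun do rewrite -AdE.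
Qed.

Let Ad_double g y : Ad g (2 *: y) = 2 *: Ad g y.
Proof.
have E z : 2 *: z = F (z, z).
  by rewrite -[z in RHS]scale1r chart_mul_line.
by rewrite !E Ad_chart_mul.
Qed.

Let Ad_half g y k : Ad g ((2^-1 : R) ^+ k *: y) = (2^-1 : R) ^+ k *: Ad g y.
Proof.
elim: k y => [|k IH] y; first by rewrite expr0 !scale1r.
have h (z : V) : z = 2 *: ((2^-1 : R) *: z) by rewrite scalerA mulfV ?scale1r // pnatr_eq0.
rewrite exprSr -!scalerA IH; congr (_ *: _).
by rewrite [in RHS](h y) Ad_double scalerA mulVf ?scale1r // pnatr_eq0.
Qed.

(** [Ad g] has a differential at 0 and commutes with doubling, so it equals its
    differential: this is why it is linear. *)
Let Ad_dAd g y : Ad g y = dAd g y.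
Proof.
have /is_derive1P H := is_derive_Ad_line g y.
apply/eqP; rewrite eq_sym -subr_eq0 -normr_le0; apply/ler_addgt0Pr => e e0.
rewrite add0r.
have /cvgrPdist_le/(_ e e0)/nbhs_ballP[d /= d0 Hd] := H.
have [k kd] : exists k, (2^-1 : R) ^+ k < d.
  have h1 : `|2^-1 : R| < 1 by rewrite ger0_norm ?invr_ge0 // invf_lt1 // ltr1n.
  have /cvgrPdist_lt/(_ d d0)[k _ /(_ k (leqnn k))] := cvg_expr h1.
  by rewrite sub0r normrN => ?; exists k; apply: le_lt_trans (ler_norm _) _.
have k0 : 0 < (2^-1 : R) ^+ k by rewrite exprn_gt0 // invr_gt0.
have := Hd ((2^-1 : R) ^+ k).
rewrite /ball /= sub0r normrN gtr0_norm // => /(_ kd).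
rewrite gt_eqF // => /(_ isT).
by rewrite addr0 scale0r Ad0 subr0 Ad_half scalerA mulVf ?scale1r // gt_eqF.
Qed.

Lemma Ad_linear g : linear (Ad g).
Proof.
move=> a x y; rewrite !Ad_dAd /dAd.
have E u : ('d F (log g, 0) (0, u), 0 : V) = ('d F (log g, 0) (0, u), 0) by [].
rewrite -linearP; congr ('d F _ _).
rewrite -[RHS]/(a *: 'd F (log g, 0) (0, x) + 'd F (log g, 0) (0, y), a *: (0 : V) + 0).
by rewrite scaler0 addr0 -linearP; congr ('d F _ _, _);
  rewrite -[RHS]/(a *: (0 : V) + 0, a *: x + y) scaler0 addr0.
Qed.
HB.instance Definition _ g := GRing.isLinear.Build R V V _ (Ad g) (Ad_linear g).

Definition ad (x y : V) : V := 'D_1 (fun t : R => Ad (exp (t *: x)) y) 0.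

Lemma is_derive_Ad_exp0 x y :
  is_derive (0 : R) 1 (fun t : R => Ad (exp (t *: x)) y) (ad x y).
Proof.
have h1 := is_derive_chart_mul (is_derive_scale_line x 0) (is_derive_cst1 y 0).
have hN : is_derive (0 : R) 1 (fun s : R => - (s *: x)) (- x).
  by apply: is_deriveN; exact: is_derive_scale_line.
have := is_derive_chart_mul h1 hN.
have E : (fun s : R => F (F (s *: x, y), - (s *: x))) = (fun t : R => Ad (exp (t *: x)) y).
  by apply/funext => t; rewrite AdE lgexpK.
rewrite E => -[d _]; exact: derivableP.
Qed.

Lemma is_derive_Ad_exp x y (t : R) :
  is_derive t 1 (fun t : R => Ad (exp (t *: x)) y) (ad x (Ad (exp (t *: x)) y)).
Proof.
have /is_derive1P H := is_derive_Ad_exp0 x (Ad (exp (t *: x)) y).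
apply/is_derive1P; apply: cvg_trans H; apply: near_eq_cvg; apply: nearW => h.
by rewrite [h + 0]addr0 lgexp_subgroup AdM (scale0r x) lgexp0 Ad1.
Qed.

Lemma ad_linear x : linear (ad x).
Proof.
move=> a u v.
have H := is_derive_Ad_exp0 x (a *: u + v).
apply: (is_derive1_unique H).
have -> : (fun t : R => Ad (exp (t *: x)) (a *: u + v)) =
  (fun t : R => a *: Ad (exp (t *: x)) u) + (fun t : R => Ad (exp (t *: x)) v).
  by apply/funext => t; rewrite linearP.
apply: is_deriveD; last exact: is_derive_Ad_exp0.
by apply: is_deriveZ; exact: is_derive_Ad_exp0.
Qed.
HB.instance Definition _ x := GRing.isLinear.Build R V V _ (ad x) (ad_linear x).

Lemma ad_Ad g x y : ad (Ad g x) (Ad g y) = Ad g (ad x y).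
Proof.
have H := is_derive_Ad_exp0 (Ad g x) (Ad g y).
apply: (is_derive1_unique H).
have -> : (fun t : R => Ad (exp (t *: Ad g x)) (Ad g y)) = Ad g \o (fun t : R => Ad (exp (t *: x)) y).
  apply/funext => t /=; rewrite -linearZ /= lgexp_Ad -!AdM.
  by rewrite -!mulgA mulVg mulg1.
exact: is_derive_linear (is_derive_Ad_exp0 x y).
Qed.

(** * The bracket of left-invariant fields *)

(** [A x] sends a vector to the value at [x] of its left-invariant field, and [B]
    is the derivative of [A] at the identity, so the bracket of left-invariant
    fields is [B u v - B v u]. As [u] is tangent to its own one-parameter
    subgroup, [B u u = 0], whence [B] is antisymmetric and the bracket is
    [2 B u v]. Inversion is [- id] in the chart and exchanges left- and
    right-invariant fields; this is [A_Ad], and its derivative at the identity is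
    [ad u v = 2 B u v]. *)
Let A (x v : V) : V := 'D_(0, v) F (x, 0).
Let B (u v : V) : V := 'D_1 (fun t : R => A (t *: u) v) 0.

Let A_linear x : linear (A x).
Proof.
move=> a u v; rewrite /A !deriveE //; try exact: diff_chart_mul.
rewrite -linearP; congr ('d F _ _).
by rewrite -[RHS]/(a *: (0 : V) + 0, a *: u + v) scaler0 addr0.
Qed.
HB.instance Definition _ x := GRing.isLinear.Build R V V _ (A x) (A_linear x).

Let is_derive_A (x v : V) : is_derive (0 : R) 1 (fun s : R => F (x, s *: v)) (A x v).
Proof.
have := is_derive_chart_mul (is_derive_cst1 x 0) (is_derive_scale_line v 0).
by rewrite /A deriveE ?scale0r //; exact: diff_chart_mul.
Qed.

Let A0 v : A 0 v = v.
Proof.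
apply: (is_derive1_unique (is_derive_A 0 v)).
by under [X in is_derive _ _ X _]eq_fun do rewrite chart_mul0l; exact: is_derive_scale_line.
Qed.

Lemma left_invariant_fieldE v (g : G) : left_invariant_field v g = left_field (log g) v.
Proof.
rewrite /left_field -deriveE; last exact: diff_chart_mul.
rewrite /left_invariant_field /derive.
suff -> : (fun h : R => h^-1 *: (((fun y => log (g * exp y)%g) \o shift 0) (h *: v) - log (g * exp 0)%g)) =
  (fun h : R => h^-1 *: ((F \o shift (log g, 0)) (h *: (0, v)) - F (log g, 0))) by [].
apply/funext => h /=; congr (_ *: (_ - _)).
  rewrite -[h *: (0, v) + _]/(h *: (0 : V) + log g, h *: v + 0).
  by rewrite /F /= scaler0 add0r lglogK.
by rewrite /F /= lglogK.
Qed.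

Let diff_A v x : differentiable (fun x => A x v) x.
Proof.
apply: (@differentiable_comp _ _ _ _ (fun x : V => (x, 0 : V)) ('D_(0, v) F)).
  by apply: differentiable_pair => //; exact: differentiable_cst.
exact: diff_D_chart_mul.
Qed.

Let is_derive_B u v : is_derive (0 : R) 1 (fun t : R => A (t *: u) v) (B u v).
Proof.
have H : is_derive (0 : R) 1 ((fun x => A x v) \o (fun t : R => t *: u)) ('d (fun x => A x v) 0 u).
  have := @is_derive_comp R _ _ (fun x => A x v) (fun t : R => t *: u) 0 u.
  by rewrite scale0r; apply => //; exact: is_derive_scale_line.
by case: (H) => d _; exact: derivableP.
Qed.

Let B_E u v : B u v = 'd (fun x => A x v) 0 u.
Proof.
apply: (is_derive1_unique (is_derive_B u v)).
have := @is_derive_comp R _ _ (fun x => A x v) (fun t : R => t *: u) 0 u.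
by rewrite scale0r; apply => //; exact: is_derive_scale_line.
Qed.

Let B_linearl v : linear (B^~ v).
Proof. by move=> a x y; rewrite !B_E linearP. Qed.

Let B_linearr u : linear (B u).
Proof.
move=> a x y; apply: (is_derive1_unique (is_derive_B u _)).
have -> : (fun t : R => A (t *: u) (a *: x + y)) =
  a *: (fun t : R => A (t *: u) x) + (fun t : R => A (t *: u) y).
  by apply/funext => t; rewrite linearP.
by apply: is_deriveD; first (apply: is_deriveZ); exact: is_derive_B.
Qed.

Let B_diag u : B u u = 0.
Proof.
apply: (is_derive1_unique (is_derive_B u u)).
have -> : (fun t : R => A (t *: u) u) = (fun=> u).
  apply/funext => t; apply: (is_derive1_unique (is_derive_A _ _)).
  under [X in is_derive _ _ X _]eq_fun do rewrite chart_mul_line scalerDl.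
  exact: is_derive_line.
exact: is_derive_cst1.
Qed.

Let B_anti u v : B u v = - B v u.
Proof.
have := B_diag (u + v).
have Dl x y z : B (x + y) z = B x z + B y z.
  by have := B_linearl z 1 x y; rewrite !scale1r.
have Dr x y z : B z (x + y) = B z x + B z y.
  by have := B_linearr z 1 x y; rewrite !scale1r.
by rewrite Dl !Dr !B_diag addr0 add0r => /eqP; rewrite addr_eq0 => /eqP.
Qed.

Let lie_bracketB u v : lie_bracket G u v = B u v - B v u.
Proof.
have E w : (fun x => left_invariant_field w (exp x)) = (fun x => A x w).
  apply/funext => x; rewrite left_invariant_fieldE lgexpK /A /left_field deriveE //; exact: diff_chart_mul.
have -> : lie_bracket G u v = 'D_(A 0 u) (fun x => A x v) 0 - 'D_(A 0 v) (fun x => A x u) 0.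
  have H (fu fv : V -> V) : fu = A^~ u -> fv = A^~ v ->
    vector_field_bracket fu fv 0 = 'D_(A 0 u) (A^~ v) 0 - 'D_(A 0 v) (A^~ u) 0.
    by move=> -> ->.
  exact: H (E u) (E v).
rewrite (A0 u) (A0 v) (deriveE _ (diff_A v 0)) (deriveE _ (diff_A u 0)).
by rewrite (B_E u v) (B_E v u).
Qed.

Let A_Ad (x v : V) : A x v = A (- x) (Ad (exp x) v).
Proof.
apply: (is_derive1_unique (is_derive_A x v)).
have E (s : R) : F (x, s *: v) = - F (- x, s *: - Ad (exp x) v).
  rewrite chart_mulN opprK scalerN opprK -linearZ.
  by rewrite /F /= lgexp_Ad -!mulgA mulVg mulg1.
have -> : (fun s : R => F (x, s *: v)) = - (fun s : R => F (- x, s *: - Ad (exp x) v)).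
  by apply/funext => s; rewrite E.
have := is_deriveN (is_derive_A (- x) (- Ad (exp x) v)).
by rewrite linearN opprK.
Qed.

Let ad_2B u v : ad u v = B u v + B u v.
Proof.
have H1 := is_derive_B u v.
have H2 : is_derive (0 : R) 1 (fun t : R => A (t *: u) v) (ad u v + B (- u) v).
  have -> : (fun t : R => A (t *: u) v) =
     (fun t : R => \sum_i (Ad (exp (t *: u)) v) 0 i *: A (t *: - u) 'e_i).
    apply/funext => t; rewrite A_Ad {1}(row_expand (Ad _ v)) linear_sum /=.
    by apply: eq_bigr => i _; rewrite linearZ /= scalerN.
  have -> : ad u v + B (- u) v = \sum_i ((ad u v) 0 i *: A ((0 : R) *: - u) 'e_i +
       (Ad (exp ((0 : R) *: u)) v) 0 i *: B (- u) 'e_i).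
    rewrite big_split /= !scale0r lgexp0 Ad1; congr (_ + _).
      by rewrite {1}(row_expand (ad u v)); apply: eq_bigr => i _; rewrite A0.
    pose Bl : {linear V -> V} := HB.pack (B (- u)) (GRing.isLinear.Build _ _ _ _ _ (B_linearr (- u))).
    rewrite -[LHS]/(Bl v) {1}(row_expand v) linear_sum.
    by apply: eq_bigr => i _; rewrite linearZ.
  apply: is_derive_fsum => i.
  exact: (is_derive_scale (is_derive_coord i (is_derive_Ad_exp0 u v)) (is_derive_B (- u) 'e_i)).
have E : B (- u) v = - B u v by have := B_linearl v (-1) u 0; rewrite addr0 !scaleN1r !B_E linear0 addr0.
have := is_derive1_unique H1 H2; rewrite E => {1}->.
by rewrite subrK.
Qed.

Lemma ad_lie_bracket u v : lie_bracket G u v = ad u v.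
Proof. by rewrite lie_bracketB ad_2B [B v u]B_anti opprK. Qed.

Lemma adC u v : ad u v = - ad v u.
Proof. by rewrite !ad_2B B_anti opprD. Qed.

Lemma ad_linearl v : linear (ad^~ v).
Proof. by move=> a x y; rewrite adC linearP /= (adC v x) (adC v y) scalerN opprD !opprK. Qed.

Lemma adD x y z : ad (x + y) z = ad x z + ad y z.
Proof. by have := ad_linearl z 1 x y; rewrite !scale1r. Qed.

Lemma ad0l z : ad 0 z = 0.
Proof. by rewrite adC linear0 oppr0. Qed.

Lemma adZ a x z : ad (a *: x) z = a *: ad x z.
Proof. by have := ad_linearl z a x 0; rewrite addr0 ad0l addr0. Qed.

Lemma adN x z : ad (- x) z = - ad x z.
Proof. by rewrite -scaleN1r adZ scaleN1r. Qed.

Lemma ad_sum (I : Type) (r : seq I) (P : pred I) (f : I -> V) z :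
  ad (\sum_(i <- r | P i) f i) z = \sum_(i <- r | P i) ad (f i) z.
Proof.
exact: (big_morph (ad^~ z) (fun x y => adD x y z) (ad0l z)).
Qed.

(** The Jacobi identity is the derivative at the identity of the invariance
    [ad_Ad] of [ad] along the one-parameter subgroup of [z]. *)
Lemma ad_bracket x y z : ad z (ad x y) = ad (ad z x) y + ad x (ad z y).
Proof.
have H1 := is_derive_Ad_exp0 z (ad x y).
apply: (is_derive1_unique H1).
have -> : (fun t : R => Ad (exp (t *: z)) (ad x y)) =
  (fun t : R => ad (Ad (exp (t *: z)) x) (Ad (exp (t *: z)) y)).
  by apply/funext => t; rewrite ad_Ad.
have := is_derive_bilinear ad_linearl ad_linear (is_derive_Ad_exp0 z x) (is_derive_Ad_exp0 z y).
by rewrite scale0r lgexp0 !Ad1.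
Qed.

(** * The left-trivialized differential of the exponential map *)

(** The differential of the exponential map at [z], brought back to the identity
    by a left translation. *)
Definition dexp (z w : V) : V := 'd F (- z, z) (0, w).

Lemma is_derive_dexp (z w : V) (t : R) :
  is_derive (0 : R) 1 (fun e : R => F (- (t *: z), t *: (z + e *: w))) (t *: dexp (t *: z) w).
Proof.
have h : is_derive (0 : R) 1 (fun e : R => t *: (z + e *: w)) (t *: w).
  by apply: is_deriveZ; exact: is_derive_line.
have := is_derive_chart_mul (is_derive_cst1 (- (t *: z)) 0) h.
rewrite scale0r addr0 /dexp -linearZ.
by rewrite -[t *: (0, w)]/(t *: (0 : V), t *: w) scaler0.
Qed.

(** The end point of a perturbed one-parameter subgroup at time [s + t] is the
    product of its values at times [s] and [t]. This determines the derivative of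
    [t *: dexp (t *: z) w] in [t], see [is_derive_scale_dexp]. *)
Lemma dexp_cocycle (z w : V) (s t : R) :
  (s + t) *: dexp ((s + t) *: z) w =
  Ad (exp (- (t *: z))) (s *: dexp (s *: z) w) + t *: dexp (t *: z) w.
Proof.
apply: (is_derive1_unique (is_derive_dexp z w (s + t))).
have -> : (fun e : R => F (- ((s + t) *: z), (s + t) *: (z + e *: w))) =
  (fun e : R => F (Ad (exp (- (t *: z))) (F (- (s *: z), s *: (z + e *: w))),
     F (- (t *: z), t *: (z + e *: w)))).
  apply/funext => e; set y := z + e *: w.
  have E a b : F (a, b) = log (exp a * exp b)%g by [].
  rewrite !E lgexp_Ad !lgexpM !lgexpN !lgexp_subgroup; congr (log _).
  rewrite invgM invgK -!mulgA; congr (_ * _)%g; congr (_ * _)%g; congr (_ * _)%g.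
  by rewrite mulgA mulgV mul1g.
have z0 : z + (0 : R) *: w = z by rewrite scale0r addr0.
have h1 := is_derive_linear (Ad (exp (- (t *: z)))) (is_derive_dexp z w s).
have := is_derive_chart_mul h1 (is_derive_dexp z w t).
have FNl x : F (- x, x) = 0 by rewrite -{2}(chart_mul0r x) chart_mulKl.
by rewrite /= z0 !FNl Ad0 diff_chart_mul00.
Qed.

Lemma dexp_linear z : linear (dexp z).
Proof.
move=> a u v; rewrite /dexp -linearP; congr ('d F _ _).
by rewrite -[RHS]/(a *: (0 : V) + 0, a *: u + v) scaler0 addr0.
Qed.
HB.instance Definition _ z := GRing.isLinear.Build R V V _ (dexp z) (dexp_linear z).

Lemma dexp_scale_cvg (z w : V) : dexp (h *: z) w @[h --> (0 : R)] --> w.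
Proof.
have -> : (fun h : R => dexp (h *: z) w) = 'D_(0, w) F \o (fun h : R => (- (h *: z), h *: z)).
  by apply/funext => h /=; rewrite /dexp deriveE //; exact: diff_chart_mul.
have -> : nbhs w = nbhs ('D_(0, w) F (- ((0 : R) *: z), (0 : R) *: z)).
  by rewrite scale0r oppr0 deriveE ?diff_chart_mul00 ?add0r //; exact: diff_chart_mul.
apply: (@continuous_comp _ _ _ (fun h : R => (- (h *: z), h *: z)) ('D_(0, w) F)); last exact: cont_D_chart_mul.
apply: differentiable_continuous; apply: differentiable_pair.
  apply: differentiableN; apply/derivable1_diffP; by case: (is_derive_scale_line z 0).
by apply/derivable1_diffP; case: (is_derive_scale_line z 0).
Qed.

Lemma is_derive_scale_dexp (z w : V) (t : R) :
  is_derive t 1 (fun s : R => s *: dexp (s *: z) w) (Ad (exp (- (t *: z))) w).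
Proof.
apply/is_derive1P.
have H : Ad (exp (- (t *: z))) (dexp (h *: z) w) @[h --> (0 : R)^'] --> Ad (exp (- (t *: z))) w.
  apply: (@cvg_trans _ ((fun h : R => Ad (exp (- (t *: z))) (dexp (h *: z) w)) @ nbhs (0 : R))).
    by apply: cvg_app; exact: cvg_within.
  apply: (@cvg_comp _ _ _ (fun h : R => dexp (h *: z) w) (Ad (exp (- (t *: z)))) _ (nbhs w)).
    exact: dexp_scale_cvg.
  exact: linear_rV_continuous.
apply: cvg_trans H; apply: near_eq_cvg; near=> h.
have h0 : h != 0 by near: h; exact: nbhs_dnbhs_neq.
by rewrite dexp_cocycle addrK [Ad _ (h *: _)]linearZ [RHS]scalerA mulVf // scale1r.
Unshelve. all: by end_near. Qed.

(** The equation [z' = left_field z w] of a curve with left-trivialized velocity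
    [w] becomes [dexp z z' = w], which is triangular with respect to the
    stratification. *)
Lemma dexp_left_field z w : dexp z (left_field z w) = w.
Proof.
have := is_derive_chart_mul (is_derive_cst1 (- z) 0) (is_derive_left_field z w).
rewrite scale0r chart_mul0r => H.
have H2 : is_derive (0 : R) 1 (fun s : R => F (- z, F (z, s *: w))) w.
  by under [X in is_derive _ _ X _]eq_fun do rewrite chart_mulKl; exact: is_derive_scale_line.
exact: is_derive1_unique H H2.
Qed.

Lemma left_field_translation (x z w : V) :
  'd F (x, z) (0, left_field z w) = left_field (F (x, z)) w.
Proof.
have := is_derive_chart_mul (is_derive_cst1 x 0) (is_derive_left_field z w).
rewrite scale0r chart_mul0r => H.
have H2 : is_derive (0 : R) 1 (fun s : R => F (x, F (z, s *: w))) (left_field (F (x, z)) w).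
  by under [X in is_derive _ _ X _]eq_fun do rewrite chart_mulA; exact: is_derive_left_field.
exact: is_derive1_unique H H2.
Qed.

Lemma is_derive_left_translation (x : V) (z : R -> V) (t : R) w :
  is_derive t 1 z (left_field (z t) w) ->
  is_derive t 1 (fun s => F (x, z s)) (left_field (F (x, z t)) w).
Proof.
move=> dz; rewrite -left_field_translation.
exact: is_derive_chart_mul (is_derive_cst1 x t) dz.
Qed.

Lemma left_field_line (w : V) (t : R) : left_field (t *: w) w = w.
Proof.
have H2 : is_derive (0 : R) 1 (fun s : R => F (t *: w, s *: w)) w.
  under [X in is_derive _ _ X _]eq_fun do rewrite chart_mul_line scalerDl.
  exact: is_derive_line.
exact: is_derive1_unique (is_derive_left_field _ _) H2.
Qed.

Lemma left_field_linear x : linear (left_field x).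
Proof.
move=> a u v; rewrite /left_field -linearP; congr ('d F _ _).
by rewrite -[RHS]/(a *: (0 : V) + 0, a *: u + v) scaler0 addr0.
Qed.
HB.instance Definition _ x := GRing.isLinear.Build R V V _ (left_field x) (left_field_linear x).

End ExpLieGroup.

(** * The stratification *)
Section Graded.
Context {R : realType} (G : carnotGroup R).
Local Notation V := 'rV[R]_(topdim G).
Local Notation exp := (lgexp G).
Local Notation log := (@lglog R _ G).
Local Notation F := (chart_mul G).
Local Notation ad := (ad G).
Local Notation s := (step G).

Let pi (i : 'I_s) : 'End(V) := sumv_pi_for (esym (layer_sum G)) i.

Definition proj_layer (j : nat) : 'End(V) := \sum_(i < s | i.+1 == j) pi i.
Local Notation P := proj_layer.

(** Extended by 0 so that brackets respect degrees without a condition on the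
    indices. *)
Definition Lay (k : nat) : {vspace V} := if (1 <= k <= s)%N then layer G k else 0%VS.

Lemma proj_layer_mem j x : P j x \in Lay j.
Proof.
rewrite /P sum_lfunE; apply: memv_suml => i /eqP <-.
rewrite /Lay /= ltn_ord; exact: (@memv_sum_pi _ _ _ _ xpredT).
Qed.

Lemma proj_layer0 x : P 0%N x = 0.
Proof. by have := proj_layer_mem 0%N x; rewrite /Lay /= memv0 => /eqP. Qed.

Lemma proj_layer_gt j x : (s < j)%N -> P j x = 0.
Proof. by move=> sj; have := proj_layer_mem j x; rewrite /Lay (leqNgt j) sj andbF memv0 => /eqP. Qed.

Lemma sum_proj_layerS x : x = \sum_(j < s) P j.+1 x.
Proof.
have E (i : 'I_s) : P i.+1 x = pi i x.
  rewrite /P sum_lfunE (bigD1 i) //= big1 ?addr0 // => k /andP[/eqP ki kni].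
  by case/eqP: kni; apply: val_inj; case: ki.
under eq_bigr do rewrite E.
by rewrite /pi (sumv_pi_sum (esym (layer_sum G))) ?memvf.
Qed.

Lemma sum_proj_layer x : x = \sum_(j < s.+1) P j x.
Proof. by rewrite big_ord_recl proj_layer0 add0r -sum_proj_layerS. Qed.

Lemma proj_layer_Lay i j x : x \in Lay j -> P i x = if i == j then x else 0.
Proof.
rewrite /Lay; case: ifPn => [/andP[j0 js] xj|_]; last first.
  by rewrite memv0 => /eqP ->; rewrite linear0 if_same.
case: j j0 js xj => // j _ js xj.
have [->|ij] := eqVneq i 0%N; first by rewrite proj_layer0.
have [si|si] := ltnP s i.
  by rewrite proj_layer_gt //; case: eqP => // eij; move: si js; rewrite eij ltnNge => /negP si /si.
case: i ij si => // i _ si.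
pose i0 := Ordinal js; pose k0 := Ordinal si.
have dir := layer_direct G.
have := @directv_sum_unique _ _ _ xpredT (fun i : 'I_s => layer G i.+1).
move=> /(_ dir) /(_ (fun k => P k.+1 x) (fun k => if k == i0 then x else 0)).
have h1 (k : 'I_s) : true -> P k.+1 x \in layer G k.+1.
  by move=> _; have := proj_layer_mem k.+1 x; rewrite /Lay /= ltn_ord.
have h2 (k : 'I_s) : true -> (if k == i0 then x else 0) \in layer G k.+1.
  by case: eqP => [->|_] //; rewrite mem0v.
move=> /(_ h1 h2); rewrite -sum_proj_layerS (bigD1 i0) //= eqxx big1 ?addr0 ?eqxx => [/esym/forallP/(_ k0) /= /eqP ->|k /negbTE -> //].
by rewrite -val_eqE.
Qed.

Lemma proj_layer_proj i j x : P i (P j x) = if i == j then P j x else 0.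
Proof. exact: proj_layer_Lay (proj_layer_mem _ _). Qed.

(** The first factor has degree 1 by definition of a stratification; a vector of
    degree [i.+1] is a sum of brackets of vectors of degrees 1 and [i], through
    which the bracket passes by the Jacobi identity. *)
Lemma ad_Lay i j u v : u \in Lay i -> v \in Lay j -> ad u v \in Lay (i + j).
Proof.
have ad1 k a b : a \in Lay 1 -> b \in Lay k -> ad a b \in Lay k.+1.
  rewrite {1}/Lay; case: ifP => [_ a1|_]; last by rewrite memv0 => /eqP ->; rewrite ad0l mem0v.
  have [->|k0] := posnP k; first by rewrite /Lay /= memv0 => /eqP ->; rewrite linear0 mem0v.
  have [ks bk|ks] := ltnP k s.
    have [|/(_ a b a1) + _] := @layer_gen _ G k.+1; first by rewrite ltnS k0.
    rewrite -ad_lie_bracket /Lay /= ks; apply.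
    by move: bk; rewrite /Lay k0 ltnW.
  rewrite {1}/Lay k0 /=; case: ifP => [ks' bk|_]; last first.
    by rewrite memv0 => /eqP ->; rewrite linear0 mem0v.
  have sk : k = s by apply/eqP; rewrite eqn_leq ks'.
  rewrite -ad_lie_bracket; rewrite sk in bk *.
  by rewrite layer_last // mem0v.
elim: i j u v => [|i IH] j u v; first by rewrite {1}/Lay /= memv0 => /eqP ->; rewrite ad0l mem0v.
have [->|i0] := posnP i; first by rewrite addSn add0n; exact: ad1.
have [is_ ui vj|si] := ltnP i s; last first.
  rewrite {1}/Lay; case: ifP => [/andP[_]|_ + _]; first by rewrite ltnNge si.
  by rewrite memv0 => /eqP ->; rewrite ad0l mem0v.
have isb : (2 <= i.+1 <= s)%N by rewrite ltnS i0.
have [_ /(_ (linfun (ad v) @^-1: Lay (i.+1 + j))%VS) HW] := @layer_gen _ G i.+1 isb.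
have iL b : b \in layer G i -> b \in Lay i by rewrite /Lay i0 ltnW.
have i1 b : b \in layer G 1 -> b \in Lay 1 by rewrite /Lay /= step_gt0.
have /subvP /(_ u) : (layer G i.+1 <= linfun (ad v) @^-1: Lay (i.+1 + j))%VS.
  apply: HW => a b /i1 a1 /iL bi; rewrite -memv_preim lfunE /= ad_lie_bracket ad_bracket.
  apply: memvD.
    rewrite (adC _ v a) adN memvN adC memvN addSnnS; apply: IH => //.
    exact: ad1.
  rewrite addSn; apply: ad1 => //; rewrite adC memvN; exact: IH.
rewrite -memv_preim lfunE /= => H; rewrite adC memvN; apply: H.
by move: ui; rewrite /Lay /= is_.
Qed.

Lemma proj_ad k u v :
  P k (ad u v) = \sum_(i < s.+1) \sum_(j < s.+1 | (i + j == k)%N) ad (P i u) (P j v).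
Proof.
rewrite {1}(sum_proj_layer u) {1}(sum_proj_layer v) ad_sum linear_sum /=.
apply: eq_bigr => i _; rewrite linear_sum linear_sum /= [RHS]big_mkcond /=.
apply: eq_bigr => j _.
rewrite (proj_layer_Lay _ (ad_Lay (proj_layer_mem i u) (proj_layer_mem j v))).
by rewrite eq_sym.
Qed.

(** * The filtration *)

(** The ideal of vectors of degree at least [j]; its exponential is the [j]-th
    term of the lower central series of the group. *)
Definition fil (j : nat) (x : V) : Prop := forall i, (i < j)%N -> P i x = 0.

Lemma fil1 x : fil 1 x. Proof. by case=> // _; rewrite proj_layer0. Qed.
Lemma filD j x y : fil j x -> fil j y -> fil j (x + y).
Proof. by move=> fx fy i ij; rewrite linearD /= fx // fy // addr0. Qed.
Lemma filZ j a x : fil j x -> fil j (a *: x).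
Proof. by move=> fx i ij; rewrite linearZ /= fx // scaler0. Qed.
Lemma filN j x : fil j x -> fil j (- x).
Proof. by move=> fx i ij; rewrite linearN /= fx // oppr0. Qed.
Lemma filB j x y : fil j x -> fil j y -> fil j (x - y).
Proof. by move=> fx fy; apply: filD => //; apply: filN. Qed.
Lemma fil_0 j : fil j 0. Proof. by move=> i _; rewrite linear0. Qed.
Lemma filS j k x : (j <= k)%N -> fil k x -> fil j x.
Proof. by move=> jk fx i ij; apply: fx; exact: leq_trans jk. Qed.
Lemma fil_sum (I : Type) (r : seq I) (Q : pred I) (f : I -> V) j :
  (forall i, Q i -> fil j (f i)) -> fil j (\sum_(i <- r | Q i) f i).
Proof. by move=> H; elim/big_rec: _ => [|i x Qi fx]; [exact: fil_0 | apply: filD => //; exact: H]. Qed.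

Lemma fil_ad a b u v : fil a u -> fil b v -> fil (a + b) (ad u v).
Proof.
move=> fu fv k kab; rewrite proj_ad big1 // => i _; rewrite big1 // => j /eqP ijk.
have [ia|ai] := ltnP i a; first by rewrite fu // ad0l.
by rewrite fv ?linear0 //; lia.
Qed.

Lemma fil_eq0 x : fil s.+1 x -> x = 0.
Proof. by move=> fx; rewrite (sum_proj_layer x) big1 // => i _; rewrite fx. Qed.

Lemma fil_Lay j x : x \in Lay j -> fil j x.
Proof. by move=> xj i ij; rewrite (proj_layer_Lay _ xj) ltn_eqF. Qed.

Lemma fil_iter_ad k j x y : fil j y -> fil (j + k) (iter k (ad x) y).
Proof.
move=> fy; elim: k => [|k IH]; first by rewrite addn0.
by rewrite addnS -addn1 addnC; apply: fil_ad IH; exact: fil1.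
Qed.

Lemma iter_ad_eq0 k x y : (s <= k)%N -> iter k (ad x) y = 0.
Proof.
move=> sk; apply: fil_eq0; apply: (@filS _ (1 + k)); first by rewrite add1n ltnS.
by apply: fil_iter_ad; exact: fil1.
Qed.

(** * Series for the adjoint action and for the differential of exp *)

Lemma zero_derive_const (W : normedModType R) (f : R -> W) (t : R) : 0 <= t ->
  (forall u, 0 <= u <= t -> is_derive u 1 f 0) -> f t = f 0.
Proof.
move=> t0 df; apply/eqP; rewrite -subr_eq0 -normr_le0.
have := @mean_value_le R W f 0 t 0 t0; rewrite mul0r; apply => u hu.
by exists 0; [exact: df | rewrite normr0].
Qed.

Lemma is_derive_expn k (t : R) : is_derive t 1 (fun u : R => u ^+ k) (k%:R * t ^+ k.-1).
Proof.
split; first exact: exprn_derivable.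
by rewrite exp_derive /= [_ *: 1]mulr1.
Qed.

Lemma is_derive_monomial k (w : V) (t : R) :
  is_derive t 1 (fun u : R => (u ^+ k / k`!%:R) *: w) ((k%:R * t ^+ k.-1 / k`!%:R) *: w).
Proof.
apply: is_derive_scalel.
have -> : (fun u : R => u ^+ k / k`!%:R) = (k`!%:R)^-1 \*: (fun u : R => u ^+ k).
  by apply/funext => u /=; rewrite mulrC.
by rewrite mulrC; apply: is_deriveZ; exact: is_derive_expn.
Qed.

Lemma iter_adZ a x k y : iter k (ad (a *: x)) y = a ^+ k *: iter k (ad x) y.
Proof.
elim: k => [|k IH]; first by rewrite expr0 scale1r.
by rewrite !iterS IH linearZ /= adZ scalerA -exprSr.
Qed.

(** The difference [e] of both sides along [t *: x] solves [e' = ad x e] and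
    vanishes at time 0. As [ad x] raises the degree, the components of [e] vanish
    one after the other. *)
Lemma Ad_expE x y :
  Ad (exp x) y = \sum_(k < s.+1) (k`!%:R)^-1 *: iter k (ad x) y.
Proof.
pose S (t : R) := \sum_(k < s.+1) (t ^+ k / k`!%:R) *: iter k (ad x) y.
pose e (t : R) := Ad (exp (t *: x)) y - S t.
have dS (t : R) : is_derive t 1 S (ad x (S t)).
  have -> : ad x (S t) = \sum_(k < s.+1) (k%:R * t ^+ k.-1 / k`!%:R) *: iter k (ad x) y.
    rewrite /S big_ord_recr linearD linear_sum /= [RHS]big_ord_recl /=.
    rewrite !mul0r scale0r add0r linearZ /= -iterS iter_ad_eq0 // scaler0 addr0.
    apply: eq_bigr => i _; rewrite linearZ /=; congr (_ *: _).
    rewrite /bump leq0n add1n add0n factS natrM invfM.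
    rewrite [i.+1%:R * _]mulrC -!mulrA; congr (_ * _).
    by rewrite mulrA mulfV ?mul1r // pnatr_eq0.
  by apply: is_derive_fsum => k; exact: is_derive_monomial.
have de (t : R) : is_derive t 1 e (ad x (e t)).
  by have := is_deriveB (is_derive_Ad_exp G x y t) (dS t); rewrite -linearB.
have e0 : e 0 = 0.
  rewrite /e /S scale0r lgexp0 Ad1 big_ord_recl big1 => [|i _].
    by rewrite expr0 fact0 divr1 scale1r addr0 subrr.
  by rewrite expr0n mul0r scale0r.
have fe m t : 0 <= t -> fil m (e t).
  elim: m t => [|m IH] t t0 //.
  move=> i; rewrite ltnS leq_eqVlt => /orP[/eqP ->|im]; last exact: IH.
  have -> : P m (e t) = P m (e 0).
    apply: (@zero_derive_const _ (fun u => P m (e u))) => // u /andP[u0 _].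
    have : is_derive u 1 (fun v : R => P m (e v)) (P m (ad x (e u))) by exact: is_derive_linear (de u).
    by rewrite (fil_ad (fil1 x) (IH u u0)).
  by rewrite e0 linear0.
have /eqP := fil_eq0 (fe s.+1 1 ler01).
rewrite /e scale1r subr_eq0 => /eqP ->.
by apply: eq_bigr => k _; rewrite expr1n mul1r.
Qed.

(** The Taylor coefficients of (1 - exp (- t)) / t. *)
Definition dcoef (k : nat) : R := (-1) ^+ k / k.+1`!%:R.

(** The derivative of [t *: dexp (t *: z) w] is [Ad (exp (- (t *: z))) w], so the
    series [Ad_expE] is integrated term by term from 0 to 1. *)
Lemma dexpE z w : dexp G z w = \sum_(k < s.+1) dcoef k *: iter k (ad z) w.
Proof.
pose S (t : R) := \sum_(k < s.+1) (t ^+ k.+1 / k.+1`!%:R) *: ((-1) ^+ k *: iter k (ad z) w).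
pose f (t : R) := t *: dexp G (t *: z) w - S t.
have df (t : R) : is_derive t 1 f 0.
  have dS : is_derive t 1 S (Ad (exp (- (t *: z))) w).
    have -> : Ad (exp (- (t *: z))) w =
      \sum_(k < s.+1) (k.+1%:R * t ^+ k.+1.-1 / k.+1`!%:R) *: ((-1) ^+ k *: iter k (ad z) w).
      rewrite Ad_expE; apply: eq_bigr => k _.
      rewrite -scaleNr iter_adZ !scalerA; congr (_ *: _).
      rewrite /= factS natrM [(- t) ^+ k]exprNn.
      have : (k.+1%:R : R) != 0 by rewrite pnatr_eq0.
      have : (k`!%:R : R) != 0 by rewrite pnatr_eq0 -lt0n fact_gt0.
      move: (k.+1%:R : R) (k`!%:R : R) (t ^+ k) ((-1 : R) ^+ k) => N M A B M0 N0.
      by field; rewrite M0 N0.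
    by apply: is_derive_fsum => k; exact: is_derive_monomial.
  by rewrite -(subrr (Ad (exp (- (t *: z))) w)); apply: is_deriveB => //; exact: is_derive_scale_dexp.
have : f 1 = f 0 by apply: zero_derive_const.
have S0 : S 0 = 0 by rewrite /S big1 // => k _; rewrite expr0n mul0r scale0r.
rewrite /f S0 /S !scale1r scale0r subr0 => /eqP; rewrite subr_eq0 => /eqP ->.
by apply: eq_bigr => k _; rewrite expr1n mul1r scalerA mulrC.
Qed.

Lemma dexp_subE z u : dexp G z u - u = \sum_(k < s) dcoef k.+1 *: iter k.+1 (ad z) u.
Proof.
have d0 : dcoef 0 = 1 by rewrite /dcoef expr0 divr1.
by rewrite dexpE big_ord_recl d0 scale1r addrAC subrr add0r.
Qed.

Lemma dexp_sub_fil j z u : fil j u -> fil j.+1 (dexp G z u - u).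
Proof.
move=> fu; rewrite dexp_subE; apply: fil_sum => k _; apply: filZ.
by apply: (@filS _ (j + k.+1)); [rewrite addnS ltnS leq_addr | exact: fil_iter_ad].
Qed.

Lemma dexp_fil j z u : fil j (dexp G z u) -> fil j u.
Proof.
move=> fd; have H m : (m <= j)%N -> fil m u.
  elim: m => [|m IH] mj //.
  have fm := dexp_sub_fil z (IH (ltnW mj)).
  rewrite -[u](subKr (dexp G z u)); apply: filB; [exact: filS mj fd | exact: fm].
exact: H.
Qed.

(** * Group law modulo the filtration *)

(** Along [t |-> x exp (t y)] the velocity in the chart is [y] up to terms of
    higher degree, because [dexp] is the identity up to such terms. *)
Lemma chart_mul_fil j x y : fil j y -> fil j.+1 (F (x, y) - x - y).
Proof.
move=> fy.
pose z (t : R) := F (x, t *: y).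
have dz (t : R) : is_derive t 1 z (left_field G (z t) y).
  apply: (@is_derive_left_translation _ _ G x (fun t : R => t *: y)).
  by rewrite left_field_line; exact: is_derive_scale_line.
have fz t : fil j (left_field G (z t) y).
  by apply: (@dexp_fil j (z t)); rewrite dexp_left_field.
move=> i ij.
pose f (t : R) := P i (z t) - t *: P i y.
have : f 1 = f 0.
  apply: zero_derive_const => // t _.
  have h : P i (left_field G (z t) y) = P i y.
    have := dexp_sub_fil (z t) (fz t) ij.
    by rewrite dexp_left_field linearB => /eqP; rewrite subr_eq0 => /eqP.
  rewrite -(subrr (P i y)); apply: is_deriveB; last exact: is_derive_scale_line.
  by rewrite -h; exact: is_derive_linear (dz t).
rewrite /f /z scale1r !scale0r chart_mul0r subr0 scale1r.
by move=> H; rewrite !linearB /= -addrA addrCA -H addrC subrr.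
Qed.

Lemma chart_mul_fil_closed j x y : fil j x -> fil j y -> fil j (F (x, y)).
Proof.
move=> fx fy; rewrite -[F _](subrK x) -[F _ - x](subrK y).
apply: filD => //; apply: filD => //; exact: filS (leqnSn _) (chart_mul_fil x fy).
Qed.

(** Descending induction on the degree: [b] is the product of [a] and [b - a] up
    to terms of higher degree. *)
Lemma coset_fil m a b : fil m (b - a) -> fil m (F (- a, b)).
Proof.
have [k mk] : exists k, (s.+1 <= m + k)%N by exists s.+1; rewrite leq_addl.
elim: k m a b mk => [|k IH] m a b mk fba.
  have /eqP : b - a = 0 by apply: fil_eq0; apply: filS fba; rewrite addn0 in mk.
  rewrite subr_eq0 => /eqP ->; rewrite -{2}(chart_mul0r G a) chart_mulKl; exact: fil_0.
set d := b - a in fba; pose a1 := F (a, d).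
have f1 : fil m.+1 (b - a1).
  have -> : b - a1 = - (F (a, d) - a - d).
    by rewrite /a1 /d !opprB addrA subrK.
  by apply: filN; exact: chart_mul_fil.
have fc : fil m.+1 (F (- a1, b)) by apply: IH => //; rewrite addSnnS.
have -> : F (- a, b) = F (d, F (- a1, b)).
  rewrite -[d](chart_mulKl G a) -/a1 -chart_mulA; congr (F (_, _)).
  by rewrite -{1}[a1]opprK chart_mulKl.
by apply: chart_mul_fil_closed => //; apply: filS (leqnSn _) fc.
Qed.

Lemma Ad_fil j x y : fil j y -> fil j.+2 (Ad (exp x) y - y - ad x y).
Proof.
move=> fy; rewrite Ad_expE.
have -> : \sum_(k < s.+1) (k`!%:R)^-1 *: iter k (ad x) y - y - ad x y =
   \sum_(k < s.-1) (k.+2`!%:R)^-1 *: iter k.+2 (ad x) y.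
  have := step_gt0 G; case: s => // s' _; rewrite big_ord_recl big_ord_recl /=.
  rewrite /bump /= fact0 invr1 !scale1r.
  by rewrite [y + _]addrC addrK [ad x y + _]addrC addrK.
apply: fil_sum => k _; apply: filZ.
by apply: (@filS _ (j + k.+2)); [lia | exact: fil_iter_ad].
Qed.

(** * Homogeneous bounds *)

Lemma ad_bounded : exists2 K, 0 < K & forall u v, `|ad u v| <= K * `|u| * `|v|.
Proof.
have /choice[k Hk] : forall i : 'I_(topdim G), exists K, 0 <= K /\ forall v, `|ad 'e_i v| <= K * `|v|.
  by move=> i; have [K K0 H] := linear_bounded (ad 'e_i); exists K; split => //; exact: ltW.
exists (1 + \sum_i k i).
  by rewrite ltr_pwDl // sumr_ge0 // => i _; case: (Hk i).
move=> u v; rewrite {1}(row_expand u) ad_sum.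
apply: (le_trans (ler_norm_sum _ _ _)).
rewrite mulrDl mul1r mulrDl; apply: ler_wpDl; first by rewrite mulr_ge0.
rewrite !mulr_suml; apply: ler_sum => i _.
rewrite adZ normrZ mulrAC [leRHS]mulrC; apply: ler_pM => //; first exact: coord_norm_le.
by case: (Hk i).
Qed.

(** Membership in a box of size [r] for the dilations of the group. The variant
    [bndu] looks at the degrees up to [m] only, for inductions on the degree. *)
Definition bndu (m : nat) (C r : R) (x : V) : Prop :=
  forall j, (j <= m)%N -> `|P j x| <= C * r ^+ j.
Definition bnd (C r : R) (x : V) : Prop := forall j, `|P j x| <= C * r ^+ j.

Lemma bndP m C r x : 0 <= C -> 0 <= r -> (s <= m)%N -> bndu m C r x -> bnd C r x.
Proof.
move=> C0 r0 sm H j; have [js|sj] := leqP j s; first exact: H (leq_trans js sm).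
by rewrite proj_layer_gt // normr0 mulr_ge0 // exprn_ge0.
Qed.

Lemma bnd_bndu m C r x : bnd C r x -> bndu m C r x. Proof. by move=> H j _. Qed.

Lemma bndu_le m k C C' r x : 0 <= r -> (k <= m)%N -> C <= C' -> bndu m C r x -> bndu k C' r x.
Proof.
move=> r0 km CC H j jk; apply: (le_trans (H j (leq_trans jk km))).
by rewrite ler_wpM2r // exprn_ge0.
Qed.

Lemma bnd_le C C' r x : 0 <= r -> C <= C' -> bnd C r x -> bnd C' r x.
Proof.
by move=> r0 CC H j; apply: (le_trans (H j)); rewrite ler_wpM2r // exprn_ge0.
Qed.

Lemma bnduD m C C' r x y : bndu m C r x -> bndu m C' r y -> bndu m (C + C') r (x + y).
Proof.
move=> H H' j jm; rewrite linearD mulrDl.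
by apply: (le_trans (ler_normD _ _)); apply: lerD; [exact: H | exact: H'].
Qed.

Lemma bnduZ m C r a x : bndu m C r x -> bndu m (`|a| * C) r (a *: x).
Proof. by move=> H j jm; rewrite linearZ normrZ -mulrA ler_wpM2l // H. Qed.

Lemma bnduN m C r x : bndu m C r x -> bndu m C r (- x).
Proof. by move=> H j jm; rewrite linearN normrN H. Qed.

Lemma bndN C r x : bnd C r x -> bnd C r (- x).
Proof. by move=> H j; rewrite linearN normrN H. Qed.

Lemma bndD C C' r x y : bnd C r x -> bnd C' r y -> bnd (C + C') r (x + y).
Proof.
move=> H H' j; rewrite linearD mulrDl.
by apply: (le_trans (ler_normD _ _)); apply: lerD; [exact: H | exact: H'].
Qed.

Lemma bndu_sum m r (n : nat) (C : 'I_n -> R) (x : 'I_n -> V) :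
  (forall i, bndu m (C i) r (x i)) -> bndu m (\sum_i C i) r (\sum_i x i).
Proof.
move=> H j jm; rewrite linear_sum mulr_suml.
by apply: (le_trans (ler_norm_sum _ _ _)); apply: ler_sum => i _; exact: H.
Qed.

(** No vector has a component of degree 0, so the component of degree [m.+1] of a
    bracket only involves components of degree at most [m] of its arguments: this
    is the gain of one degree. *)
Lemma ad_bndu : exists2 K, 0 < K & forall m C C' r u v,
  0 <= C -> 0 <= C' -> 0 <= r -> bndu m C r u -> bndu m C' r v ->
  bndu m.+1 (K * C * C') r (ad u v).
Proof.
have [K K0 HK] := ad_bounded.
exists (K * s.+1%:R * s.+1%:R); first by rewrite !mulr_gt0.
move=> m C C' r u v C0 C'0 r0 Hu Hv k km.
have B0 : 0 <= K * C * C' * r ^+ k by rewrite !mulr_ge0 ?exprn_ge0 // ltW.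
have term (i j : nat) : (i + j == k)%N -> `|ad (P i u) (P j v)| <= K * C * C' * r ^+ k.
  move=> /eqP ijk.
  have [->|i0] := posnP i; first by rewrite proj_layer0 ad0l normr0.
  have [->|j0] := posnP j; first by rewrite proj_layer0 linear0 normr0.
  apply: (le_trans (HK _ _)).
  have hi : `|P i u| <= C * r ^+ i by apply: Hu; lia.
  have hj : `|P j v| <= C' * r ^+ j by apply: Hv; lia.
  rewrite -ijk exprD.
  have -> : K * C * C' * (r ^+ i * r ^+ j) = K * (C * r ^+ i) * (C' * r ^+ j) by ring.
  apply: ler_pM => //; first by rewrite mulr_ge0 // ltW.
  by rewrite ler_wpM2l // ltW.
rewrite proj_ad.
have -> : K * s.+1%:R * s.+1%:R * C * C' * r ^+ k =
  \sum_(i < s.+1) \sum_(j < s.+1) (K * C * C' * r ^+ k).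
  rewrite sumr_const card_ord sumr_const card_ord -[RHS]mulr_natr.
  by rewrite -[in RHS](mulr_natr (K * C * C' * r ^+ k)); move: (s.+1%:R : R) => N; ring.
apply: (le_trans (ler_norm_sum _ _ _)); apply: ler_sum => i _.
apply: (le_trans (ler_norm_sum _ _ _)); rewrite big_mkcond /=; apply: ler_sum => j _.
by case: ifP => // ijk; exact: term.
Qed.

Lemma iter_ad_bndu : exists2 K, 0 < K & forall k m C D r z u,
  0 <= C -> 0 <= D -> 0 <= r -> bndu m C r z -> bndu m D r u ->
  bndu m.+1 ((K * C) ^+ k.+1 * D) r (iter k.+1 (ad z) u).
Proof.
have [K K0 HK] := ad_bndu; exists K => // k m C D r z u C0 D0 r0 Hz Hu.
elim: k => [|k IH]; first by rewrite expr1; exact: HK.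
rewrite iterS.
have KC : 0 <= (K * C) ^+ k.+1 * D by rewrite mulr_ge0 // exprn_ge0 // mulr_ge0 // ltW.
have := HK m C _ r z _ C0 KC r0 Hz (bndu_le r0 (leqnSn _) (lexx _) IH).
by rewrite [_ ^+ k.+2]exprS -[(K * C) * _ * D]mulrA.
Qed.

(** The terms of [dexp z u - u] are iterated brackets, so in degree [m.+1] they
    are controlled by the components of [u] of degree at most [m]: a bound on
    [dexp z u] passes to [u] by induction on the degree. *)
Lemma dexp_bndu (C : R) : 0 <= C -> exists2 K, 1 <= K & forall m r theta z u,
  0 <= r -> 0 <= theta -> bndu m C r z -> bndu m (C * theta) r u ->
  bndu m.+1 theta r (dexp G z u) -> bndu m.+1 (K * theta) r u.
Proof.
move=> C0; have [K K0 HK] := iter_ad_bndu.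
exists (1 + \sum_(k < s) `|dcoef k.+1| * ((K * C) ^+ k.+1 * C)).
  rewrite lerDl sumr_ge0 // => k _.
  by rewrite !mulr_ge0 // exprn_ge0 // mulr_ge0 // ltW.
move=> m r th z u r0 th0 Hz Hu Hd.
rewrite -[u](subKr (dexp G z u)) dexp_subE mulrDl mul1r.
apply: bnduD => //; apply: bnduN; rewrite mulr_suml; apply: bndu_sum => k.
rewrite -mulrA -[_ * C * th]mulrA; apply: bnduZ.
by apply: HK => //; rewrite mulr_ge0.
Qed.

Lemma Ad_bnd (C : R) : 0 <= C -> exists2 K, 0 <= K & forall r theta x y,
  0 <= r -> 0 <= theta -> bnd C r x -> bnd theta r y -> bnd (K * theta) r (Ad (exp x) y).
Proof.
move=> C0; have [K K0 HK] := iter_ad_bndu.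
have KC k : 0 <= (K * C) ^+ k by rewrite exprn_ge0 // mulr_ge0 // ltW.
exists (\sum_(k < s.+1) `|(k`!%:R)^-1| * (K * C) ^+ k).
  by apply: sumr_ge0 => k _; rewrite mulr_ge0.
move=> r th x y r0 th0 Hx Hy.
apply: (@bndP s) => //.
  by rewrite mulr_ge0 // sumr_ge0 // => k _; rewrite mulr_ge0.
rewrite Ad_expE mulr_suml; apply: bndu_sum => -[k ks]; rewrite -mulrA /=; apply: bnduZ.
case: k ks => [_|k _]; first by rewrite expr0 mul1r; exact: bnd_bndu.
apply: (@bndu_le s.+1) => //.
by apply: HK => //; exact: bnd_bndu.
Qed.

End Graded.

Section AlmostEverywhere.
Context {R : realType}.
Local Notation mu := (@lebesgue_measure R).

Lemma ae_imp (P Q : R -> Prop) : (forall t, P t -> Q t) ->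
  {ae mu, forall t, P t} -> {ae mu, forall t, Q t}.
Proof. by move=> PQ; apply: filterS PQ; exact: (ae_filter_ringOfSetsType mu). Qed.

Lemma ae_and (P Q : R -> Prop) :
  {ae mu, forall t, P t} -> {ae mu, forall t, Q t} -> {ae mu, forall t, P t /\ Q t}.
Proof. by apply: filterS2; [exact: (ae_filter_ringOfSetsType mu) | split]. Qed.

End AlmostEverywhere.

(** * Homogeneous bounds for curves and products *)
Section CurveBounds.
Context {R : realType} (G : carnotGroup R).
Local Notation V := 'rV[R]_(topdim G).
Local Notation exp := (lgexp G).
Local Notation log := (@lglog R _ G).
Local Notation F := (chart_mul G).
Local Notation s := (step G).
Local Notation P := (proj_layer G).
Local Notation mu := (@lebesgue_measure R).

Lemma lfun_bounded (f : 'End(V)) : exists2 K, 0 < K & forall x, `|f x| <= K * `|x|.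
Proof. exact: linear_bounded. Qed.

(** Integration, degree after degree, of the triangular equation satisfied by a
    curve. The factor [L] in front of the velocities makes the statement invariant
    under a change of the length of the time interval. *)
Lemma curve_bndu m : exists2 K, 1 <= K & forall r L th Kz (z zd : R -> V),
  0 <= r -> 0 < L -> 0 <= th <= 1 ->
  (forall s t, 0 <= s <= L -> 0 <= t <= L -> `|z s - z t| <= Kz * `|s - t|) ->
  {ae mu, forall t : R, t \in `[0, L] ->
     is_derive t 1 z (zd t) /\ bnd th r (L *: dexp G (z t) (zd t))} ->
  bnd 1 r (z 0) ->
  (forall t, 0 <= t <= L -> bndu m (K * th) r (z t - z 0)) /\
  {ae mu, forall t : R, t \in `[0, L] -> bndu m (K * th) r (L *: zd t)}.
Proof.
elim: m => [|m [K K1 IH]].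
  exists 1 => // r L th Kz z zd r0 L0 /andP[th0 th1] _ _ _.
  have H x : bndu 0 (1 * th) r (x : V).
    move=> j; rewrite leqn0 => /eqP ->.
    by rewrite proj_layer0 normr0 mul1r expr0 mulr1.
  by split => [t _|]; [exact: H | apply: aeW => t _; exact: H].
have K0 : 0 <= 1 + K by lra.
have [K' K'1 HK'] := dexp_bndu G K0.
exists (K + K'); first by lra.
move=> r L th Kz z zd r0 L0 /andP[th0 th1] zL ae0 z0.
have th01 : 0 <= th <= 1 by rewrite th0.
have [Hz Hzd] := IH r L th Kz z zd r0 L0 th01 zL ae0 z0.
have bz t : 0 <= t <= L -> bndu m (1 + K) r (z t).
  move=> tL; rewrite -[z t](subrK (z 0)) [_ + z 0]addrC.
  apply: (bndu_le r0 (leqnn m) _ (bnduD (bnd_bndu (m := m) z0) (Hz t tL))).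
  by rewrite lerD2l; apply: ler_piMr => //; lra.
have Hzd' : {ae mu, forall t : R, t \in `[0, L] ->
    is_derive t 1 z (zd t) /\ bndu m.+1 (K' * th) r (L *: zd t)}.
  apply: ae_imp (ae_and Hzd ae0) => t [H1 H2] tL.
  have [dz bw] := H2 tL; split => //.
  have tL' : 0 <= t <= L by move: tL; rewrite in_itv.
  apply: (HK' m r th (z t)) => //; first exact: bz.
    apply: (bndu_le r0 (leqnn m) _ (H1 tL)).
    by rewrite ler_wpM2r //; lra.
  by rewrite linearZ; exact: bnd_bndu.
have le1 : K' * th <= (K + K') * th by rewrite ler_wpM2r //; lra.
split; last first.
  apply: ae_imp Hzd' => t H tL; have [_] := H tL.
  exact: bndu_le.
move=> t tL j; rewrite leq_eqVlt ltnS => /orP[/eqP -> {j}|jm]; last first.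
  apply: (le_trans (Hz t tL j jm)); rewrite ler_wpM2r ?exprn_ge0 // ler_wpM2r //; lra.
have [c c0 Hc] := lfun_bounded (P m.+1).
have rm : 0 <= r ^+ m.+1 by rewrite exprn_ge0.
pose M := K' * th * r ^+ m.+1 / L.
have M0 : 0 <= M by rewrite divr_ge0 ?mulr_ge0 //; lra.
move/andP: (tL) => [t0 tL1].
rewrite linearB; apply: (@le_trans _ _ (M * (t - 0))).
  apply: (@ae_mean_value_le R _ (fun u => P m.+1 (z u)) 0 t M (c * Kz)) => //.
    move=> u v /andP[u0 u1] /andP[v0 v1]; rewrite -linearB.
    apply: (le_trans (Hc _)); rewrite -mulrA ler_wpM2l ?(ltW c0) // zL //; lra.
  apply: ae_imp Hzd' => u H; rewrite in_itv /= => /andP[u0 u1].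
  have [|du bu] := H; first by rewrite in_itv /= u0 (le_trans u1).
  exists (P m.+1 (zd u)); first exact: is_derive_linear du.
  have := bu m.+1 (leqnn _); rewrite linearZ normrZ gtr0_norm // => h.
  by rewrite /M ler_pdivlMr // mulrC.
rewrite subr0 /M -mulrA mulrC.
have h1 : L^-1 * t <= 1 by rewrite mulrC ler_pdivrMr // mul1r.
rewrite mulrC; apply: (@le_trans _ _ (K' * th * r ^+ m.+1)).
  by apply: ler_piMr => //; rewrite !mulr_ge0 //; lra.
by rewrite ler_wpM2r.
Qed.

Lemma curve_bnd : exists2 K, 1 <= K & forall r L th Kz (z zd : R -> V),
  0 <= r -> 0 < L -> 0 <= th <= 1 ->
  (forall s t, 0 <= s <= L -> 0 <= t <= L -> `|z s - z t| <= Kz * `|s - t|) ->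
  {ae mu, forall t : R, t \in `[0, L] ->
     is_derive t 1 z (zd t) /\ bnd th r (L *: dexp G (z t) (zd t))} ->
  bnd 1 r (z 0) ->
  forall t, 0 <= t <= L -> bnd (K * th) r (z t - z 0).
Proof.
have [K K1 HK] := curve_bndu s; exists K => // r L th Kz z zd r0 L0 th01 zL ae0 z0 t tL.
have [H _] := HK r L th Kz z zd r0 L0 th01 zL ae0 z0.
apply: (@bndP _ _ s) => //; last exact: H.
by move/andP: th01 => [? _]; rewrite mulr_ge0 //; lra.
Qed.

Lemma chart_mul_lipschitz (x : V) (r : R) : exists2 K, 0 <= K & forall y y' : V,
  `|y| <= r -> `|y'| <= r -> `|F (x, y) - F (x, y')| <= K * `|y - y'|.
Proof.
have dF y : differentiable (fun y => F (x, y)) y.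
  apply: (@differentiable_comp _ _ _ _ (fun y : V => (x, y)) F); last exact: diff_chart_mul.
  by apply: differentiable_pair => //; exact: differentiable_cst.
apply: C1_lipschitz_ball => // v y.
have E : 'D_v (fun y => F (x, y)) = 'D_(0, v) F \o (fun y : V => (x, y)).
  apply/funext => y' /=; rewrite !deriveE //; last exact: diff_chart_mul.
  have H1 := derivable_direction v (dF y').
  have H2 := is_derive_chart_mul G (is_derive_cst1 x 0) (is_derive_line y' v 0).
  have := is_derive1_unique H1 H2.
  by rewrite scale0r addr0.
rewrite E; apply: continuous_comp; last exact: cont_D_chart_mul.
by apply: differentiable_continuous; apply: differentiable_pair => //; exact: differentiable_cst.
Qed.

Lemma is_derive_chart_mul_line (x y : V) (t : R) :
  is_derive t 1 (fun t : R => F (x, t *: y)) (left_field G (F (x, t *: y)) y).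
Proof.
apply: (@is_derive_left_translation _ _ G x (fun t : R => t *: y)).
by rewrite left_field_line; exact: is_derive_scale_line.
Qed.

(** The curve [t |-> x exp (t y)] runs from [x] to the product with constant
    left-trivialized velocity [y]. *)
Lemma chart_mul_bnd : exists2 K, 1 <= K & forall r th x y,
  0 <= r -> 0 <= th <= 1 -> bnd 1 r x -> bnd th r y ->
  bnd (K * th) r (F (x, y) - x).
Proof.
have [K K1 HK] := curve_bnd; exists K => // r th x y r0 th01 bx by_.
have [Kf Kf0 HKf] := chart_mul_lipschitz x `|y|.
have H u : 0 <= u <= 1 -> `|u *: y| <= `|y|.
  move=> /andP[u0 u1]; rewrite normrZ ger0_norm //; exact: ler_piMl.
have := @HK r 1 th (Kf * `|y|) (fun t => F (x, t *: y)) (fun t => left_field G (F (x, t *: y)) y)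
  r0 ltr01 th01.
rewrite scale0r chart_mul0r => /(_ _ _ bx) H1.
have := H1 _ _ 1; rewrite scale1r; apply.
- move=> u v u01 v01; apply: (le_trans (HKf _ _ (H u u01) (H v v01))).
  by rewrite -scalerBl normrZ -mulrA ler_wpM2l // mulrC.
- apply: aeW => t _; split; first exact: is_derive_chart_mul_line.
  by rewrite scale1r dexp_left_field.
- by rewrite ler01 lexx.
Qed.

Lemma bnd_scale_in C r (x : V) : 1 <= C -> 0 <= r -> bnd C r x -> bnd 1 (C * r) x.
Proof.
move=> C1 r0 H j; rewrite mul1r exprMn.
case: j => [|j]; first by rewrite proj_layer0 normr0 !expr0 mulr1.
apply: (le_trans (H _)); rewrite ler_wpM2r ?exprn_ge0 //.
by rewrite ler_eXnr.
Qed.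

Lemma bnd_scale_out C K r (x : V) : 1 <= C -> 0 <= K -> 0 <= r -> bnd K (C * r) x -> bnd (K * C ^+ s) r x.
Proof.
move=> C1 K0 r0 H; apply: (@bndP _ _ s) => //.
  by rewrite mulr_ge0 // exprn_ge0 //; lra.
move=> j js; apply: (le_trans (H j)); rewrite exprMn mulrA ler_wpM2r ?exprn_ge0 //.
by rewrite ler_wpM2l // ler_weXn2l.
Qed.

Lemma chart_mul_bndC (C : R) : exists2 K, 0 <= K & forall r x y,
  0 <= r -> bnd C r x -> bnd C r y -> bnd K r (F (x, y)).
Proof.
have [K K1 HK] := chart_mul_bnd.
pose C' := 1 + `|C|.
have C'1 : 1 <= C' by rewrite /C' lerDl.
exists ((K + 1) * C' ^+ s); first by rewrite mulr_ge0 ?exprn_ge0 //; lra.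
move=> r x y r0 bx by_.
have CC' : C <= C' by rewrite /C'; have := ler_norm C; lra.
have C'r : 0 <= C' * r by rewrite mulr_ge0 //; lra.
have bx' := bnd_scale_in C'1 r0 (bnd_le r0 CC' bx).
have by' := bnd_scale_in C'1 r0 (bnd_le r0 CC' by_).
apply: bnd_scale_out => //; first by lra.
rewrite -[F _](subrK x); apply: bndD => //.
by rewrite -[K]mulr1; apply: HK => //; rewrite ler01 lexx.
Qed.

Lemma proj1_dexp z u : P 1%N (dexp G z u) = P 1%N u.
Proof.
apply/eqP; rewrite -subr_eq0 -linearB; apply/eqP.
exact: (dexp_sub_fil z (@fil1 _ G u)).
Qed.

Lemma proj1_chart_mul x y : P 1%N (F (x, y)) = P 1%N x + P 1%N y.
Proof.
have := chart_mul_fil x (@fil1 _ G y) (ltnSn 1).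
by rewrite !linearB /= => /eqP; rewrite -addrA -opprD subr_eq0 => /eqP.
Qed.

Lemma proj_chart_mul j x y : fil j y -> P j (F (x, y)) = P j x + P j y.
Proof.
move=> fy; have := chart_mul_fil x fy (ltnSn j).
by rewrite !linearB /= => /eqP; rewrite -addrA -opprD subr_eq0 => /eqP.
Qed.

End CurveBounds.

(** * The Euclidean structure of the space of controls *)
Section Euclidean.
Context {R : realType} {r : nat}.
Implicit Types a b : 'rV[R]_r.

Definition dot a b : R := \sum_i a 0 i * b 0 i.
Definition norm2 a : R := Num.sqrt (dot a a).

Lemma dotC a b : dot a b = dot b a.
Proof. by apply: eq_bigr => i _; rewrite mulrC. Qed.
Lemma dotDl a b c : dot (a + b) c = dot a c + dot b c.
Proof. by rewrite -big_split; apply: eq_bigr => i _; rewrite !mxE mulrDl. Qed.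
Lemma dotZl k a b : dot (k *: a) b = k * dot a b.
Proof. by rewrite mulr_sumr; apply: eq_bigr => i _; rewrite !mxE mulrA. Qed.
Lemma dotNl a b : dot (- a) b = - dot a b.
Proof. by rewrite -scaleN1r dotZl mulN1r. Qed.
Lemma dotDr a b c : dot a (b + c) = dot a b + dot a c.
Proof. by rewrite dotC dotDl !(dotC a). Qed.
Lemma dotZr k a b : dot a (k *: b) = k * dot a b.
Proof. by rewrite dotC dotZl dotC. Qed.
Lemma dotNr a b : dot a (- b) = - dot a b.
Proof. by rewrite dotC dotNl dotC. Qed.
Lemma dot0l a : dot 0 a = 0.
Proof. by rewrite -(scale0r a) dotZl mul0r. Qed.
Lemma dot_ge0 a : 0 <= dot a a.
Proof. by apply: sumr_ge0 => i _; rewrite -expr2 sqr_ge0. Qed.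
Lemma dot_eq0 a : dot a a = 0 -> a = 0.
Proof.
move=> /eqP; rewrite psumr_eq0 => [/allP H|i _]; last by rewrite -expr2 sqr_ge0.
apply/rowP => i; have := H i (mem_index_enum i).
by rewrite mxE -expr2 sqrf_eq0 => /eqP.
Qed.
Lemma norm2_ge0 a : 0 <= norm2 a. Proof. exact: sqrtr_ge0. Qed.
Lemma sqr_norm2 a : norm2 a ^+ 2 = dot a a. Proof. by rewrite sqr_sqrtr // dot_ge0. Qed.

Lemma dot_le_norm2 a b : dot a b <= norm2 a * norm2 b.
Proof.
have [b0|b0] := eqVneq (norm2 b) 0.
  have -> : b = 0 by apply: dot_eq0; rewrite -sqr_norm2 b0 expr0n.
  by rewrite dotC dot0l mulr_ge0 // norm2_ge0.
have [a0|a0] := eqVneq (norm2 a) 0.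
  have -> : a = 0 by apply: dot_eq0; rewrite -sqr_norm2 a0 expr0n.
  by rewrite dot0l mulr_ge0 // norm2_ge0.
have bp : 0 < norm2 b by rewrite lt_neqAle eq_sym b0 norm2_ge0.
have ap : 0 < norm2 a by rewrite lt_neqAle eq_sym a0 norm2_ge0.
have := dot_ge0 (norm2 b *: a - norm2 a *: b).
rewrite dotDl !dotDr !dotNl !dotNr !dotZl !dotZr -!sqr_norm2 (dotC b a) opprK => H.
have H2 : 0 <= 2 * (norm2 a * norm2 b) * (norm2 a * norm2 b - dot a b).
  apply: le_trans H _; rewrite le_eqVlt; apply/orP; left; apply/eqP; ring.
have p : 0 < 2 * (norm2 a * norm2 b) by rewrite !mulr_gt0.
by move: H2; rewrite pmulr_rge0 // subr_ge0.
Qed.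

Lemma coord_le_norm2 a i : `|a 0 i| <= norm2 a.
Proof.
rewrite -(sqrtr_sqr (a 0 i)) ler_sqrt ?dot_ge0 // /dot (bigD1 i) //= -expr2 lerDl.
by apply: sumr_ge0 => j _; rewrite -expr2 sqr_ge0.
Qed.

Lemma norm2Z k a : norm2 (k *: a) = `|k| * norm2 a.
Proof. by rewrite /norm2 dotZl dotZr mulrA -expr2 sqrtrM ?sqr_ge0 // sqrtr_sqr. Qed.

End Euclidean.

(** * Coordinates on the first layer *)
Section FirstLayer.
Context {R : realType} (G : carnotGroup R).
Local Notation V := 'rV[R]_(topdim G).
Local Notation exp := (lgexp G).
Local Notation log := (@lglog R _ G).
Local Notation F := (chart_mul G).
Local Notation P := (proj_layer G).
Local Notation mu := (@lebesgue_measure R).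
Local Notation r := (rank G).
Local Notation X i := (tnth (frame G) i).

Definition embed (a : 'rV[R]_r) : V := \sum_i a 0 i *: X i.

Lemma embed_linear : linear embed.
Proof.
move=> k a b; rewrite /embed scaler_sumr -big_split; apply: eq_bigr => i _ /=.
by rewrite !mxE scalerDl scalerA.
Qed.
HB.instance Definition _ := GRing.isLinear.Build R 'rV[R]_r V _ embed embed_linear.

Lemma embed_layer a : embed a \in layer G 1.
Proof.
apply: memv_suml => i _; apply: memvZ; apply: (basis_mem (frame_basis G)).
exact: mem_tnth.
Qed.

Lemma Lay1 : Lay G 1 = layer G 1. Proof. by rewrite /Lay /= step_gt0. Qed.

Lemma proj1_embed a : P 1%N (embed a) = embed a.
Proof. by rewrite (proj_layer_Lay _ (j := 1)) // Lay1 embed_layer. Qed.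

Lemma layer1_embed z : z \in layer G 1 -> exists a, z = embed a.
Proof.
rewrite -(span_basis (frame_basis G)) => /coord_span zE.
exists (\row_i coord (frame G) i z).
rewrite {1}zE /embed; apply: eq_bigr => i _.
by rewrite mxE (tnth_nth 0).
Qed.

Lemma scal_embed_frame a i : scal G (embed a) (X i) = a 0 i.
Proof.
rewrite /embed linear_sumlz (bigD1 i) //= big1 ?addr0 => [|j /negbTE ji].
  by rewrite linearZl_LR /= frame_orthonormal eqxx /= mulr1.
by rewrite linearZl_LR /= frame_orthonormal ji mulr0.
Qed.

Lemma scal_embed a b : scal G (embed a) (embed b) = dot a b.
Proof.
rewrite /(embed b) linear_sumr; apply: eq_bigr => i _.
by rewrite linearZr_LR /= scal_embed_frame mulrC.
Qed.

Definition coord1 (z : V) : 'rV[R]_r := \row_i scal G (P 1%N z) (X i).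

Lemma coord1_linear : linear coord1.
Proof.
move=> k a b; apply/rowP => i; rewrite !mxE linearP /=.
by rewrite linearDl linearZl_LR.
Qed.
HB.instance Definition _ := GRing.isLinear.Build R V 'rV[R]_r _ coord1 coord1_linear.

Lemma coord1_embed a : coord1 (embed a) = a.
Proof. by apply/rowP => i; rewrite mxE proj1_embed scal_embed_frame. Qed.

Lemma embed_coord1 z : embed (coord1 z) = P 1%N z.
Proof.
have : P 1%N z \in layer G 1 by rewrite -Lay1 proj_layer_mem.
move=> /layer1_embed[a aE]; rewrite aE; congr embed; rewrite -[RHS]coord1_embed -aE.
by apply/rowP => i; rewrite !mxE proj_layer_proj.
Qed.

Lemma coord1_chart_mul x y : coord1 (F (x, y)) = coord1 x + coord1 y.
Proof.
by apply/rowP => i; rewrite !mxE proj1_chart_mul linearDl.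
Qed.

Lemma coord1_dexp z u : coord1 (dexp G z u) = coord1 u.
Proof. by apply/rowP => i; rewrite !mxE proj1_dexp. Qed.

(** * Horizontal curves *)

Definition cvec (h : 'I_r -> R -> R) (t : R) : 'rV[R]_r := \row_i h i t.

Lemma control_normE h t : control_norm h t = norm2 (cvec h t).
Proof.
by congr Num.sqrt; apply: eq_bigr => i _; rewrite !mxE expr2.
Qed.

Lemma frame_field_sum h t x :
  \sum_(i < r) h i t *: frame_field i x = left_field G (log x) (embed (cvec h t)).
Proof.
rewrite /embed linear_sum; apply: eq_bigr => i _.
by rewrite /frame_field left_invariant_fieldE linearZ mxE.
Qed.

Lemma lipschitz_on_itvP (f : R -> V) (a b : R) :
  [lipschitz f t | t in `[a, b]%classic] <->
  exists K, forall s t, a <= s <= b -> a <= t <= b -> `|f s - f t| <= K * `|s - t|.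
Proof.
split=> [[M [Mr H]]|[K H]].
  exists (M + 1) => s t sab tab.
  have M1 : M < M + 1 by rewrite ltrDl.
  by have := H (M + 1) M1 (s, t); apply; rewrite /= !in_itv.
exists K; split; first exact: num_real.
move=> M KM [s t] [/= ]; rewrite !in_itv /= => sab tab.
by apply: (le_trans (H _ _ sab tab)); rewrite ler_wpM2r // ltW.
Qed.

(** The speed is only bounded by 1, which allows a curve to wait and makes
    lengths monotone, see [reach_le]. *)
Definition horizontal1 (a b : R) (g : R -> G) (h : 'I_r -> R -> R) : Prop :=
  [/\ exists K, forall s t, a <= s <= b -> a <= t <= b ->
        `|log (g s) - log (g t)| <= K * `|s - t|,
      forall i, measurable_fun `[a, b] (h i),
      {ae mu, forall t, t \in `[a, b] ->
        is_derive t 1 (fun t => log (g t)) (left_field G (log (g t)) (embed (cvec h t)))}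
    & {ae mu, forall t, t \in `[a, b] -> norm2 (cvec h t) <= 1}].

Lemma horizontal1_horizontal a b g h : horizontal1 a b g h -> horizontal a b g h.
Proof.
move=> [L m d n]; split; first exact/lipschitz_on_itvP.
  move=> i; split => //; exists 1; apply: ae_imp n => t H tab.
  by have := coord_le_norm2 (cvec h t) i; rewrite mxE => /le_trans; apply; exact: H.
by apply: ae_imp d => t H tab; rewrite frame_field_sum; exact: H.
Qed.

Lemma horizontal_horizontal1 a b g h : horizontal a b g h ->
  arclength_parametrized a b h -> horizontal1 a b g h.
Proof.
move=> [L m d] n; split; first exact/lipschitz_on_itvP.
- by move=> i; case: (m i).
- by apply: ae_imp d => t H tab; rewrite -frame_field_sum; exact: H.
- by apply: ae_imp n => t H tab; rewrite -control_normE H.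
Qed.

Lemma horizontal1_sub a b a' b' g h : a <= a' -> b' <= b ->
  horizontal1 a b g h -> horizontal1 a' b' g h.
Proof.
move=> aa bb [[K HK] m d n].
have sub t : t \in `[a', b'] -> t \in `[a, b].
  by rewrite !in_itv /= => /andP[h1 h2]; rewrite (le_trans aa) // (le_trans _ bb).
split.
- exists K => s t /andP[s1 s2] /andP[t1 t2]; apply: HK.
    by rewrite (le_trans aa) // (le_trans s2).
  by rewrite (le_trans aa) // (le_trans t2).
- by move=> i; apply: measurable_funS (m i).
- by apply: ae_imp d => t H /sub; exact: H.
- by apply: ae_imp n => t H /sub; exact: H.
Qed.

Lemma ae_translation (c : R) (Q : R -> Prop) :
  {ae mu, forall t, Q t} -> {ae mu, forall t, Q (t - c)}.
Proof. exact: (@negligible_translation _ (- c) (~` [set t | Q t])). Qed.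

Lemma horizontal1_move a b (c : R) (x : G) g h : a <= b -> horizontal1 a b g h ->
  horizontal1 (a + c) (b + c) (fun t => x * g (t - c))%g (fun i t => h i (t - c)).
Proof.
move=> ab [[K HK] m d n].
have sub t : t \in `[a + c, b + c] -> t - c \in `[a, b].
  by rewrite !in_itv /= => /andP[h1 h2]; apply/andP; split; lra.
have sub' t : a + c <= t <= b + c -> a <= t - c <= b.
  by move=> /andP[h1 h2]; apply/andP; split; lra.
have E t : cvec (fun i t => h i (t - c)) t = cvec h (t - c) by apply/rowP => i; rewrite !mxE.
split.
- pose rr := `|log (g a)| + `|K| * (b - a).
  have bg t : a <= t <= b -> `|log (g t)| <= rr.
    move=> tab; rewrite -(subrK (log (g a)) (log (g t))) addrC.
    apply: (le_trans (ler_normD _ _)); rewrite lerD2l.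
    have aab : a <= a <= b by rewrite lexx.
    apply: (le_trans (HK _ _ tab aab)); move/andP: tab => [h1 h2].
    have -> : `|t - a| = t - a by rewrite ger0_norm // subr_ge0.
    apply: (@le_trans _ _ (`|K| * (t - a))).
      by rewrite ler_wpM2r ?ler_norm // subr_ge0.
    by rewrite ler_wpM2l //; lra.
  have [Kf Kf0 HKf] := chart_mul_lipschitz (log x) rr.
  exists (Kf * K) => s t /sub' sab /sub' tab.
  rewrite !lglogM; apply: (le_trans (HKf _ _ (bg _ sab) (bg _ tab))).
  rewrite -mulrA ler_wpM2l //; apply: (le_trans (HK _ _ sab tab)).
  by rewrite opprB addrA subrK.
- move=> i; rewrite (_ : (fun t => h i (t - c)) = h i \o (fun t => t - c)) //.
  apply: (@measurable_comp _ _ _ _ _ _ `[a, b]%classic) => //.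
    by move=> _ [t /= tab <-]; exact: sub.
  by apply: measurable_funD.
- apply: ae_imp (ae_translation c d) => t H /sub tab; have {}H := H tab.
  have H1 : is_derive t 1 (fun t => log (g (t - c))) (left_field G (log (g (t - c))) (embed (cvec h (t - c)))).
    have := @is_derive_affine R _ (fun t => log (g t)) 1 (- c) t _.
    rewrite mul1r => /(_ _ H); rewrite scale1r.
    by under [Y in is_derive _ _ Y _ -> _]eq_fun do rewrite mul1r.
  have := is_derive_left_translation (log x) H1; rewrite E lglogM.
  by under [Y in is_derive _ _ Y _ -> _]eq_fun do rewrite -lglogM.
- by apply: ae_imp (ae_translation c n) => t H /sub tab; rewrite E; exact: H.
Qed.

Lemma ae_neq (c : R) : {ae mu, forall t, t != c}.
Proof.
exists [set c]; split => //; first exact: lebesgue_measure_set1.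
by move=> t /= /negP; rewrite negbK => /eqP.
Qed.

Lemma horizontal1_concat a b c g1 h1 g2 h2 : a <= b -> b <= c ->
  horizontal1 a b g1 h1 -> horizontal1 b c g2 h2 -> g1 b = g2 b ->
  horizontal1 a c (fun t => if t <= b then g1 t else g2 t)
    (fun i t => if t <= b then h1 i t else h2 i t).
Proof.
move=> ab bc [[K1 HK1] m1 d1 n1] [[K2 HK2] m2 d2 n2] gb.
set g := fun t => _; set h := fun i t => _.
have gl t : t <= b -> g t = g1 t by rewrite /g => ->.
have gr t : b <= t -> g t = g2 t.
  rewrite /g; case: ifP => // tb bt; have -> : t = b by apply/eqP; rewrite eq_le tb bt.
  by [].
pose K := `|K1| + `|K2|.
have Kl s t : a <= s <= b -> a <= t <= b -> `|log (g1 s) - log (g1 t)| <= K * `|s - t|.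
  move=> sab tab; apply: (le_trans (HK1 _ _ sab tab)); rewrite ler_wpM2r //.
  by rewrite /K; have := ler_norm K1; have := normr_ge0 K2; lra.
have Kr s t : b <= s <= c -> b <= t <= c -> `|log (g2 s) - log (g2 t)| <= K * `|s - t|.
  move=> sab tab; apply: (le_trans (HK2 _ _ sab tab)); rewrite ler_wpM2r //.
  by rewrite /K; have := ler_norm K2; have := normr_ge0 K1; lra.
have Klr s t : a <= s <= b -> b <= t <= c -> `|log (g s) - log (g t)| <= K * `|s - t|.
  move=> /andP[as_ sb] /andP[bt tc]; rewrite gl // gr //.
  rewrite -[log (g1 s) - log (g2 t)](subrKA (log (g1 b))).
  apply: (le_trans (ler_normD _ _)).
  have e1 : `|log (g1 s) - log (g1 b)| <= K * (b - s).
    have -> : b - s = `|s - b| by rewrite distrC ger0_norm // subr_ge0.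
    by apply: Kl; apply/andP; split.
  have e2 : `|log (g1 b) - log (g2 t)| <= K * (t - b).
    have -> : t - b = `|b - t| by rewrite distrC ger0_norm // subr_ge0.
    by rewrite gb; apply: Kr; apply/andP; split.
  have -> : `|s - t| = (t - b) + (b - s) by rewrite distrC ger0_norm; lra.
  by rewrite mulrDr addrC lerD.
split.
- exists K => s t /andP[as_ sc] /andP[at_ tc].
  have [sb|bs] := leP s b; have [tb|bt] := leP t b.
  + by rewrite !gl //; apply: Kl; apply/andP; split.
  + by apply: Klr; apply/andP; split => //; exact: ltW.
  + rewrite distrC [`|s - t|]distrC; apply: Klr; apply/andP; split => //; exact: ltW.
  + by rewrite !gr ?(ltW bs) ?(ltW bt) //; apply: Kr; apply/andP; split => //; exact: ltW.
- move=> i.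
  have -> : `[a, c]%classic = `[a, b]%classic `|` `]b, c]%classic.
    by rewrite -itv_bndbnd_setU ?bnd_simp.
  apply/measurable_funU => //; split.
    apply: eq_measurable_fun (m1 i) => t; rewrite inE /= in_itv /= => /andP[_ tb].
    by rewrite /h tb.
  apply: (@eq_measurable_fun _ _ _ _ _ (h2 i)).
    by move=> t; rewrite inE /= in_itv /= => /andP[bt _]; rewrite /h leNgt bt.
  apply: measurable_funS (m2 i) => //.
  by move=> t /=; rewrite !in_itv /= => /andP[bt ->]; rewrite ltW.
- apply: ae_imp (ae_and (ae_and d1 d2) (ae_neq b)) => t [[H1 H2] tb].
  rewrite in_itv /= => /andP[at_ tc].
  have [ltb|gtb|eqb] := ltgtP t b; last by rewrite eqb eqxx in tb.
  + have E : cvec h t = cvec h1 t by apply/rowP => i; rewrite !mxE /h (ltW ltb).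
    rewrite gl ?(ltW ltb) // E; apply: (@near_eq_is_derive _ _ _ (fun t => log (g1 t))); last first.
      by apply: H1; rewrite in_itv /= at_ ltW.
    near=> u; rewrite gl //.
    by near: u; exact: lt_le_nbhsl.
  + have E : cvec h t = cvec h2 t by apply/rowP => i; rewrite !mxE /h leNgt gtb.
    rewrite gr ?(ltW gtb) // E; apply: (@near_eq_is_derive _ _ _ (fun t => log (g2 t))); last first.
      by apply: H2; rewrite in_itv /= tc ltW.
    near=> u; rewrite gr //.
    by near: u; exact: lt_le_nbhsr.
- apply: ae_imp (ae_and n1 n2) => t [H1 H2]; rewrite in_itv /= => /andP[at_ tc].
  have [tb|bt] := leP t b.
    have -> : cvec h t = cvec h1 t by apply/rowP => i; rewrite !mxE /h tb.
    by apply: H1; rewrite in_itv /= at_ tb.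
  have -> : cvec h t = cvec h2 t by apply/rowP => i; rewrite !mxE /h leNgt bt.
  by apply: H2; rewrite in_itv /= tc ltW.
Unshelve. all: by end_near. Qed.

(** * Reachable points *)

Definition reach (x : G) (l : R) : Prop :=
  0 < l /\ exists g h, [/\ horizontal1 0 l g h, g 0 = 1%g & g l = x].

Lemma reach_mul x y l m : reach x l -> reach y m -> reach (x * y)%g (l + m).
Proof.
move=> [l0 [g [h [H g0 gl]]]] [m0 [g' [h' [H' g'0 g'm]]]].
split; first exact: addr_gt0.
have H2 := horizontal1_move l x (ltW m0) H'; rewrite add0r addrC in H2.
have e : g l = (x * g' (l - l))%g by rewrite subrr g'0 mulg1.
have lm : l <= l + m by rewrite lerDl ltW.
have H3 := horizontal1_concat (ltW l0) lm H H2 e.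
eexists; eexists; split; first exact: H3.
  by rewrite /= (ltW l0) g0.
by rewrite /= leNgt ltrDl m0 /= (_ : l + m - l = m) ?g'm //; ring.
Qed.

Lemma reach_arc T g h a b : horizontal1 0 T g h -> 0 <= a -> a < b -> b <= T ->
  reach ((g a)^-1 * g b)%g (b - a).
Proof.
move=> H a0 ab bT; split; first by rewrite subr_gt0.
have H1 := horizontal1_sub a0 bT H.
have := horizontal1_move (- a) ((g a)^-1)%g (ltW ab) H1; rewrite subrr => H2.
eexists; eexists; split; first exact: H2.
  by rewrite opprK add0r mulVg.
by rewrite opprK subrK.
Qed.

Lemma reach_embed (a : 'rV[R]_r) l : 0 < l -> norm2 a <= l -> reach (exp (embed a)) l.
Proof.
move=> l0 al; split => //.
pose v := l^-1 *: a.
exists (fun t => exp (t *: embed v)), (fun i _ => v 0 i).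
have E t : cvec (fun i _ => v 0 i) t = v by apply/rowP => i; rewrite mxE.
have dl (t : R) : is_derive t 1 (fun t : R => log (exp (t *: embed v))) (embed v).
  by under [Y in is_derive _ _ Y _]eq_fun do rewrite lgexpK; exact: is_derive_scale_line.
split.
- split.
  + by exists `|embed v| => s t _ _; rewrite !lgexpK -scalerBl normrZ mulrC.
  + by move=> i; exact: measurable_cst.
  + by apply: aeW => t _; rewrite E lgexpK left_field_line.
  + apply: aeW => t _; rewrite E /v norm2Z normfV gtr0_norm //.
    by rewrite ler_pdivrMl // mulr1.
- by rewrite scale0r lgexp0.
- by rewrite -linearZ /= /v scalerA mulfV ?scale1r // gt_eqF.
Qed.

Lemma embed_bounded : exists2 K, 0 < K & forall a, `|embed a| <= K * norm2 a.
Proof.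
have [K K0 HK] := linear_bounded embed.
exists K => // a; apply: (le_trans (HK a)); rewrite ler_wpM2l ?(ltW K0) //.
by apply: norm_le_coord; [exact: norm2_ge0 | move=> i; exact: coord_le_norm2].
Qed.

(** One half of the ball-box estimate: the velocity of a horizontal curve has
    degree 1, so [curve_bnd] applies at the scale of the length of the curve. *)
Lemma reach_bnd : exists2 K, 1 <= K & forall x l, reach x l -> bnd K l (log x).
Proof.
have [K K1 HK] := curve_bnd G; have [Ke Ke0 HKe] := embed_bounded.
pose C := 1 + Ke.
have C1 : 1 <= C by rewrite /C; lra.
exists (K * C ^+ step G).
  have : 1 <= C ^+ step G by rewrite exprn_ege1.
  by move=> h; rewrite (le_trans K1) // ler_peMr //; lra.
move=> x l [l0 [g [h [[[Kz HKz] m d n] g0 gl]]]].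
apply: bnd_scale_out => //; [lra|exact: ltW|].
have Cl : 0 <= C * l by rewrite mulr_ge0 //; lra.
have := HK (C * l) l 1 Kz (fun t => log (g t)) (fun t => left_field G (log (g t)) (embed (cvec h t))) Cl l0 _ HKz.
rewrite g0 lglog1 ler01 lexx => /(_ isT) H.
have := H _ _ l; rewrite (ltW l0) lexx gl subr0 mulr1; apply => //.
  apply: ae_imp (ae_and d n) => t [H1 H2] tl; split; first exact: H1.
  rewrite dexp_left_field => j.
  have lay : l *: embed (cvec h t) \in Lay G 1 by rewrite Lay1 memvZ // embed_layer.
  rewrite (proj_layer_Lay _ lay) mul1r; case: eqP => [->|_]; last by rewrite normr0 exprn_ge0.
  rewrite expr1 normrZ gtr0_norm // mulrC ler_wpM2r ?(ltW l0) //.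
  apply: (le_trans (HKe _)); apply: (@le_trans _ _ (Ke * 1)).
    by rewrite ler_wpM2l ?(ltW Ke0) // H2.
  by rewrite mulr1 /C; lra.
by move=> j; rewrite linear0 normr0 mul1r exprn_ge0.
Qed.

Lemma measurable_control_norm (a b : R) (h : 'I_r -> R -> R) :
  (forall i, measurable_fun `[a, b] (h i)) -> measurable_fun `[a, b] (control_norm h).
Proof.
move=> m; rewrite /control_norm.
apply: (@measurableT_comp _ _ _ _ _ _ (@Num.sqrt R)).
  by apply: continuous_measurable_fun; exact: sqrt_continuous.
apply: measurable_sum => i; exact: measurable_funX.
Qed.

Lemma hlength_le (a b : R) g h : a <= b -> horizontal1 a b g h -> (hlength a b h <= (b - a)%:E)%E.
Proof.
move=> ab [_ m _ n].
have -> : (b - a)%:E = (\int[mu]_(t in `[a, b]) (cst 1%:E t))%E.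
  rewrite integral_cst //= mul1e lebesgue_measure_itv /= lte_fin.
  by case: ifPn => //; rewrite -leNgt => ba; have -> : b = a; [apply/eqP; rewrite eq_le ba ab | rewrite subrr].
apply: ae_ge0_le_integral => //.
- by move=> t _; rewrite lee_fin sqrtr_ge0.
- by apply/measurable_EFinP; exact: measurable_control_norm.
- by apply: ae_imp n => t H tab; rewrite lee_fin control_normE; exact: H.
Qed.

Lemma hlength_arclength (a b : R) (h : 'I_r -> R -> R) : a <= b -> (forall i, measurable_fun `[a, b] (h i)) ->
  arclength_parametrized a b h -> hlength a b h = (b - a)%:E.
Proof.
move=> ab m n.
have -> : (b - a)%:E = (\int[mu]_(t in `[a, b]) (cst 1%:E t))%E.
  rewrite integral_cst //= mul1e lebesgue_measure_itv /= lte_fin.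
  by case: ifPn => //; rewrite -leNgt => ba; have -> : b = a; [apply/eqP; rewrite eq_le ba ab | rewrite subrr].
apply: ae_eq_integral => //.
- by apply/measurable_EFinP; exact: measurable_control_norm.
- by apply: ae_imp n => t H tab; rewrite H.
Qed.

Lemma cc_dist_reach (x y : G) l : reach ((x^-1) * y)%g l -> (cc_dist x y <= l%:E)%E.
Proof.
move=> [l0 [g [h [H g0 gl]]]].
have H2 := horizontal1_move 0 x (ltW l0) H; rewrite !addr0 in H2.
apply: (@le_trans _ _ (hlength 0 l (fun i t => h i (t - 0)))).
  apply: ereal_inf_lbound; exists 0, l, (fun t => x * g (t - 0))%g, (fun i t => h i (t - 0)).
  split => //; first exact: horizontal1_horizontal.
    by rewrite subr0 g0 mulg1.
  by rewrite subr0 gl mulVKg.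
by apply: le_trans (hlength_le (ltW l0) H2) _; rewrite subr0.
Qed.

End FirstLayer.

(** * Leading parts and the ball-box estimate *)
Section Reach.
Context {R : realType} (G : carnotGroup R).
Local Notation V := 'rV[R]_(topdim G).
Local Notation exp := (lgexp G).
Local Notation log := (@lglog R _ G).
Local Notation F := (chart_mul G).
Local Notation P := (proj_layer G).
Local Notation ad := (ad G).
Local Notation s := (step G).
Local Notation r := (rank G).
Local Notation X i := (tnth (frame G) i).

(** The group element [c] is congruent to the exponential of [Z] modulo elements
    of degree greater than [j]. *)
Definition lead (j : nat) (c : G) (Z : V) : Prop := fil j (log c) /\ P j (log c) = Z.

Lemma lead1 j : lead j 1%g 0.
Proof. by rewrite /lead lglog1 linear0; split => //; exact: fil_0. Qed.

Lemma leadM j c c' Z Z' : lead j c Z -> lead j c' Z' -> lead j (c * c')%g (Z + Z').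
Proof.
move=> [f1 <-] [f2 <-]; rewrite /lead lglogM; split; first exact: chart_mul_fil_closed.
exact: proj_chart_mul.
Qed.

Lemma leadV j c Z : lead j c Z -> lead j (c^-1)%g (- Z).
Proof. by move=> [f1 <-]; rewrite /lead lglogV linearN; split => //; exact: filN. Qed.

Lemma lead_fil j c : fil j (log c) -> lead j c (P j (log c)). Proof. by []. Qed.

Lemma lead0_fil j c : lead j c 0 -> fil j.+1 (log c).
Proof.
move=> [f1 f2] i; rewrite ltnS leq_eqVlt => /orP[/eqP ->|] //; exact: f1.
Qed.

Lemma proj_ad_lead j u w : fil j w -> P j.+1 (ad u w) = ad (P 1%N u) (P j w).
Proof.
move=> fw; have E : P j.+1 (ad u (w - P j w)) = 0.
  have fw' : fil j.+1 (w - P j w).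
    move=> i; rewrite ltnS leq_eqVlt linearB /= => /orP[/eqP ->|ij].
      by rewrite proj_layer_proj eqxx subrr.
    by rewrite (fw _ ij) (proj_layer_proj i j w) (ltn_eqF ij) subrr.
  by apply: (fil_ad (fil1 u) fw'); rewrite add1n.
have E2 : P j.+1 (ad (u - P 1%N u) (P j w)) = 0.
  have fu : fil 2 (u - P 1%N u).
    move=> [|[|i]] // _; rewrite linearB /= proj_layer_proj.
      by rewrite proj_layer0 subr0.
    by rewrite eqxx subrr.
  by apply: (fil_ad fu (fil_Lay (proj_layer_mem j w))); rewrite add2n.
move: E E2; rewrite linearB linearB /= => /eqP; rewrite subr_eq0 => /eqP ->.
rewrite adD adN linearB /= => /eqP; rewrite subr_eq0 => /eqP ->.
have := ad_Lay (proj_layer_mem 1 u) (proj_layer_mem j w); rewrite add1n => /proj_layer_Lay ->.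
by rewrite eqxx.
Qed.

Lemma lead_conj j x c Z : lead j c Z -> lead j (x * c * x^-1)%g Z.
Proof.
move=> [f1 <-]; rewrite /lead.
have -> : log (x * c * x^-1)%g = Ad x (log c) by rewrite /Ad lglogK.
have h := Ad_fil (log x) f1; rewrite lglogK in h.
have h1 := fil_ad (fil1 (log x)) f1.
have h2 : fil j.+1 (Ad x (log c) - log c).
  rewrite -[_ - _](subrK (ad (log x) (log c))); apply: filD => //.
  exact: filS (leqnSn _) h.
split.
  rewrite -[Ad _ _](subrK (log c)); apply: filD => //; exact: filS (leqnSn _) h2.
by have := h2 j (ltnSn j); rewrite linearB => /eqP; rewrite subr_eq0 => /eqP.
Qed.

(** [Ad x] differs from the identity by [ad (log x)] up to terms of degree two
    higher. *)
Lemma lead_commutator j x c Z : lead j c Z ->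
  lead j.+1 (c^-1 * (x * c * x^-1))%g (ad (P 1%N (log x)) Z).
Proof.
move=> [f1 <-].
have E : log (x * c * x^-1)%g = Ad x (log c) by rewrite /Ad lglogK.
have h := Ad_fil (log x) f1; rewrite lglogK in h.
have h1 := fil_ad (fil1 (log x)) f1; rewrite add1n in h1.
set w := log c in f1 h h1 *; set a := Ad x w in h E.
have h2 : fil j.+1 (a - w).
  rewrite -[_ - _](subrK (ad (log x) w)); apply: filD => //.
  exact: filS (leqnSn _) h.
have fq := coset_fil h2; set q := F (- w, a) in fq.
have -> : lead j.+1 (c^-1 * (x * c * x^-1))%g = lead j.+1 (exp q).
  by congr lead; rewrite -[LHS]lglogK lglogM lglogV E.
split; rewrite lgexpK //.
have Fq : F (w, q) = a by rewrite /q -{1}(opprK w) chart_mulKl.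
have h3 := chart_mul_fil w fq; rewrite Fq in h3.
have aux (a' w' b' q' : V) : (a' - w' - b') - (a' - w' - q') = q' - b'.
  by apply/rowP => i; rewrite !mxE; ring.
have h4 := filB h h3; rewrite aux in h4; have := h4 j.+1 (ltnSn _).
rewrite linearB /= => /eqP; rewrite subr_eq0 => /eqP ->.
exact: proj_ad_lead.
Qed.

(** Reachability is not symmetric by definition; commutators need both an element
    and its inverse. *)
Definition sreach (c : G) (l : R) : Prop := reach c l /\ reach (c^-1)%g l.

Lemma reach1 l : 0 < l -> reach (1%g : G) l.
Proof.
move=> l0; have := @reach_embed R G 0 l l0; rewrite linear0 lgexp0; apply.
by rewrite /norm2 dot0l sqrtr0 ltW.
Qed.

Lemma reach_le (x : G) l m : reach x l -> l <= m -> reach x m.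
Proof.
move=> xl; rewrite le_eqVlt => /orP[/eqP <- //|lm].
have := reach_mul xl (reach1 (l := m - l) _); rewrite subr_gt0 mulg1 addrC subrK.
by apply.
Qed.

Lemma sreach_mul c c' l l' : sreach c l -> sreach c' l' -> sreach (c * c')%g (l + l').
Proof.
move=> [h1 h2] [h3 h4]; split; first exact: reach_mul.
by rewrite invgM addrC; exact: reach_mul.
Qed.

Lemma sreach_inv c l : sreach c l -> sreach (c^-1)%g l.
Proof. by move=> [h1 h2]; split => //; rewrite invgK. Qed.

Lemma sreach_embed a l : 0 < l -> norm2 a <= l -> sreach (exp (embed a) : G) l.
Proof.
move=> l0 al; split; first exact: reach_embed.
rewrite -lgexpN -linearN; apply: reach_embed => //.
by rewrite -scaleN1r norm2Z normrN1 mul1r.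
Qed.

Lemma lead_prod j n (Z : 'I_n -> V) (l : R) : 0 < l ->
  (forall k, exists c, lead j c (Z k) /\ sreach c l) ->
  exists c, lead j c (\sum_k Z k) /\ sreach c (l + l *+ n).
Proof.
move=> l0; elim: n Z => [|n IH] Z H.
  exists 1%g; rewrite big_ord0 mulr0n addr0; split; first exact: lead1.
  by split; rewrite ?invg1; exact: reach1.
have [c [h1 h2]] := IH (fun k => Z (widen_ord (leqnSn n) k)) (fun k => H _).
have [c' [h3 h4]] := H ord_max.
exists (c * c')%g; rewrite big_ord_recr; split; first exact: leadM.
by rewrite mulrSr addrA; exact: sreach_mul.
Qed.

Lemma norm2_le_norm (a : 'rV[R]_r) : norm2 a <= r.+1%:R * `|a|.
Proof.
rewrite -(ger0_norm (mulr_ge0 (ler0n R r.+1) (normr_ge0 a))) -sqrtr_sqr ler_sqrt ?sqr_ge0 //.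
apply: (@le_trans _ _ (\sum_(i < r) `|a| ^+ 2)).
  apply: ler_sum => i _; rewrite -expr2 -real_normK ?num_real //.
  by rewrite ler_sqr ?nnegrE // coord_norm_le.
rewrite sumr_const card_ord exprMn -[Y in Y <= _]mulr_natl ler_wpM2r ?sqr_ge0 //.
by rewrite -natrX ler_nat expnS mulnC; nia.
Qed.

Lemma coord1_bounded : exists2 K, 0 < K & forall z : V, norm2 (coord1 z) <= K * `|P 1%N z|.
Proof.
have [K K0 HK] := linear_bounded (@coord1 R G).
exists (r.+1%:R * K); first by rewrite mulr_gt0.
move=> z; have -> : coord1 z = coord1 (P 1%N z).
  by apply/rowP => i; rewrite !mxE proj_layer_proj eqxx.
by apply: (le_trans (norm2_le_norm _)); rewrite -mulrA ler_wpM2l // HK.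
Qed.

(** The images of the layer of degree [j] under the brackets with the frame span
    the next layer; decomposing a basis of the latter once and for all gives
    coefficients that depend linearly on [Z]. *)
Lemma bracket_decomposition j : (1 <= j < s)%N -> exists2 C, 0 <= C &
  forall Z, Z \in Lay G j.+1 -> exists W : 'I_r -> V,
    [/\ forall k, W k \in Lay G j, Z = \sum_k ad (X k) (W k) & forall k, `|W k| <= C * `|Z|].
Proof.
move=> /andP[j1 js].
have LE : Lay G j = layer G j by rewrite /Lay j1 ltnW.
have LE1 : Lay G j.+1 = layer G j.+1 by rewrite /Lay js.
rewrite LE LE1.
have sub : (layer G j.+1 <= \sum_(k < r) (linfun (ad (X k)) @: layer G j))%VS.
  have [|_] := @layer_gen _ G j.+1; first by rewrite ltnS j1.
  apply => u v /layer1_embed[a ->] vj; rewrite ad_lie_bracket /embed ad_sum.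
  apply: memv_suml => k _; rewrite adZ; apply: memvZ.
  apply: (subvP (sumv_sup k _ (subvv _))) => //.
  have -> : ad (X k) v = linfun (ad (X k)) v by rewrite lfunE.
  exact: memv_img.
pose b := vbasis (layer G j.+1).
have ex (Z : V) : Z \in layer G j.+1 -> exists W : 'I_r -> V,
    (forall k, W k \in layer G j) /\ Z = \sum_k ad (X k) (W k).
  move=> /(subvP sub) /memv_sumP[vs Hvs ->].
  have /choice[W HW] : forall k, exists w, w \in layer G j /\ vs k = ad (X k) w.
    by move=> k; have /memv_imgP[w wj ->] := Hvs k isT; exists w; rewrite lfunE.
  exists W; split; first by move=> k; case: (HW k).
  by apply: eq_bigr => k _; case: (HW k).
have /choice[W HW] : forall l : 'I_(\dim (layer G j.+1)), exists W : 'I_r -> V,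
    (forall k, W k \in layer G j) /\ tnth b l = \sum_k ad (X k) (W k).
  by move=> l; apply: ex; apply: vbasis_mem; exact: mem_tnth.
have /choice[K HK] : forall l : 'I_(\dim (layer G j.+1)), exists K, 0 <= K /\ forall Z, `|coord b l Z| <= K * `|Z|.
  by move=> l; have [K K0 H] := linear_bounded (coord b l); exists K; split => //; exact: ltW.
exists (\sum_l \sum_k K l * `|W l k|).
  by apply: sumr_ge0 => l _; apply: sumr_ge0 => k _; rewrite mulr_ge0 //; case: (HK l).
move=> Z Zj; exists (fun k => \sum_l coord b l Z *: W l k); split.
- by move=> k; apply: memv_suml => l _; apply: memvZ; case: (HW l).
- under eq_bigr do rewrite linear_sum.
  rewrite exchange_big /= {1}(coord_vbasis Zj); apply: eq_bigr => l _.
  have [_] := HW l; rewrite (tnth_nth 0) => ->; rewrite scaler_sumr.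
  by apply: eq_bigr => k _; rewrite linearZ.
- move=> k; apply: (le_trans (ler_norm_sum _ _ _)); rewrite mulr_suml; apply: ler_sum => l _.
  rewrite normrZ; have [K0 H] := HK l.
  apply: (@le_trans _ _ (K l * `|W l k| * `|Z|)).
    by rewrite mulrAC ler_wpM2r.
  rewrite ler_wpM2r // (bigD1 k) //= lerDl; apply: sumr_ge0 => i _; by rewrite mulr_ge0.
Qed.

Lemma embed_delta (k : 'I_r) : embed (delta_mx 0 k) = X k.
Proof.
rewrite /embed (bigD1 k) //= big1 => [|i ik]; rewrite !mxE ?eqxx /=.
  by rewrite scale1r addr0.
by rewrite (negbTE ik) scale0r.
Qed.

(** Induction on the degree: a vector of degree [j.+1] is a sum of brackets of
    frame vectors with vectors of degree [j], realized by commutators of a segment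
    of length [rho] with elements reachable in time O(rho). *)
Lemma reach_layer j : (1 <= j <= s)%N -> exists2 C, 0 < C &
  forall rho Z, 0 < rho -> Z \in Lay G j -> `|Z| <= rho ^+ j ->
  exists c, lead j c Z /\ sreach c (C * rho).
Proof.
case: j => // j; elim: j => [_|j IH /andP[_ js]].
  have [K K0 HK] := coord1_bounded.
  exists K => // rho Z rho0 Z1; rewrite expr1 => Zr.
  have PZ : P 1%N Z = Z by rewrite (proj_layer_Lay _ Z1).
  have ZE : Z = embed (coord1 Z) by rewrite embed_coord1.
  exists (exp Z); split; first by rewrite /lead lgexpK; split => //; exact: fil1.
  rewrite ZE; apply: sreach_embed; first by rewrite mulr_gt0.
  by apply: (le_trans (HK _)); rewrite PZ ler_wpM2l // ltW.
have [|C C0 HC] := IH; first by apply/andP; split => //; exact: ltnW.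
have [|D D0 HD] := @bracket_decomposition j.+1; first by rewrite js.
pose D' := 1 + D; have D'1 : 1 <= D' by rewrite /D' lerDl.
pose E := (C * D' + 1) + (C * D' + 1).
have CD : 0 < C * D' by rewrite mulr_gt0 //; lra.
have E0 : 0 < E by rewrite /E; lra.
exists (E + E *+ r); first by rewrite ltr_pwDl // mulrn_wge0 // ltW.
move=> rho Z rho0 ZL Zr.
have [W [WL ZE WC]] := HD Z ZL.
rewrite ZE mulrDl mulrnAl; apply: lead_prod; first by rewrite mulr_gt0.
move=> k.
have [|||c [lc sc]] := HC (D' * rho) (rho^-1 *: W k).
- by rewrite mulr_gt0 //; lra.
- exact: memvZ.
- rewrite normrZ normfV gtr0_norm // ler_pdivrMl // (le_trans (WC k)) //.
  apply: (@le_trans _ _ (D' * rho ^+ j.+2)).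
    by apply: ler_pM => //; rewrite /D'; lra.
  have -> : rho * (D' * rho) ^+ j.+1 = D' ^+ j.+1 * rho ^+ j.+2 by rewrite exprMn [rho ^+ j.+2]exprS; ring.
  rewrite ler_wpM2r ?exprn_ge0 ?(ltW rho0) //.
  by rewrite ler_eXnr.
pose x : G := exp (rho *: X k).
have xE : x = exp (embed (rho *: delta_mx 0 k)).
  by rewrite /x linearZ /= embed_delta.
have sx : sreach x rho.
  rewrite xE; apply: sreach_embed => //.
  rewrite norm2Z gtr0_norm // -[leRHS]mulr1 ler_wpM2l ?(ltW rho0) //.
  rewrite /norm2 /dot (bigD1 k) //= big1 => [|i ik]; rewrite !mxE ?eqxx /=.
    by rewrite mulr1 addr0 sqrtr1.
  by rewrite (negbTE ik) mulr0.
exists (c^-1 * (x * c * x^-1))%g; split.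
  have PX : P 1%N (X k) = X k.
    rewrite (proj_layer_Lay _ (j := 1)) // Lay1; apply: (basis_mem (frame_basis G)).
    exact: mem_tnth.
  have := lead_commutator x lc; rewrite /x lgexpK.
  have -> : P 1%N (rho *: X k) = rho *: X k by rewrite linearZ /= PX.
  by rewrite adZ linearZ /= scalerA mulfV ?scale1r // gt_eqF.
have -> : E * rho = C * (D' * rho) + (rho + C * (D' * rho) + rho) by rewrite /E; ring.
apply: sreach_mul; first exact: sreach_inv.
apply: sreach_mul; last exact: sreach_inv.
exact: sreach_mul.
Qed.

Lemma bndC_inv C rho (x : G) : bnd C rho (log x) -> bnd C rho (log (x^-1)%g).
Proof. by rewrite lglogV; exact: bndN. Qed.

(** Induction on the number of remaining degrees: the component of lowest degree
    of [x] is realized by [reach_layer], and what is left has higher degree. *)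
Lemma ball_box_fil d j K : (1 <= j)%N -> (j + d = s.+1)%N -> 0 <= K ->
  exists2 C, 0 < C & forall rho (x : G), 0 < rho -> fil j (log x) -> bnd K rho (log x) ->
  reach x (C * rho).
Proof.
elim: d j K => [|d IH] j K j1 jd K0.
  exists 1 => // rho x rho0 fx _; rewrite mul1r.
  have -> : x = 1%g by rewrite -[x]lglogK (fil_eq0 (x := log x)) ?lgexp0 // -jd addn0.
  exact: reach1.
have [|C C0 HC] := @reach_layer j; first by lia.
have [Kb Kb1 HKb] := reach_bnd G.
pose K' := 1 + K; have K'1 : 1 <= K' by rewrite /K' lerDl.
pose C' := 1 + C * K'; have C'1 : 1 <= C' by rewrite /C' lerDl mulr_ge0 ?(ltW C0) //; lra.
pose K2 := Kb * C' ^+ s + K.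
have [K3 K30 HK3] := chart_mul_bndC G K2.
have [|||C2 C20 HC2] := IH j.+1 K3 => //; first by lia.
exists (C * K' + C2); first by rewrite addr_gt0 // mulr_gt0 //; lra.
move=> rho x rho0 fx bx.
have Kp : 0 <= Kb * C' ^+ s by rewrite mulr_ge0 ?exprn_ge0 //; lra.
have [|||c [lc [sc sc']]] := HC (K' * rho) (P j (log x)).
- by rewrite mulr_gt0 //; lra.
- exact: proj_layer_mem.
- apply: (le_trans (bx j)); rewrite exprMn ler_wpM2r ?exprn_ge0 ?(ltW rho0) //.
  apply: (@le_trans _ _ K'); first by rewrite /K'; lra.
  by rewrite ler_eXnr.
have bc : bnd K2 rho (log (c^-1)%g).
  apply: bndC_inv; apply: (@bnd_le _ _ (Kb * C' ^+ s)); [exact: ltW | by rewrite /K2 lerDl |].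
  apply: bnd_scale_out; [by [] | by lra | exact: ltW |].
  apply: HKb; apply: reach_le sc _.
  by rewrite mulrA ler_wpM2r ?(ltW rho0) // /C'; lra.
have lx : lead j (c^-1 * x)%g 0.
  by have := leadM (leadV lc) (lead_fil fx); rewrite addNr.
have := HC2 rho (c^-1 * x)%g rho0 (lead0_fil lx).
rewrite lglogM => /(_ _) H.
have {}H : reach (c^-1 * x)%g (C2 * rho).
  apply: H; apply: HK3 => //; first exact: ltW.
  by apply: bnd_le bx; [exact: ltW | rewrite /K2 lerDr].
by have := reach_mul sc H; rewrite mulVKg mulrA -mulrDl.
Qed.

Lemma ball_box : exists2 C, 0 < C & forall rho (x : G), 0 < rho -> bnd 1 rho (log x) ->
  reach x (C * rho).
Proof.
have [|||C C0 HC] := @ball_box_fil s 1 1 => //.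
by exists C => // rho x rho0 bx; apply: HC => //; exact: fil1.
Qed.

End Reach.

(** * Primitives of bounded functions *)
Section RealIntegrals.
Context {R : realType}.
Local Notation mu := (@lebesgue_measure R).

(** The one-sided bound becomes a two-sided one after subtraction of the linear
    function whose slope is the midpoint [- m] of the range of the derivative. *)
Lemma ae_mean_value_upper (f : R -> R) (a b K B c : R) : a <= b -> - B <= c ->
  (forall s t, a <= s <= b -> a <= t <= b -> `|f s - f t| <= K * `|s - t|) ->
  {ae mu, forall t, t \in `[a, b] -> exists2 f', is_derive t 1 f f' & - B <= f' <= c} ->
  f b - f a <= c * (b - a).
Proof.
move=> ab Bc fK fd.
pose m := (B - c) / 2; pose M := (B + c) / 2.
have M0 : 0 <= M by rewrite /M; lra.
have := @ae_mean_value_le R R (fun t => f t + t * m) a b M (K + `|m|) ab M0.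
move=> /(_ _ _) H.
have {}H : `|f b + b * m - (f a + a * m)| <= M * (b - a).
  apply: H.
    move=> s t sab tab.
    have -> : f s + s * m - (f t + t * m) = (f s - f t) + m * (s - t) by ring.
    apply: (le_trans (ler_normD _ _)); rewrite mulrDl normrM lerD2r; exact: fK.
  apply: ae_imp fd => t H tab; have [f' df /andP[f1 f2]] := H tab.
  exists (f' + m); last by rewrite /M /m ler_norml; apply/andP; split; lra.
  by apply: is_deriveD; exact: (is_derive_scale_line (m : R) t).
have := le_trans (ler_norm _) H.
have -> : c * (b - a) = M * (b - a) - m * (b - a) by rewrite /M /m; field.
rewrite mulrBr !(mulrC m); lra.
Qed.

(** The integral of [f1] is the supremum of the integrals of the simple functions
    below [f1], and each of these functions is below [f2] almost everywhere. *)
Lemma le_lower_integral (D : set R) (f1 f2 : R -> \bar R) : measurable D ->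
  (forall x, D x -> 0 <= f1 x)%E -> (forall x, D x -> 0 <= f2 x)%E -> measurable_fun D f2 ->
  {ae mu, forall x, D x -> (f1 x <= f2 x)%E} ->
  (\int[mu]_(x in D) f1 x <= \int[mu]_(x in D) f2 x)%E.
Proof.
move=> mD f10 f20 mf2 f12; rewrite ge0_integralE //.
apply: ge_ereal_sup => /= _ [g /= gf] <-.
rewrite -integralT_nnsfun [leRHS]integral_mkcond.
apply: ae_ge0_le_integral => //.
- by move=> x _; rewrite lee_fin.
- exact/measurable_EFinP.
- by move=> x _; apply: erestrict_ge0.
- by apply/(measurable_restrictT _ mD).
- apply: ae_imp f12 => x H _; apply: (le_trans (gf x)).
  by rewrite !patchE; case: ifPn => // xD; apply: H; exact: set_mem.
Qed.

Variable f : R -> R.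
Hypothesis mf : measurable_fun setT f.
Hypothesis f01 : forall x, 0 <= f x <= 1.
Let I (t : R) : R := \int[mu]_(x in `[0, t]) f x.

Let f_integrable (D : set R) : measurable D -> (mu D < +oo)%E -> mu.-integrable D (EFin \o f).
Proof.
move=> mD Dfin; apply: measurable_bounded_integrable => //.
  exact: measurable_funS mf.
exists 1; split; first exact: num_real.
move=> M M1 x _ /=; have /andP[f0 f1] := f01 x.
by rewrite ger0_norm // (le_trans f1) // ltW.
Qed.

Let itv_fin (a b : itv_bound R) : (exists x y, [set` Interval a b] `<=` `[x, y]%classic) -> (mu [set` Interval a b] < +oo)%E.
Proof.
move=> [x [y sub]]; apply: (@le_lt_trans _ _ (mu `[x, y]%classic)).
  by apply: le_measure; rewrite ?inE.
by rewrite lebesgue_measure_itv /=; case: ifP => _; rewrite -?EFinB ltry.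
Qed.

Lemma primitive_increment s t : 0 <= s -> s <= t -> 0 <= I t - I s <= t - s.
Proof.
move=> s0 st.
have i1 : mu.-integrable `[0, t] (EFin \o f).
  by apply: f_integrable => //; apply: itv_fin; exists 0, t.
have i2 : mu.-integrable `]s, t] (EFin \o f).
  apply: f_integrable => //; apply: itv_fin; exists s, t => x /=.
  by rewrite !in_itv /= => /andP[/ltW -> ->].
have -> : I t - I s = \int[mu]_(x in `]s, t]) f x.
  by rewrite /I -(@Rintegral_itvB _ f (BLeft 0) (BRight t) s) //= bnd_simp.
apply/andP; split; first by apply: Rintegral_ge0 => x _; case/andP: (f01 x).
have -> : t - s = \int[mu]_(x in `]s, t]) (cst 1 x).
  rewrite Rintegral_cst // mul1r /= lebesgue_measure_itv /= lte_fin.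
  by move: st; rewrite le_eqVlt => /orP[/eqP ->|->]; rewrite ?ltxx ?subrr.
apply: le_Rintegral => //; last by move=> x _; case/andP: (f01 x).
apply: measurable_bounded_integrable => //.
  apply: itv_fin; exists s, t => x /=.
  by rewrite !in_itv /= => /andP[/ltW -> ->].
exists 1; split; first exact: num_real.
by move=> M M1 x _ /=; rewrite normr1 ltW.
Qed.

Lemma ae_is_derive_primitive : {ae mu, forall t : R, 0 < t -> is_derive t 1 I (f t)}.
Proof.
have H1 y : mu.-integrable [set` Interval (BLeft 0) (BRight y)] (EFin \o f).
  by apply: f_integrable => //; apply: itv_fin; exists 0, y.
have H2 : locally_integrable [set: R] f.
  split => //; first exact: openT.
  move=> K _ cK.
  have mK := compact_measurable cK.
  have /integrableP[_] := f_integrable mK (compact_finite_measure cK).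
  by [].
apply: ae_imp (FTC1 H1 H2) => t H t0.
have [|d <-] := H; first by rewrite /= lte_fin.
by rewrite derive1E; exact: derivableP.
Qed.

End RealIntegrals.

(** * The excess as a quadratic form of the velocity *)
Section Excess.
Context {R : realType} (G : carnotGroup R).
Local Notation V := 'rV[R]_(topdim G).
Local Notation exp := (lgexp G).
Local Notation log := (@lglog R _ G).
Local Notation P := (proj_layer G).
Local Notation s := (step G).
Local Notation r := (rank G).
Local Notation mu := (@lebesgue_measure R).

Lemma proj_first_layerE x : proj_first_layer G x = P 1%N x.
Proof.
rewrite /proj_first_layer; set W := (\sum_(1 <= j < s) layer G j.+1)%VS.
have PW x' : x' \in W -> P 1%N x' = 0.
  rewrite /W big_seq; move: x'.
  apply: (big_ind (fun U : {vspace V} => forall x', x' \in U -> P 1%N x' = 0)).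
  - by move=> x'; rewrite memv0 => /eqP ->; rewrite linear0.
  - move=> U U' HU HU' x' /memv_addP[u uU [u' uU' ->]].
    by rewrite linearD /= HU // HU' // addr0.
  - move=> j; rewrite mem_index_iota => /andP[j1 js] x' xj.
    have xL : x' \in Lay G j.+1 by rewrite /Lay /= js.
    by rewrite (proj_layer_Lay 1 xL); case: j j1 js xj xL.
have P1 x' : x' \in layer G 1 -> P 1%N x' = x'.
  by move=> xl; rewrite (proj_layer_Lay _ (j := 1)) // Lay1.
have cap : (layer G 1 :&: W)%VS = 0%VS.
  apply/eqP; rewrite -subv0; apply/subvP => y /memv_capP[y1 yW].
  by rewrite memv0 -(P1 y y1) PW.
have dW y : y \in W -> daddv_pi (layer G 1) W y = 0.
  move=> yW; have yUW : y \in (layer G 1 + W)%VS by exact: subvP (addvSr _ _) _ yW.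
  have := daddv_pi_add cap yUW.
  rewrite (daddv_pi_id (U := W) (V := layer G 1)) //; last by rewrite capvC.
  by move=> /eqP; rewrite addrC -subr_eq0 addrAC subrr add0r => /eqP.
rewrite {1}(sum_proj_layerS x).
have := step_gt0 G; case E : s => [//|s'] _.
rewrite big_ord_recl linearD /= daddv_pi_id //; last by rewrite -Lay1 proj_layer_mem.
rewrite dW ?addr0 //; apply: memv_suml => i _.
have iw : i.+1 \in index_iota 1 s by rewrite mem_index_iota E /= ltnS.
have sub : (layer G i.+2 <= W)%VS.
  by rewrite /W (bigD1_seq i.+1) ?iota_uniq //= addvSl.
apply: (subvP sub); have := proj_layer_mem i.+2 x.
by rewrite /Lay /= E ltnS ltn_ord.
Qed.

Variables (T : R) (gam : R -> G) (h : 'I_r -> R -> R).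
Hypothesis T0 : 0 < T.
Hypothesis H : horizontal1 0 T gam h.

Let z (t : R) : V := log (gam t).

Lemma ae_derive1_hproj : {ae mu, forall t, t \in `[0, T] ->
  derive1 (@hproj R G \o gam) t = embed (cvec h t)}.
Proof.
have [_ _ d _] := H; apply: ae_imp d => t dt /dt {}dt.
have H1 : is_derive t 1 (fun u => P 1%N (z u)) (P 1%N (left_field G (z t) (embed (cvec h t)))).
  exact: is_derive_linear dt.
have -> : @hproj R G \o gam = (fun u => P 1%N (z u)).
  by apply/funext => u; rewrite /= /hproj proj_first_layerE.
rewrite derive1E (@derive_val _ _ _ _ _ _ _ H1).
by rewrite -(proj1_dexp (z t)) dexp_left_field proj1_embed.
Qed.

(** Truncated at 1 and extended by 0, in order to be bounded everywhere: the
    speed is bounded by 1 almost everywhere only. *)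
Definition sqdot (v : 'rV[R]_r) : R -> R :=
  (fun t => Num.min (dot v (cvec h t) ^+ 2) 1) \_ `[0, T].

Lemma measurable_sqdot v : measurable_fun setT (sqdot v).
Proof.
have [_ m _ _] := H.
apply/(measurable_restrictT _ _).1 => //.
apply: measurable_minr => //.
apply: measurable_funX; rewrite /dot.
apply: measurable_sum => i.
have -> : (fun t => v 0 i * cvec h t 0 i) = (fun t => v 0 i * h i t).
  by apply/funext => t; rewrite mxE.
by apply: measurable_funM => //; exact: measurable_cst.
Qed.

Lemma sqdot01 v t : 0 <= sqdot v t <= 1.
Proof.
rewrite /sqdot patchE; case: ifP => _; last by rewrite lexx ler01.
by rewrite le_min sqr_ge0 ler01 ge_min lexx orbT.
Qed.

Lemma sqdotE v t : t \in `[0, T] -> sqdot v t = Num.min (dot v (cvec h t) ^+ 2) 1.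
Proof. by move=> tT; rewrite /sqdot patchE mem_set. Qed.

Definition isqdot (v : 'rV[R]_r) (t : R) : R := \int[mu]_(x in `[0, t]) sqdot v x.

Lemma excess_lower (eta eps : R) (v : 'rV[R]_r) : 0 < eta <= T -> 0 <= eps ->
  eps <= excess gam `[0, eta] -> dot v v = 1 -> eps ^+ 2 * eta <= isqdot v eta.
Proof.
move=> /andP[eta0 etaT] eps0 exc v1.
have mueta : fine (mu `[0, eta]%classic) = eta.
  by rewrite lebesgue_measure_itv /= lte_fin eta0 /= subr0.
pose J := \int[mu]_(t in `[0, eta]) (scal G (embed v) (derive1 (@hproj R G \o gam) t)) ^+ 2.
have J0 : 0 <= J by apply: Rintegral_ge0 => t _; exact: sqr_ge0.
have h1 : eps <= Num.sqrt (eta^-1 * J).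
  apply: (le_trans exc); rewrite /excess mueta.
  apply: inf_lbound; last first.
    by exists (embed v) => //; split; [exact: embed_layer | rewrite scal_embed].
  by exists 0 => _ [w _ <-]; exact: sqrtr_ge0.
have h2 : eps ^+ 2 <= eta^-1 * J.
  rewrite -[leRHS]sqr_sqrtr ?mulr_ge0 ?invr_ge0 ?(ltW eta0) //.
  by rewrite ler_sqr ?nnegrE // sqrtr_ge0.
apply: (@le_trans _ _ J).
  by move: h2; rewrite ler_pdivlMl // mulrC.
have mq : measurable_fun `[0, eta]%classic (sqdot v).
  by apply: measurable_funS (measurable_sqdot v).
have p2 : (0 <= \int[mu]_(t in `[0%R, eta]) (sqdot v t)%:E)%E.
  by apply: integral_ge0 => x _; rewrite lee_fin; case/andP: (sqdot01 v x).
have fin2 : (\int[mu]_(t in `[0%R, eta]) (sqdot v t)%:E < +oo)%E.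
  rewrite -ge0_fin_numE //; apply: integrable_fin_num => //.
  have muf : (mu `[0%R, eta]%classic < +oo)%E by rewrite lebesgue_measure_itv /= lte_fin eta0 ltry.
  apply: measurable_bounded_integrable => //.
  exists 1; split; first exact: num_real.
  move=> M M1 x _ /=; have /andP[f0 f1] := sqdot01 v x.
  by rewrite ger0_norm // (le_trans f1) // ltW.
have le12 : (\int[mu]_(t in `[0%R, eta]) ((scal G (embed v) (derive1 (@hproj R G \o gam) t)) ^+ 2)%:E
   <= \int[mu]_(t in `[0%R, eta]) (sqdot v t)%:E)%E.
  apply: le_lower_integral => //.
  - by move=> x _; rewrite lee_fin sqr_ge0.
  - by move=> x _; rewrite lee_fin; case/andP: (sqdot01 v x).
  - exact/measurable_EFinP.
  - have [_ _ _ n] := H.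
    apply: ae_imp (ae_and ae_derive1_hproj n) => t [e1 e2] /=.
    rewrite in_itv /= => /andP[t0 t1].
    have tT : t \in `[0, T] by rewrite in_itv /= t0 (le_trans t1).
    rewrite e1 // sqdotE // lee_fin scal_embed le_min lexx /=.
    have b1 : norm2 v = 1 by rewrite /norm2 v1 sqrtr1.
    have b2 := e2 tT.
    have b3 : dot v (cvec h t) <= 1.
      by apply: (le_trans (dot_le_norm2 _ _)); rewrite b1 mul1r.
    have b4 : - 1 <= dot v (cvec h t).
      rewrite lerNl -dotNl; apply: (le_trans (dot_le_norm2 _ _)).
      by rewrite -scaleN1r norm2Z normrN1 mul1r b1 mul1r.
    by rewrite -real_normK ?num_real // expr_le1 // ler_norml b4 b3.
rewrite /J /isqdot /Rintegral; apply: fine_le => //.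
- rewrite ge0_fin_numE; first exact: le_lt_trans le12 fin2.
  by apply: integral_ge0 => x _; rewrite lee_fin sqr_ge0.
- by rewrite ge0_fin_numE.
Qed.

(** The control is the derivative of the first layer coordinates of the curve, so
    the linear term of the pointwise inequality integrates to a displacement. *)
Lemma isqdot_displacement (v w : 'rV[R]_r) (a b c : R) : 0 <= a -> a <= b -> b <= T ->
  (forall x, norm2 x <= 1 -> dot v x ^+ 2 + dot w x <= c) ->
  isqdot v b - isqdot v a + dot w (coord1 (z b) - coord1 (z a)) <= c * (b - a).
Proof.
move=> a0 ab bT Hc.
have [[K HK] _ d n] := H.
have lw : linear (fun y : V => dot w (coord1 y)).
  by move=> k x y; rewrite linearP dotDr dotZr.
pose L : {linear V -> R} := HB.pack (fun y : V => dot w (coord1 y))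
  (GRing.isLinear.Build _ _ _ _ _ lw).
have [KL KL0 HKL] := linear_bounded L.
have -> : dot w (coord1 (z b) - coord1 (z a)) = L (z b) - L (z a).
  by rewrite dotDr dotNr.
have -> : isqdot v b - isqdot v a + (L (z b) - L (z a)) =
   (isqdot v b + L (z b)) - (isqdot v a + L (z a)) by ring.
have c0 : 0 <= c.
  by have := Hc 0; rewrite /norm2 !dot0l sqrtr0 dotC dot0l (dotC w) dot0l expr0n addr0; apply.
apply: (@ae_mean_value_upper _ (fun t => isqdot v t + L (z t)) a b (1 + KL * K) (norm2 w)) => //.
- by apply: le_trans c0; rewrite oppr_le0 norm2_ge0.
- move=> u t uab tab.
  have incr u' t' : a <= u' -> u' <= t' -> `|isqdot v u' - isqdot v t'| <= `|u' - t'|.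
    move=> au ut; have /andP[i0 i1] := primitive_increment (measurable_sqdot v) (sqdot01 v) (le_trans a0 au) ut.
    by rewrite distrC ger0_norm // distrC ger0_norm // subr_ge0.
  have h1 : `|isqdot v u - isqdot v t| <= `|u - t|.
    move/andP: uab => [au ub]; move/andP: tab => [at_ tb].
    have [ut|tu] := leP u t; first exact: incr.
    by rewrite distrC [leRHS]distrC; apply: incr => //; exact: ltW.
  have h2 : `|L (z u) - L (z t)| <= KL * K * `|u - t|.
    rewrite -linearB; apply: (le_trans (HKL _)); rewrite -mulrA ler_wpM2l ?(ltW KL0) //.
    move/andP: uab => [au ub]; move/andP: tab => [at_ tb].
    by apply: HK; apply/andP; split; lra.
  have -> : isqdot v u + L (z u) - (isqdot v t + L (z t)) =
    (isqdot v u - isqdot v t) + (L (z u) - L (z t)) by ring.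
  by apply: (le_trans (ler_normD _ _)); rewrite mulrDl mul1r lerD.
- apply: ae_imp (ae_and (ae_and d n) (ae_and (ae_is_derive_primitive (measurable_sqdot v) (sqdot01 v)) (ae_neq 0))).
  move=> t [[dt nt] [it t0]]; rewrite in_itv /= => /andP[at_ tb].
  have tT : t \in `[0, T] by rewrite in_itv /= (le_trans a0) // (le_trans tb).
  have tp : 0 < t by rewrite lt_neqAle eq_sym t0 (le_trans a0).
  exists (sqdot v t + dot w (cvec h t)).
    have dL : is_derive t 1 (fun u => L (z u)) (dot w (cvec h t)).
      have -> : dot w (cvec h t) = L (left_field G (z t) (embed (cvec h t))).
        by rewrite /= -(coord1_dexp (z t)) dexp_left_field coord1_embed.
      exact: is_derive_linear (dt tT).
    by apply: is_deriveD => //; exact: it.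
  rewrite sqdotE //; have n1 := nt tT.
  apply/andP; split.
    apply: (@le_trans _ _ (dot w (cvec h t))); last first.
      by rewrite lerDr le_min sqr_ge0 ler01.
    rewrite lerNl -dotNl; apply: (le_trans (dot_le_norm2 _ _)).
    by rewrite -scaleN1r norm2Z normrN1 mul1r -[leRHS]mulr1 ler_wpM2l // norm2_ge0.
  by apply: le_trans (Hc _ n1); rewrite lerD2r ge_min lexx.
Qed.

Lemma isqdot0 v : isqdot v 0 = 0.
Proof.
by rewrite /isqdot set_itv1 Rintegral_set1.
Qed.

End Excess.

(** * Gram forms *)

(** The matrix [Q] of the Gram form is invertible, and the coefficients are the
    scalar products of the [u i] with the solution [x] of [x *m Q = w]; testing
    this equation with [x] bounds the norm of [x]. *)
Lemma gram_solve (R : realType) (r N : nat) (u : 'I_N -> 'rV[R]_r) (c : R) : 0 < c ->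
  (forall v, dot v v = 1 -> c <= \sum_i dot v (u i) ^+ 2) ->
  forall w : 'rV[R]_r, exists a : 'I_N -> R,
    w = \sum_i a i *: u i /\ forall i, `|a i| <= norm2 w * norm2 (u i) / c.
Proof.
move=> c0 Hc w.
pose Q : 'M[R]_r := \matrix_(k, l) \sum_i u i 0 k * u i 0 l.
have QE v : v *m Q = \sum_i dot v (u i) *: u i.
  apply/rowP => l; rewrite !mxE summxE.
  under eq_bigr do rewrite !mxE mulr_sumr.
  rewrite exchange_big /=; apply: eq_bigr => i _; rewrite !mxE mulr_suml.
  by apply: eq_bigr => k _; rewrite mulrA.
have dotQ v : dot (v *m Q) v = \sum_i dot v (u i) ^+ 2.
  have dsum (g : 'I_N -> 'rV[R]_r) : dot (\sum_i g i) v = \sum_i dot (g i) v.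
    by apply: (big_morph (dot^~ v)); [move=> x y; exact: dotDl | exact: dot0l].
  by rewrite QE dsum; apply: eq_bigr => i _; rewrite dotZl dotC expr2.
have low v : c * norm2 v ^+ 2 <= dot (v *m Q) v.
  have [v0|v0] := eqVneq (norm2 v) 0.
    rewrite v0 expr0n mulr0 dotQ; apply: sumr_ge0 => i _; exact: sqr_ge0.
  have vp : 0 < norm2 v by rewrite lt_neqAle eq_sym v0 norm2_ge0.
  have h1 : dot ((norm2 v)^-1 *: v) ((norm2 v)^-1 *: v) = 1.
    by rewrite -sqr_norm2 norm2Z gtr0_norm ?invr_gt0 // mulVf // expr1n.
  have := Hc _ h1; rewrite dotQ.
  have -> : \sum_i dot ((norm2 v)^-1 *: v) (u i) ^+ 2 = (norm2 v ^+ 2)^-1 * \sum_i dot v (u i) ^+ 2.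
    by rewrite mulr_sumr; apply: eq_bigr => i _; rewrite dotZl exprMn exprVn.
  by rewrite ler_pdivlMl ?exprn_gt0 // mulrC.
have Qu : Q \in unitmx.
  rewrite -row_free_unit -kermx_eq0; apply/rowV0P => v /sub_kermxP vQ.
  have := low v; rewrite vQ dot0l => h.
  apply: dot_eq0; rewrite -sqr_norm2; apply/eqP; rewrite eq_le sqr_ge0 andbT.
  by move: h; rewrite pmulr_rle0.
pose x := w *m invmx Q.
have xQ : x *m Q = w by rewrite /x mulmxKV.
have xle : norm2 x <= norm2 w / c.
  have := low x; rewrite xQ => h.
  have h2 := le_trans h (dot_le_norm2 w x).
  have [x0|x0] := eqVneq (norm2 x) 0.
    by rewrite x0 divr_ge0 ?norm2_ge0 // ltW.
  have xp : 0 < norm2 x by rewrite lt_neqAle eq_sym x0 norm2_ge0.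
  rewrite ler_pdivlMr // mulrC -(ler_pM2r xp) (le_trans _ h2) //.
  by rewrite expr2 mulrA.
exists (fun i => dot x (u i)); split; first by rewrite -QE xQ.
have dn y : dot x y <= norm2 w / c * norm2 y.
  by apply: (le_trans (dot_le_norm2 _ _)); rewrite ler_wpM2r // norm2_ge0.
move=> i; rewrite ler_norml; apply/andP; split; last by rewrite mulrAC; exact: dn.
rewrite lerNl -dotNr mulrAC; apply: (le_trans (dn _)).
by rewrite -scaleN1r norm2Z normrN1 mul1r.
Qed.

(** * Conjugating the factors of a product *)
Section Products.
Context {R : realType} (G : carnotGroup R).
Local Notation log := (@lglog R _ G).
Local Notation P := (proj_layer G).
Local Notation s := (step G).

Fixpoint gprod (f : nat -> G) (n : nat) : G :=
  if n is n'.+1 then (gprod f n' * f n')%g else 1%g.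

Lemma reach_gprod (f : nat -> G) (l : nat -> R) (l0 : R) n : 0 < l0 ->
  (forall i, (i < n)%N -> reach (f i) (l i)) ->
  reach (gprod f n) (l0 + \sum_(i < n) l i).
Proof.
move=> l00; elim: n => [|n IH] H; first by rewrite big_ord0 addr0; exact: reach1.
rewrite big_ord_recr /= addrA; apply: reach_mul; last exact: H.
by apply: IH => i ni; apply: H; exact: ltnW.
Qed.

(** Conjugating the [i]-th factor inserts a commutator, with leading part the
    bracket of [m i] with [Z i]. Bringing it to the front conjugates it, which does
    not change its leading part. *)
Lemma gprod_conj (m c : nat -> G) (Z : nat -> 'rV[R]_(topdim G)) j n :
  (forall i, (i < n)%N -> lead j (c i) (Z i)) ->
  exists S, lead j.+1 S (\sum_(i < n) ad G (P 1%N (log (m i))) (Z i)) /\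
    gprod (fun i => (c i)^-1 * m i * c i)%g n = (S * gprod m n)%g.
Proof.
elim: n => [|n IH] H.
  by exists 1%g; rewrite big_ord0 mulg1; split => //; exact: lead1.
have [|S [lS ES]] := IH; first by move=> i ni; apply: H; exact: ltnW.
have lc := lead_commutator (m n) (H n (ltnSn n)).
exists (S * (gprod m n * ((c n)^-1 * (m n * c n * (m n)^-1)) * (gprod m n)^-1))%g.
rewrite big_ord_recr /=; split; first by apply: leadM => //; exact: lead_conj.
by rewrite ES -!mulgA mulKg mulVg mulg1.
Qed.

Lemma bnd_small (sg rho : R) x : 0 <= sg <= 1 -> 0 <= rho -> bnd (G := G) (sg ^+ s) rho x -> bnd 1 (sg * rho) x.
Proof.
move=> /andP[s0 s1] r0 H; apply: (@bndP _ _ s) => //; first by rewrite mulr_ge0.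
move=> j js; apply: (le_trans (H j)); rewrite mul1r exprMn ler_wpM2r ?exprn_ge0 //.
exact: ler_wiXn2l.
Qed.

End Products.

Section Grid.
Context {R : realType}.
Implicit Types eta : R.

Definition grid (eta : R) (N i : nat) : R := eta * i%:R / N%:R.

Lemma grid0 eta N : grid eta N 0 = 0. Proof. by rewrite /grid mulr0 mul0r. Qed.
Lemma gridN eta N : (0 < N)%N -> grid eta N N = eta.
Proof. by move=> N0; rewrite /grid -mulrA mulfV ?mulr1 // pnatr_eq0 -lt0n. Qed.
Lemma gridS eta N i : grid eta N i.+1 - grid eta N i = eta / N%:R.
Proof. by rewrite /grid -mulrBl -mulrBr -natrB // subSnn mulr1. Qed.
Lemma grid_ge0 eta N i : 0 <= eta -> 0 <= grid eta N i.
Proof. by move=> e0; rewrite /grid !mulr_ge0 // invr_ge0. Qed.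
Lemma grid_lt eta N i : 0 < eta -> (0 < N)%N -> grid eta N i < grid eta N i.+1.
Proof. by move=> e0 N0; rewrite -subr_gt0 gridS divr_gt0 // ltr0n. Qed.
Lemma grid_le eta N i : 0 <= eta -> (0 < N)%N -> (i <= N)%N -> grid eta N i <= eta.
Proof.
move=> e0 N0 iN; rewrite /grid -mulrA -[leRHS]mulr1 ler_wpM2l //.
by rewrite ler_pdivrMr ?ltr0n // mul1r ler_nat.
Qed.

End Grid.

(** * Inscribed polygons of a minimizer *)
Section Minimizer.
Context {R : realType} (G : carnotGroup R).
Local Notation V := 'rV[R]_(topdim G).
Local Notation exp := (lgexp G).
Local Notation log := (@lglog R _ G).
Local Notation F := (chart_mul G).
Local Notation P := (proj_layer G).
Local Notation ad := (ad G).
Local Notation s := (step G).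
Local Notation r := (rank G).

Variables (T : R) (gam : R -> G) (h : 'I_r -> R -> R).
Hypothesis T0 : 0 < T.
Hypothesis H : horizontal1 0 T gam h.
Hypothesis Hmin : forall t l, 0 < t <= T -> reach ((gam 0)^-1 * gam t)%g l -> t <= l.

Definition arc (a b : R) : G := ((gam a)^-1 * gam b)%g.
Definition disp (a b : R) : 'rV[R]_r := coord1 (log (gam b)) - coord1 (log (gam a)).

Lemma coord1_arc a b : coord1 (log (arc a b)) = disp a b.
Proof. by rewrite /arc lglogM lglogV coord1_chart_mul linearN addrC. Qed.

Lemma disp_bounded : exists2 K, 1 <= K & forall a b, 0 <= a -> a < b -> b <= T ->
  norm2 (disp a b) <= K * (b - a).
Proof.
have [Kr Kr1 HKr] := reach_bnd G; have [Kc Kc0 HKc] := coord1_bounded G.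
exists (1 + Kc * Kr); first by rewrite lerDl mulr_ge0 ?(ltW Kc0) //; lra.
move=> a b a0 ab bT; rewrite -coord1_arc; apply: (le_trans (HKc _)).
have := HKr _ _ (reach_arc H a0 ab bT) 1%N; rewrite expr1 => h1.
apply: (@le_trans _ _ (Kc * (Kr * (b - a)))); first by rewrite ler_wpM2l // ltW.
by rewrite mulrA ler_wpM2r ?subr_ge0 ?(ltW ab) // lerDr.
Qed.

(** Every piece is replaced by the segment with the same displacement. The pieces
    have size eta / N and the corrections have no component of degree 1, so their
    components of degree j are O((eta / N)^j) with j >= 2; the N corrections
    together lie in a box which shrinks with respect to eta as N grows, and are
    made by a curve of length at most d eta / 2. A polygon shorter than
    (1 - d) eta would thus produce a curve shorter than the minimizer. *)
Lemma polygon_length (d : R) : 0 < d -> exists2 N, (0 < N)%N &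
  forall eta, 0 < eta <= T ->
    (1 - d) * eta <= \sum_(i < N) norm2 (disp (grid eta N i) (grid eta N i.+1)).
Proof.
move=> d0.
have [Kr Kr1 HKr] := reach_bnd G.
have [K2 K20 HK2] := chart_mul_bndC G Kr.
have [Kd Kd1 HKd] := disp_bounded.
pose A := 1 + d + Kd.
have A1 : 1 <= A by rewrite /A; lra.
pose K5 := Kr * A ^+ s.
have K50 : 0 <= K5 by rewrite mulr_ge0 ?exprn_ge0 //; lra.
have [K6 K60 HK6] := Ad_bnd G K50.
have [K7 K71 HK7] := chart_mul_bnd G.
have [Cb Cb0 HCb] := ball_box G.
pose sg := d / (2 * (Cb + d)).
have sg0 : 0 < sg by rewrite divr_gt0 // mulr_gt0 // addr_gt0.
have sg1 : sg <= 1 by rewrite ler_pdivrMr ?mul1r; lra.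
have Csg : Cb * sg <= d / 2.
  rewrite /sg mulrA ler_pdivrMr; last by lra.
  by rewrite mulrAC; nra.
pose X := K7 * (K6 * K2) / sg ^+ s.
have X0 : 0 <= X by rewrite divr_ge0 ?exprn_ge0 ?(ltW sg0) // !mulr_ge0 //; lra.
pose N := (Num.bound X).+1.
have N0 : (0 < N)%N by [].
have NX : X <= N%:R.
  apply: ltW; apply: (le_lt_trans (ler_norm X)).
  by apply: (lt_trans (archi_boundP (normr_ge0 X))); rewrite /N ltr_nat ger0_norm.
have Np : 0 < N%:R :> R by rewrite ltr0n.
have N1 : 1 <= N%:R :> R by rewrite ler1n.
exists N => // eta /andP[eta0 etaT].
pose t i := grid eta N i.
pose u i := disp (t i) (t i.+1).
pose m i := arc (t i) (t i.+1).
pose tau := eta / N%:R.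
have tau0 : 0 < tau by rewrite divr_gt0.
have tT i : (i < N)%N -> t i.+1 <= T by move=> iN; rewrite (le_trans _ etaT) // grid_le // ltW.
have rm i : (i < N)%N -> reach (m i) tau.
  move=> iN; rewrite /tau -(gridS eta N i); apply: (reach_arc H); last exact: tT.
    by apply: grid_ge0; exact: ltW.
  exact: grid_lt.
pose U i := embed (u i).
have UE i : U i = P 1%N (log (m i)).
  by rewrite /U /u -coord1_arc embed_coord1.
pose q := gprod (fun i => exp (U i)).
(* A small amount of time is granted to every segment: [reach] asks for positive
   durations, and displacements may vanish. *)
pose d' := d * eta / (4 * N.+1%:R).
have d'0 : 0 < d' by rewrite divr_gt0 ?mulr_gt0.
pose len n := d' + \sum_(i < n) (norm2 (u i) + d').
have rq n : reach (q n) (len n).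
  apply: (reach_gprod (l := fun i => norm2 (u i) + d')) => // i _.
  apply: reach_embed; first by rewrite ltr_wpDl // norm2_ge0.
  by rewrite lerDl ltW.
have d'N : d' * N.+1%:R = d * eta / 4.
  have x0 : N.+1%:R != 0 :> R by rewrite pnatr_eq0.
  by rewrite /d'; move: (N.+1%:R : R) x0 => x x0; field.
have lenE n : len n = d' * n.+1%:R + \sum_(i < n) norm2 (u i).
  rewrite /len big_split /= sumr_const card_ord -[d' *+ n]mulr_natr -natr1.
  ring.
have norm_u i : (i < N)%N -> norm2 (u i) <= Kd * tau.
  move=> iN; rewrite /u /tau -(gridS eta N i); apply: HKd; [|exact: grid_lt|exact: tT].
  by apply: grid_ge0; exact: ltW.
have len_le n : (n <= N)%N -> len n <= A * eta.
  move=> nN; rewrite lenE.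
  have h1 : d' * n.+1%:R <= d * eta / 4.
    by rewrite -d'N ler_wpM2l ?(ltW d'0) // ler_nat ltnS.
  have h2 : \sum_(i < n) norm2 (u i) <= Kd * eta.
    apply: (@le_trans _ _ (\sum_(i < n) (Kd * tau))).
      by apply: ler_sum => i _; apply: norm_u; exact: leq_trans (ltn_ord i) nN.
    rewrite sumr_const card_ord -[_ *+ n]mulr_natr -mulrA ler_wpM2l //; first by lra.
    by rewrite /tau mulrAC ler_pdivrMr // ler_wpM2l ?(ltW eta0) // ler_nat.
  have : d * eta / 4 <= d * eta by rewrite ler_pdivrMr // ler_peMr ?mulr_ge0 ?(ltW d0) ?(ltW eta0) //; lra.
  by rewrite /A; nra.
have bq n : (n <= N)%N -> bnd K5 eta (log (q n)).
  move=> nN; apply: bnd_scale_out => //; [lra|exact: ltW|].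
  by apply: HKr; apply: reach_le (rq n) (len_le n nN).
pose g i := (m i * exp (- U i))%g.
pose y i := log (g i).
have P1y i : P 1%N (y i) = 0.
  rewrite /y /g lglogM lgexpK proj1_chart_mul linearN /= /U proj1_embed.
  by rewrite -/(U i) UE subrr.
have by_ i : (i < N)%N -> bnd (K2 / N%:R ^+ 2) eta (y i).
  move=> iN.
  have b1 : bnd K2 tau (y i).
    have bm := HKr _ _ (rm i iN).
    rewrite /y /g lglogM lgexpK; apply: HK2 => //; first exact: ltW.
    apply: bndN => j; rewrite UE proj_layer_proj; case: eqP => [->|_] //.
    by rewrite normr0 mulr_ge0 ?exprn_ge0 ?(ltW tau0) //; lra.
  move=> [|[|j]].
  - by rewrite proj_layer0 normr0 mulr_ge0 ?divr_ge0 ?exprn_ge0 ?ler0n ?(ltW eta0).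
  - by rewrite P1y normr0 mulr_ge0 ?divr_ge0 ?exprn_ge0 ?ler0n ?(ltW eta0).
  - apply: (le_trans (b1 _)); rewrite /tau exprMn exprVn mulrA mulrAC.
    rewrite ler_wpM2r ?exprn_ge0 ?(ltW eta0) // ler_wpM2l //.
    rewrite lef_pV2 ?posrE ?exprn_gt0 //; exact: ler_weXn2l.
pose th := K6 * (K2 / N%:R ^+ 2).
have th0 : 0 <= th by rewrite mulr_ge0 // divr_ge0 // exprn_ge0.
have thN : N%:R * (K7 * th) <= sg ^+ s.
  have -> : N%:R * (K7 * th) = K7 * (K6 * K2) / N%:R by rewrite /th; field; rewrite gt_eqF.
  have sgs0 : 0 < sg ^+ s by exact: exprn_gt0.
  by move: NX; rewrite /X !ler_pdivrMr // [sg ^+ s * _]mulrC.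
have sgs1 : sg ^+ s <= 1 by rewrite exprn_ile1 // ltW.
have thi i : (i <= N)%N -> i%:R * (K7 * th) <= 1.
  move=> iN; apply: le_trans sgs1; apply: le_trans thN.
  by rewrite ler_wpM2r ?ler_nat // mulr_ge0 //; lra.
have th1 : th <= 1.
  have := thi 1%N N0; rewrite mul1r; apply: le_trans.
  by rewrite ler_peMl.
pose E n := (gprod m n * (q n)^-1)%g.
have ES n : E n.+1 = (E n * (q n * g n * (q n)^-1))%g.
  rewrite /E /q /= -/(q n) /g lgexpN invgM -!mulgA; congr (_ * _)%g.
  by rewrite mulKg.
have bE n : (n <= N)%N -> bnd (n%:R * (K7 * th)) eta (log (E n)).
  elim: n => [|n IH] nN.
    rewrite /E /= mul1g invg1 lglog1 mul0r => j.
    by rewrite linear0 normr0 mul0r.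
  have {}IH := IH (ltnW nN).
  rewrite ES lglogM -natr1 mulrDl mul1r.
  set y' := log (_ * _ * _)%g.
  have by' : bnd th eta y'.
    have -> : y' = Ad (exp (log (q n))) (y n).
      by rewrite /y' /Ad lglogK (lglogK (g n)).
    apply: HK6; [exact: ltW | by rewrite divr_ge0 // exprn_ge0 | exact: bq (ltnW nN) | exact: by_].
  rewrite -[F _](subrK (log (E n))) [_ - _ + _]addrC; apply: bndD => //.
  apply: HK7 => //; [exact: ltW | by rewrite th0 | ].
  by apply: bnd_le IH; [exact: ltW | exact: thi (ltnW nN)].
have rE : reach (E N) (Cb * (sg * eta)).
  apply: HCb; first by rewrite mulr_gt0.
  apply: bnd_small; [by rewrite (ltW sg0) | exact: ltW |].
  by apply: bnd_le (bE N (leqnn N)); first exact: ltW.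
have prodm n : gprod m n = arc 0 (t n).
  elim: n => [|n IH]; first by rewrite /= /arc /t grid0 mulVg.
  by rewrite /= IH /m /arc -!mulgA mulVKg.
have := reach_mul rE (rq N).
rewrite /E mulgVK prodm /t gridN // => rr.
have := Hmin _ rr; rewrite eta0 etaT => /(_ isT).
rewrite lenE d'N -/(t _).
have : Cb * (sg * eta) <= d / 2 * eta by rewrite mulrA ler_wpM2r // ltW.
have de : 0 <= d * eta by rewrite mulr_ge0 // ltW.
move=> h1 h2; set S := \sum_(i < N) norm2 (u i) in h2.
change ((1 - d) * eta <= S); move: h1 h2.
set a := Cb * (sg * eta); lra.
Qed.

End Minimizer.

Lemma bessel (R : realType) (r : nat) (v w x : 'rV[R]_r) : dot v v = 1 -> dot w w <= 1 ->
  dot v w = 0 -> dot v x ^+ 2 + dot w x ^+ 2 <= dot x x.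
Proof.
move=> v1 w1 vw.
have := dot_ge0 (x - dot v x *: v - dot w x *: w).
rewrite !(dotDl, dotDr, dotNl, dotNr, dotZl, dotZr) v1 (dotC w v) vw (dotC x v) (dotC x w).
move: (dot_ge0 w) w1; move: (dot w w) (dot v x) (dot w x) (dot x x) => ww a b c ww0 w1 H.
have : 0 <= b ^+ 2 * (1 - ww) by rewrite mulr_ge0 ?sqr_ge0 ?subr_ge0.
nra.
Qed.

Lemma dot_sub_scale (R : realType) (r : nat) (k : R) (x u : 'rV[R]_r) :
  dot (x - k *: u) (x - k *: u) = dot x x - 2 * k * dot u x + k ^+ 2 * dot u u.
Proof.
by rewrite !(dotDl, dotDr, dotNl, dotNr, dotZl, dotZr) (dotC x u); ring.
Qed.

Lemma unit_orthogonal (R : realType) (r : nat) (w : 'rV[R]_r) : (2 <= r)%N ->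
  exists2 v, dot v v = 1 & dot v w = 0.
Proof.
move=> r2.
have : kermx w^T != 0.
  rewrite -mxrank_eq0 mxrank_ker -lt0n subn_gt0.
  exact: leq_ltn_trans (rank_leq_col _) r2.
move=> /rowV0Pn[v /sub_kermxP vw v0].
have vw0 : dot v w = 0.
  have := congr1 (fun M : 'M[R]_1 => M 0 0) vw; rewrite !mxE => e; rewrite -[RHS]e.
  by apply: eq_bigr => i _; rewrite mxE.
have n0 : norm2 v != 0.
  apply/eqP => n0; case/eqP: v0; apply: dot_eq0; by rewrite -sqr_norm2 n0 expr0n.
exists ((norm2 v)^-1 *: v); last by rewrite dotZl vw0 mulr0.
by rewrite dotZl dotZr -sqr_norm2; field.
Qed.

(** * Short cuts *)
Section Stages.
Context {R : realType} (G : carnotGroup R).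
Local Notation V := 'rV[R]_(topdim G).
Local Notation exp := (lgexp G).
Local Notation log := (@lglog R _ G).
Local Notation F := (chart_mul G).
Local Notation P := (proj_layer G).
Local Notation ad := (ad G).
Local Notation s := (step G).
Local Notation r := (rank G).
Local Notation X i := (tnth (frame G) i).

Variables (T : R) (gam : R -> G) (h : 'I_r -> R -> R).
Hypothesis T0 : 0 < T.
Hypothesis H : horizontal1 0 T gam h.
Hypothesis Hmin : forall t l, 0 < t <= T -> reach ((gam 0)^-1 * gam t)%g l -> t <= l.

Local Notation arc := (arc gam).
Local Notation disp := (disp gam).

Variables (eps eta0 : R).
Hypothesis eps0 : 0 < eps.
Hypothesis eta00 : 0 < eta0.
Hypothesis eta0T : eta0 <= T.
Hypothesis spread : forall eta v, 0 < eta <= eta0 -> dot v v = 1 ->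
  eps ^+ 2 * eta <= isqdot T h v eta.

(** With u the displacement and tau the duration of a piece, the deviation of the
    velocity h from its mean satisfies
      int |h - u / tau|^2 <= tau - |u|^2 / tau <= 2 (tau - |u|),
    while <v, h>^2 <= 2 <v, h - u / tau>^2 + 2 <v, u / tau>^2. *)
Lemma isqdot_disp_le (v : 'rV[R]_r) a b : dot v v = 1 -> 0 <= a -> a < b -> b <= T ->
  isqdot T h v b - isqdot T h v a <=
    4 * (b - a - norm2 (disp a b)) + 2 * (dot v (disp a b) ^+ 2 / (b - a)).
Proof.
move=> v1 a0 ab bT.
set u := disp a b; set n := norm2 u; set q := dot v u.
set tau := b - a; have tau0 : 0 < tau by rewrite subr_gt0.
have n2 : dot u u = n ^+ 2 by rewrite sqr_norm2.
pose c := 2 + 2 * (n / tau) ^+ 2 + 2 * (q / tau) ^+ 2.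
have := @isqdot_displacement R G T gam h H v ((4 / tau) *: u) a b c a0 (ltW ab) bT.
have pw x : norm2 x <= 1 -> dot v x ^+ 2 + dot ((4 / tau) *: u) x <= c.
  move=> x1; have xx : dot x x <= 1 by rewrite -sqr_norm2 expr_le1 // norm2_ge0.
  pose y := x - tau^-1 *: u.
  have vy : dot v y ^+ 2 <= dot y y.
    have := @bessel R r v 0 y v1 _ _; rewrite dot0l => /(_ ler01).
    by rewrite dotC dot0l => /(_ erefl); rewrite dotC dot0l expr0n addr0.
  have e1 : dot v x = dot v y + q / tau.
    by rewrite /y dotDr dotNr dotZr -/q mulrC; ring.
  have e2 : dot y y = dot x x - 2 * (dot u x / tau) + (n / tau) ^+ 2.
    rewrite /y dot_sub_scale n2.
    by field; rewrite gt_eqF.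
  have e3 : dot ((4 / tau) *: u) x = 4 * (dot u x / tau) by rewrite dotZl; ring.
  rewrite e3 e1 /c; move: vy; rewrite e2.
  have := sqr_ge0 (dot v y - q / tau); rewrite !expr2; nra.
move=> /(_ pw); rewrite -/(disp a b) -/u -/tau dotZl n2 => h1.
have sq : 0 <= (tau - n) ^+ 2 / tau by rewrite divr_ge0 ?sqr_ge0 // ltW.
have e4 : 4 / tau * n ^+ 2 = 4 * (n ^+ 2 / tau) by ring.
have e5 : c * tau = 2 * tau + 2 * (n ^+ 2 / tau) + 2 * (q ^+ 2 / tau).
  by rewrite /c; field; rewrite gt_eqF.
have e6 : (tau - n) ^+ 2 / tau = tau - 2 * n + n ^+ 2 / tau.
  by field; rewrite gt_eqF.
move: h1 sq; rewrite e4 e5 e6; lra.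
Qed.

(** Sum of [isqdot_disp_le] over the pieces of a polygon whose length is close to
    that of the curve. *)
Lemma gram_lower_bound : exists2 c0, 0 < c0 & exists2 N, (0 < N)%N &
  forall eta v, 0 < eta <= eta0 -> dot v v = 1 ->
    c0 * eta ^+ 2 <= \sum_(i < N) dot v (disp (grid eta N i) (grid eta N i.+1)) ^+ 2.
Proof.
have [|N N0 HN] := @polygon_length R G T gam h H Hmin (eps ^+ 2 / 8).
  by rewrite divr_gt0 // exprn_gt0.
have Np : 0 < N%:R :> R by rewrite ltr0n.
exists (eps ^+ 2 / (4 * N%:R)); first by rewrite divr_gt0 ?exprn_gt0 ?mulr_gt0.
exists N => // eta v /andP[e0 ee] v1.
have eT := le_trans ee eta0T.
set u := fun i => disp (grid eta N i) (grid eta N i.+1).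
have hE := @spread eta v _ v1; rewrite e0 ee in hE; have {}hE := hE isT.
have := HN eta; rewrite e0 eT => /(_ isT); rewrite -/(u _) => hL.
have tel : isqdot T h v eta <= \sum_(i < N)
   (4 * (eta / N%:R - norm2 (u i)) + 2 * (dot v (u i) ^+ 2 / (eta / N%:R))).
  have -> : isqdot T h v eta = \sum_(0 <= i < N)
      (isqdot T h v (grid eta N i.+1) - isqdot T h v (grid eta N i)).
    by rewrite telescope_sumr // gridN // grid0 isqdot0 subr0.
  rewrite big_mkord; apply: ler_sum => i _; rewrite -(gridS eta N i).
  apply: isqdot_disp_le => //; first by apply: grid_ge0; exact: ltW.
    exact: grid_lt.
  by apply: le_trans eT; apply: grid_le => //; exact: ltW.
have {}tel := le_trans hE tel.
rewrite big_split /= -!mulr_sumr sumrB sumr_const card_ord -mulr_suml in tel.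
have eN : (eta / N%:R) *+ N = eta by rewrite -mulr_natr divfK // gt_eqF.
rewrite eN in tel.
change (\sum_(i < N) _) with (\sum_(i < N) norm2 (u i)) in hL.
change (eps ^+ 2 / (4 * N%:R) * eta ^+ 2 <= \sum_(i < N) dot v (u i) ^+ 2).
move: tel hL; set L := \sum_(i < N) norm2 _; set Q := \sum_(i < N) _ => tel hL.
have h1 : eps ^+ 2 / 4 * eta <= Q / (eta / N%:R) by nra.
rewrite ler_pdivlMr ?divr_gt0 // in h1.
apply: le_trans h1; rewrite le_eqVlt; apply/orP; left; apply/eqP.
by field; rewrite gt_eqF.
Qed.

(** At every small scale [rho] some curve is shorter than [gam] by a fixed
    proportion of [rho], its end point being off by an element of degree [j]. *)
Definition shortcut (j : nat) := exists2 kappa, 0 < kappa & forall rho,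
  0 < rho <= eta0 -> exists E, fil j (log E) /\ reach (E * arc 0 rho)%g ((1 - kappa) * rho).

Hypothesis r2 : (2 <= r)%N.

(** Let [w] be the direction of the displacement and [v] a unit vector orthogonal
    to it, which exists as the rank is at least 2. Bessel's inequality bounds
    2 <w, h> by 2 - <v, h>^2, and the integral of the last term is at least
    eps^2 eta. *)
Lemma norm2_disp_le eta : 0 < eta <= eta0 ->
  norm2 (disp 0 eta) <= (1 - eps ^+ 2 / 2) * eta.
Proof.
move=> /andP[e0 ee]; have eT := le_trans ee eta0T.
set u := disp 0 eta; set n := norm2 u.
have [v v1 vu] := unit_orthogonal u r2.
pose w := n^-1 *: u.
have wu : dot w u = n.
  rewrite /w dotZl -sqr_norm2 -/n; have [->|n0] := eqVneq n 0; first by rewrite expr0n mulr0.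
  by rewrite expr2 mulKf.
have ww : dot w w <= 1.
  rewrite {2}/w dotZr wu; have [->|n0] := eqVneq n 0; first by rewrite mulr0.
  by rewrite mulVf.
have vw : dot v w = 0 by rewrite /w dotZr vu mulr0.
have := @isqdot_displacement R G T gam h H v (2 *: w) 0 eta 2 (lexx 0) (ltW e0) eT.
have pw x : norm2 x <= 1 -> dot v x ^+ 2 + dot (2 *: w) x <= 2.
  move=> x1; have xx : dot x x <= 1 by rewrite -sqr_norm2 expr_le1 // norm2_ge0.
  have := bessel x v1 ww vw; have := sqr_ge0 (dot w x - 1); rewrite (dotZl 2 w x) !expr2.
  move: (dot v x) (dot w x) (dot x x) xx => a b c; lra.
move=> /(_ pw); rewrite -/(disp 0 eta) -/u dotZl wu isqdot0 !subr0.
have := @spread eta v _ v1; rewrite e0 ee => /(_ isT); lra.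
Qed.

(** The segment with the same displacement has the same first layer coordinates
    as the curve. *)
Lemma shortcut2 : shortcut 2.
Proof.
exists (eps ^+ 2 / 4); first by rewrite divr_gt0 // exprn_gt0.
move=> eta he; have hu := norm2_disp_le he; move/andP: he => [e0 ee].
have n0 := norm2_ge0 (disp 0 eta).
have ep2 : 0 < eps ^+ 2 by rewrite exprn_gt0.
have : 0 <= 1 - eps ^+ 2 / 2 by rewrite -(pmulr_lge0 _ e0); exact: le_trans hu.
move=> ep1.
exists (exp (embed (disp 0 eta)) * (arc 0 eta)^-1)%g; split.
  move=> [|[|i]] // _; first by rewrite proj_layer0.
  by rewrite lglogM lglogV lgexpK proj1_chart_mul linearN /= proj1_embed -(embed_coord1 (log (arc 0 eta))) coord1_arc subrr.
rewrite mulgVK; apply: reach_embed; first by rewrite mulr_gt0 //; lra.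
apply: (le_trans hu); rewrite ler_wpM2r ?(ltW e0) //; lra.
Qed.

Lemma ad_suml (n : nat) (u : 'I_n -> V) (w : V) : ad (\sum_i u i) w = \sum_i ad (u i) w.
Proof.
apply: (big_morph (fun x => ad x w)); first by move=> x y; rewrite adD.
by rewrite ad0l.
Qed.

(** The error of degree [j.+1] made at scale [rho] is corrected at the scale
    [M * rho], [M] a large constant, by conjugating the pieces of [gam] with
    elements whose leading parts [Z i] have degree [j]. Since the displacements of
    the pieces span the first layer, with coefficients of order 1 / (M rho), the
    brackets with the [Z i] reach the whole layer of degree [j.+1], and the [Z i]
    needed are of order rho^j / M; the conjugations then take a time small with
    respect to the gain [kap * rho]. *)
Lemma shortcutS j : (1 <= j < s)%N -> shortcut j.+1 -> shortcut j.+2.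
Proof.
move=> /andP[j1 js] [kap kap0 Hk].
have [c0 c00 [N N0 HN]] := gram_lower_bound.
have [D D0 HD] : exists2 C, 0 <= C & forall Z, Z \in Lay G j.+1 -> exists W : 'I_r -> V,
    [/\ forall k, W k \in Lay G j, Z = \sum_k ad (X k) (W k) & forall k, `|W k| <= C * `|Z|].
  by apply: bracket_decomposition; rewrite j1.
have [Kd Kd1 HKd] := disp_bounded H.
have [Kr Kr1 HKr] := reach_bnd G.
have [K2 K20 HK2] := chart_mul_bndC G Kr.
have [|C C0 HC] := @reach_layer R G j; first by rewrite j1 ltnW.
have Np : 0 < N%:R :> R by rewrite ltr0n.
pose K9 := Kd / c0.
have K90 : 0 <= K9 by rewrite divr_ge0 ?(ltW c00) //; lra.
(* Two detours of duration C sg rho per piece cost kap rho / 4 in total. *)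
pose sg := kap / (8 * N%:R * C).
have sg0 : 0 < sg by rewrite divr_gt0 // !mulr_gt0.
pose B := r%:R * K9 * D * K2.
have B0 : 0 <= B by rewrite /B; do 3 apply: mulr_ge0 => //.
(* The first two terms make the first piece longer than rho, the last one makes
   the Z i smaller than (sg rho)^j. *)
pose M := N%:R + 1 + B / sg ^+ j.
have Bs0 : 0 <= B / sg ^+ j by rewrite divr_ge0 // exprn_ge0 // ltW.
have MN : N%:R < M by rewrite /M; lra.
have M0 : 0 < M by exact: lt_trans MN.
have N1 : 1 <= N%:R :> R by rewrite ler1n.
have M1 : 1 <= M by rewrite /M; lra.
have BM : B <= M * sg ^+ j.
  rewrite -ler_pdivrMr ?exprn_gt0 // /M; lra.
exists (kap / (2 * M)); first by rewrite divr_gt0 // mulr_gt0.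
move=> rho' /andP[rp0 rpe]; have rpT := le_trans rpe eta0T.
pose rho := rho' / M.
have rho0 : 0 < rho by rewrite divr_gt0.
have rM : rho' = M * rho by rewrite /rho mulrC divfK // gt_eqF.
have rle : rho <= eta0 by apply: le_trans rpe; rewrite rM ler_peMl // ltW.
have [|E [fE rE]] := Hk rho; first by rewrite rho0.
pose t i := grid rho' N i.
pose tau := rho' / N%:R.
have tau0 : 0 < tau by rewrite divr_gt0.
have t1 : t 1%N = tau by rewrite /t /grid mulr1.
have rt : rho < t 1%N by rewrite t1 /rho /tau ltr_pM2l // ltf_pV2.
have tge i : 0 <= t i by apply: grid_ge0; exact: ltW.
have tlt i : t i < t i.+1 by exact: grid_lt.
have tT i : (i <= N)%N -> t i <= T by move=> iN; apply: le_trans rpT; apply: grid_le => //; exact: ltW.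
pose u i := disp (t i) (t i.+1).
pose PE := P j.+1 (log E).
have bE : `|PE| <= K2 * rho ^+ j.+1.
  have b1 : bnd Kr rho (log (E * arc 0 rho)%g).
    apply: HKr; apply: reach_le rE _; rewrite ler_piMl ?(ltW rho0) //; lra.
  have b2 : bnd Kr rho (log (arc 0 rho)).
    have := reach_arc H (lexx 0) rho0 (le_trans rle eta0T); rewrite subr0.
    exact: HKr.
  have -> : PE = P j.+1 (F (log (E * arc 0 rho)%g, - log (arc 0 rho))).
    by rewrite /PE -lglogV -lglogM mulgK.
  by apply: HK2 => //; [exact: ltW | exact: bndN].
have [|W [WL WE WB]] := HD (- PE); first by rewrite memvN proj_layer_mem.
have /choice[a Ha] : forall k : 'I_r, exists a : 'I_N -> R,
    delta_mx 0 k = \sum_i a i *: u i /\ forall i, `|a i| <= K9 / rho'.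
  move=> k; have c1 : 0 < c0 * rho' ^+ 2 by rewrite mulr_gt0 ?exprn_gt0.
  have [|b [bE' bB]] := @gram_solve R r N (fun i => u i) _ c1 _ (delta_mx 0 k).
    by move=> v v1; apply: HN => //; rewrite rp0.
  exists b; split => // i; apply: (le_trans (bB i)).
  have -> : norm2 (delta_mx 0 k : 'rV[R]_r) = 1.
    rewrite /norm2 /dot (bigD1 k) //= big1 => [|l lk]; rewrite !mxE ?eqxx /=.
      by rewrite mulr1 addr0 sqrtr1.
    by rewrite (negbTE lk) mulr0.
  rewrite mul1r ler_pdivrMr //.
  have -> : K9 / rho' * (c0 * rho' ^+ 2) = Kd * rho' by rewrite /K9; field; rewrite !gt_eqF.
  apply: (le_trans (HKd _ _ (tge i) (tlt i) (tT _ (ltn_ord i)))).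
  rewrite /t gridS ler_wpM2l //; first by lra.
  by rewrite ler_pdivrMr // ler_peMr // ltW.
pose Z (i : nat) : V := if insub i is Some i' then \sum_k a k i' *: W k else 0.
have ZE (i : 'I_N) : Z i = \sum_k a k i *: W k by rewrite /Z valK.
have ZB i : `|Z i| <= (sg * rho) ^+ j.
  have sr : 0 <= (sg * rho) ^+ j by rewrite exprn_ge0 // mulr_ge0 // ltW.
  rewrite /Z; case: insubP => [i' _ _|_]; last by rewrite normr0.
  apply: (le_trans (ler_norm_sum _ _ _)).
  apply: (@le_trans _ _ (\sum_(k < r) (K9 / rho' * (D * (K2 * rho ^+ j.+1))))).
    apply: ler_sum => k _; rewrite normrZ; apply: ler_pM => //.
      by case: (Ha k) => _; exact.
    apply: (le_trans (WB k)); rewrite normrN ler_wpM2l //.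
  rewrite sumr_const card_ord -[_ *+ r]mulr_natl.
  have -> : r%:R * (K9 / rho' * (D * (K2 * rho ^+ j.+1))) = B / M * rho ^+ j.
    by rewrite /B rM exprS; field; rewrite !gt_eqF.
  rewrite [leRHS]exprMn ler_wpM2r ?exprn_ge0 ?(ltW rho0) //.
  by rewrite ler_pdivrMr // mulrC.
have /choice[c Hc] : forall i, exists c, lead j c (Z i) /\ sreach c (C * (sg * rho)).
  move=> i; apply: HC => //; first by rewrite mulr_gt0.
  rewrite /Z; case: insubP => [i' _ _|_]; last by rewrite mem0v.
  by apply: memv_suml => k _; apply: memvZ.
(* The short cut replaces the beginning of the first piece; having no component
   of degree 1, its error does not affect the displacement of that piece. *)
pose m i := if i is 0%N then (E * arc 0 (t 1%N))%g else arc (t i) (t i.+1).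
have mP i : P 1%N (log (m i)) = embed (u i).
  have PA a' b' : P 1%N (log (arc a' b')) = embed (disp a' b').
    by rewrite -embed_coord1 coord1_arc.
  case: i => [|i] /=; last exact: PA.
  rewrite lglogM proj1_chart_mul PA (fE 1%N) ?add0r /u /t ?grid0 //.
have gm n : (0 < n)%N -> gprod m n = (E * arc 0 (t n))%g.
  case: n => // n _; elim: n => [|n IH]; first by rewrite /= mul1g.
  by rewrite [LHS]/= -/(gprod m n.+1) IH /arc -!mulgA mulVKg.
have [S [lS SE]] := gprod_conj m (c := c) (Z := Z) (n := N) (fun i _ => proj1 (Hc i)).
have sumE : \sum_(i < N) ad (P 1%N (log (m i))) (Z i) = - PE.
  rewrite WE.
  under eq_bigr => i _ do rewrite mP ZE linear_sum.
  rewrite exchange_big /=; apply: eq_bigr => k _.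
  rewrite -embed_delta (proj1 (Ha k)) linear_sum ad_suml; apply: eq_bigr => i _.
  by rewrite !linearZ /= adZ.
rewrite sumE in lS.
exists (S * E)%g; split.
  by apply: lead0_fil; have := leadM lS (lead_fil fE); rewrite addNr.
have -> : (S * E * arc 0 rho')%g = (S * gprod m N)%g.
  by rewrite gm // /t gridN // (mulgA S E).
rewrite -SE.
pose d := C * (sg * rho).
pose l i := d + (tau - (if i is 0%N then kap * rho else 0)) + d.
have rm i : (i < N)%N -> reach ((c i)^-1 * m i * c i)%g (l i).
  move=> iN; have [_ [r1 r1']] := Hc i.
  apply: reach_mul => //; apply: reach_mul => //.
  case: i iN r1 r1' => [|i] iN _ _; last first.
    rewrite subr0 /m /tau -(gridS rho' N i.+1).
    by apply: (reach_arc H) => //; exact: tT.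
  have -> : tau - kap * rho = (1 - kap) * rho + (tau - rho) by ring.
  have -> : m 0%N = (E * arc 0 rho * arc rho (t 1%N))%g.
    by rewrite /m /arc -!mulgA mulVKg.
  apply: reach_mul => //; rewrite -t1; apply: (reach_arc H) => //; first exact: ltW.
  exact: tT.
have q0 : 0 < kap * rho / 4 by rewrite divr_gt0 // mulr_gt0.
apply: (reach_le (reach_gprod q0 rm)).
have -> : \sum_(i < N) l i = N%:R * (d + tau + d) - kap * rho.
  have aux n (A k : R) : (0 < n)%N ->
      \sum_(i < n) (A - (if nat_of_ord i is 0%N then k else 0)) = n%:R * A - k.
    case: n => // n _; rewrite big_ord_recl /=.
    rewrite (eq_bigr (fun=> A)); last by move=> i _; rewrite subr0.
    by rewrite sumr_const card_ord -[_ *+ n]mulr_natl -natr1; ring.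
  by rewrite -aux //; apply: eq_bigr => i _; rewrite /l; case: (nat_of_ord i) => [|k]; ring.
have -> : N%:R * (d + tau + d) = rho' + kap * rho / 4.
  by rewrite /d /tau /sg; field; rewrite !gt_eqF.
have -> : (1 - kap / (2 * M)) * rho' = rho' - kap * rho / 2.
  by rewrite rM; field; rewrite gt_eqF.
lra.
Qed.

(** An error of degree greater than the step is trivial, and the curve is a
    minimizer. *)
Lemma no_shortcut : ~ shortcut s.+1.
Proof.
move=> [kap kap0 Hk]; have [|E [fE]] := Hk eta0; first by rewrite eta00 lexx.
have -> : E = 1%g by rewrite -[E]lglogK (fil_eq0 fE) lgexp0.
rewrite mul1g => /Hmin; rewrite eta00 eta0T => /(_ isT); have := mulr_gt0 kap0 eta00; lra.
Qed.

Lemma spread_absurd : False.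
Proof.
apply: no_shortcut.
have sj : forall j, (j < s)%N -> shortcut j.+2.
  elim=> [_|j IH js]; first exact: shortcut2.
  by apply: shortcutS => //; apply: IH; exact: ltnW.
by have := sj s.-1; case: s (step_gt0 G) => // s' _ /=; apply.
Qed.

End Stages.

(** * Vanishing of the excess along a sequence *)
Section Conclusion.
Context {R : realType} (G : carnotGroup R).
Variables (T : R) (gamma : R -> G) (h : 'I_(rank G) -> R -> R).

(** A curve to [gamma t] is completed by [gamma] itself on the rest of [0, T]. *)
Lemma minimizing_reach (t l : R) : length_minimizing 0 T gamma h ->
  arclength_parametrized 0 T h -> 0 < t <= T -> reach ((gamma 0)^-1 * gamma t)%g l -> t <= l.
Proof.
move=> [hor hlen] harc /andP[t0 tT] rl.
have T0 : 0 < T by exact: lt_le_trans tT.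
have H := horizontal_horizontal1 hor harc; have [_ mh _ _] := H.
have rT : reach ((gamma 0)^-1 * gamma T)%g (l + (T - t)).
  move: tT; rewrite le_eqVlt => /orP[/eqP <-|tT]; first by rewrite subrr addr0.
  have := reach_mul rl (reach_arc H (ltW t0) tT (lexx T)).
  by rewrite -mulgA mulVKg.
have := cc_dist_reach rT.
rewrite -hlen (hlength_arclength (ltW T0) mh harc) lee_fin; lra.
Qed.

Lemma excess_ge0 B : 0 <= excess gamma B.
Proof.
rewrite /excess; set S := (X in inf X).
have [[x Sx]|S0] := pselect (S !=set0); last first.
  have -> : S = set0 by rewrite -subset0 => x Sx; apply: S0; exists x.
  by rewrite inf0.
by apply: lb_le_inf; [exists x | move=> _ [v _ <-]; exact: sqrtr_ge0].
Qed.

Lemma small_excess (e d : R) : (2 <= rank G)%N -> 0 < T ->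
  length_minimizing 0 T gamma h -> arclength_parametrized 0 T h -> 0 < e -> 0 < d ->
  exists eta, [/\ 0 < eta < d, eta <= T & excess gamma `[0, eta] < e].
Proof.
move=> r2 T0 hmin harc e0 d0; apply: contrapT => no.
have H := horizontal_horizontal1 hmin.1 harc.
pose eta0 := Num.min (d / 2) T.
have eta00 : 0 < eta0 by rewrite lt_min T0 divr_gt0.
have eta0T : eta0 <= T by rewrite ge_min lexx orbT.
have eta0d : eta0 < d by rewrite gt_min; apply/orP; left; lra.
apply: (@spread_absurd R G T gamma h H _ e eta0) => //.
  by move=> t l; exact: minimizing_reach.
move=> eta v /andP[p0 p1] v1; apply: (excess_lower H) => //.
- by rewrite p0 (le_trans p1).
- exact: ltW.
- rewrite leNgt; apply/negP => lte; apply: no; exists eta; split => //.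
    by rewrite p0 (le_lt_trans p1).
  exact: le_trans eta0T.
Qed.

End Conclusion.

Theorem theorem4p1 (R : realType) (G : carnotGroup R) (hr : (2 <= rank G)%N)
    (T : R) (hT : 0 < T) (gamma : R -> G) (h : 'I_(rank G) -> R -> R)
    (hmin : length_minimizing 0 T gamma h)
    (harc : arclength_parametrized 0 T h) :
  exists eta : nat -> R,
    [/\ forall i, 0 < eta i <= T,
        decreasing_seq eta,
        eta @ \oo --> 0
      & excess gamma `[0, eta i] @[i --> \oo] --> 0].
Proof.
have /choice[f Hf] : forall p : nat * R, exists eta, 0 < p.2 ->
    [/\ 0 < eta < p.2, eta <= T, eta < harmonic p.1 & excess gamma `[0, eta] < harmonic p.1].
  move=> [m x] /=; have [x0|] := pselect (0 < x); last by exists 0.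
  have h0 := @harmonic_gt0 R m.
  have [||eta [/andP[e1 e2] e3 e4]] := @small_excess R G T gamma h (harmonic m) (Num.min x (harmonic m)) hr hT hmin harc.
  - exact: h0.
  - by rewrite lt_min x0.
  by exists eta => _; move: e2; rewrite lt_min => /andP[-> ->]; rewrite e1.
pose eta := fix eta i := if i is i'.+1 then f (i'.+1, eta i') else f (0%N, T).
have eta0 i : 0 < eta i.
  elim: i => [|i IH].
    by have [/andP[]] := Hf (0%N, T) hT.
  by have [/andP[]] := Hf (i.+1, eta i) IH.
have etaT i : eta i <= T.
  case: i => [|i]; first by have [_] := Hf (0%N, T) hT.
  by have [_] := Hf (i.+1, eta i) (eta0 i).
have etah i : eta i < harmonic i.
  case: i => [|i]; first by have [_ _] := Hf (0%N, T) hT.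
  by have [_ _] := Hf (i.+1, eta i) (eta0 i).
have exh i : excess gamma `[0, eta i] < harmonic i.
  case: i => [|i]; first by have [_ _ _] := Hf (0%N, T) hT.
  by have [_ _ _] := Hf (i.+1, eta i) (eta0 i).
have squeeze (u : nat -> R) : (forall i, 0 <= u i) -> (forall i, u i < harmonic i) ->
    u @ \oo --> 0.
  move=> u0 uh; apply: (@squeeze_cvgr _ _ _ _ (cst 0) (@harmonic R)).
  - by apply: nearW => i; rewrite u0 ltW.
  - exact: cvg_cst.
  - exact: cvg_harmonic.
exists eta; split.
- by move=> i; rewrite eta0 etaT.
- apply/decreasing_seqP => i.
  by have [/andP[]] := Hf (i.+1, eta i) (eta0 i).
- by apply: squeeze => // i; exact: ltW.
- by apply: squeeze => // i; exact: excess_ge0.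
Qed.
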